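(* Let $k$ be a field and $q\in k^\times$ not a root of unity. Let $Q$ be the quiver with two vertices $1,2$, arrows $\gamma,\delta:1\to2$, arrows $\alpha,\beta:2\to1$, and a loop $\tau:2\to2$, with all arrows of degree $1$. Then the formulas $$B=kQ/(\beta\delta,\ \delta\beta,\ \beta\tau,\ \tau\delta,\ \tau^2,\ \gamma\beta-q\delta\alpha,\ \gamma\alpha-(q-1)\delta\alpha),$$ $$d\beta=\alpha\tau,\qquad d\delta=\tau\gamma,\qquad d\alpha=d\gamma=d\tau=0,\qquad de_1=de_2=0$$ (where $e_1,e_2$ are the vertex idempotents) define a dg algebra $B$ of total dimension $17$, with $\dim_kB^i=2,5,6,3,1$ and $\dim_kH^i(B)=2,3,3,2,1$ for $i=0,1,2,3,4$ respectively. There is a zigzag of quasi-isomorphisms of dg algebras between $B$ and $A=\mathrm{End}_\Lambda(\Lambda\oplus V)$, under which $e_1$ corresponds to the projection $e$ onto $\Lambda$, where $$\Lambda=k\langle x,y\rangle/(x^2,y^2,xy-qyx),\quad|x|=|y|=2,\qquad V=(\Lambda/(x+y)\Lambda)[-1].$$ Moreover, the quotient $$C=B/Be_1B=k[\tau]/(\tau^2),\qquad|\tau|=1,\qquad d_C=0,$$ viewed as a right dg $B$-module, satisfies $C\neq0$ and $\mathrm{Hom}_B(C,B)=0$. In particular, $B$ does not cogenerate $\mathrm{Mod}_B$, and this is witnessed by a module which is itself finite dimensional.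
   Context: Cohomological grading is used. Paths in a quiver are composed from right to left (e.g. $\alpha\gamma$ means first $\gamma$, then $\alpha$, and lies in $e_1Be_1$); the differential has degree $+1$ and is extended by the graded Leibniz rule $d(ab)=(da)b+(-1)^{|a|}a\,(db)$. $\Lambda$ is regarded as a dg algebra with zero differential and $V$ as a right dg $\Lambda$-module with zero differential. $\mathrm{Hom}$ and $\mathrm{End}$ are derived. $\mathrm{Mod}_B$ is the dg derived category of unbounded right dg $B$-modules; $B$ cogenerates $\mathrm{Mod}_B$ if, for $M\in\mathrm{Mod}_B$, $\mathrm{Hom}_B(M,B)=0$ implies $M=0$. *)

(* Defs.v *)
From HB Require Import structures.
From mathcomp Require Import all_boot all_algebra.
From mathcomp Require Import boolp functions.
From mathcomp Require Import finmap.
From mathcomp.multinomials Require Import monalg.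

Set Implicit Arguments.
Unset Strict Implicit.
Unset Printing Implicit Defensive.

Import GRing.Theory.
Local Open Scope ring_scope.

(* * Gradings *)

(* V is the internal direct sum of the subspaces [h i]; an element of V is a
   finite sum of homogeneous ones, so V stands for the total space. *)
Record is_grading (k : fieldType) (V : lmodType k) (h : int -> V -> Prop) :
    Prop := IsGrading {
  gr0 : forall i, h i 0;
  gr_lin : forall i c u v, h i u -> h i v -> h i (c *: u + v);
  gr_span : forall v, exists sf : seq int * (int -> V),
    [/\ uniq sf.1, forall i, h i (sf.2 i) & v = \sum_(i <- sf.1) sf.2 i];
  gr_free : forall (s : seq int) (f : int -> V),
    uniq s -> (forall i, h i (f i)) -> \sum_(i <- s) f i = 0 ->
    forall i, i \in s -> f i = 0 }.

Section Grading.
Variables (k : fieldType) (V : lmodType k) (h : int -> V -> Prop).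

Definition decomposition (v : V) (sf : seq int * (int -> V)) :=
  [/\ uniq sf.1, forall i, h i (sf.2 i) & v = \sum_(i <- sf.1) sf.2 i].

Definition pad (sf : seq int * (int -> V)) i := if i \in sf.1 then sf.2 i else 0.

Section Linear.
Hypothesis h0 : forall i, h i 0.
Hypothesis hlin : forall i c u v, h i u -> h i v -> h i (c *: u + v).

Lemma pad_sum (I : eqType) (W : zmodType) (s u : seq I) (f : I -> W) :
  uniq s -> uniq u -> {subset s <= u} ->
  \sum_(i <- u) (if i \in s then f i else 0) = \sum_(i <- s) f i.
Proof.
move=> us uu su; rewrite -big_mkcond -big_filter; apply: perm_big.
apply: uniq_perm; rewrite ?filter_uniq // => i; rewrite mem_filter.
by case: (boolP (i \in s)) => // /su ->.
Qed.

Lemma pad_decomp v sf u : decomposition v sf -> uniq u ->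
  {subset sf.1 <= u} ->
  decomposition v (u, pad sf).
Proof.
case=> us hf -> uu su; split=> //= [i|]; last by rewrite pad_sum.
by rewrite /pad; case: ifP.
Qed.

Lemma decomp_lin c v w sv sw : decomposition v sv -> decomposition w sw ->
  exists s, decomposition (c *: v + w) s.
Proof.
move=> dv dw; pose u := undup (sv.1 ++ sw.1).
have uu : uniq u by apply: undup_uniq.
have [||_ hv ev] := pad_decomp dv (u := u) => //.
  by move=> i; rewrite mem_undup mem_cat => ->.
have [||_ hw ew] := pad_decomp dw (u := u) => //.
  by move=> i; rewrite mem_undup mem_cat orbC => ->.
exists (u, fun i => c *: pad sv i + pad sw i); split=> //= [i|]; first exact: hlin.
by rewrite big_split -scaler_sumr /= -ev -ew.
Qed.

Lemma decomp_homog n v : h n v -> exists s, decomposition v s.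
Proof.
move=> hv; exists ([:: n], fun i => if i == n then v else 0); split=> //= [i|].
  by case: eqP => [->|].
by rewrite big_seq1 eqxx.
Qed.

End Linear.

Section Extension.
Hypothesis G : is_grading h.

Lemma gr_ind (P : V -> Prop) : (forall u v, P u -> P v -> P (u + v)) ->
  (forall i v, h i v -> P v) -> forall v, P v.
Proof.
move=> PD Ph v; have [[s f] [_ hf ->]] := gr_span G v.
elim/big_ind: _ => //; first exact: (Ph 0 _ (gr0 G 0)).
by move=> i _; apply: Ph (hf i).
Qed.

Lemma grZ i c v : h i v -> h i (c *: v).
Proof. by move=> hv; rewrite -[c *: v]addr0; apply: gr_lin => //; apply: gr0. Qed.

Lemma grB i u v : h i u -> h i v -> h i (u - v).
Proof. by move=> hu hv; rewrite addrC -scaleN1r; apply: gr_lin. Qed.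

(* The additive map which is [F i] on the elements of degree i. *)
Definition extend (W : zmodType) (F : int -> V -> W) (v : V) : W :=
  let sf := sval (cid (gr_span G v)) in \sum_(i <- sf.1) F i (sf.2 i).

Lemma decomp_uniq (W : zmodType) (F : int -> V -> W) v sf tg :
  (forall i, F i 0 = 0) -> decomposition v sf -> decomposition v tg ->
  \sum_(i <- sf.1) F i (sf.2 i) = \sum_(i <- tg.1) F i (tg.2 i).
Proof.
move=> F0 df dg; pose u := undup (sf.1 ++ tg.1).
have uu : uniq u by apply: undup_uniq.
have su : {subset sf.1 <= u} by move=> i; rewrite mem_undup mem_cat => ->.
have tu : {subset tg.1 <= u}.
  by move=> i; rewrite mem_undup mem_cat orbC => ->.
have [us _ _] := df; have [ut _ _] := dg.
have [_ hf ef] := pad_decomp (gr0 G) df uu su.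
have [_ hg eg] := pad_decomp (gr0 G) dg uu tu.
rewrite -(pad_sum (fun i => F i (sf.2 i)) us uu su).
rewrite -(pad_sum (fun i => F i (tg.2 i)) ut uu tu).
rewrite !big_seq; apply: eq_bigr => i iu.
have -> (x : V) b : (if b then F i x else 0) = F i (if b then x else 0).
  by case: b; rewrite ?F0.
have -> (x : V) b : (if b then F i x else 0) = F i (if b then x else 0).
  by case: b; rewrite ?F0.
congr F; apply/eqP; rewrite -subr_eq0; apply/eqP.
apply: (gr_free G uu (f := fun i => pad sf i - pad tg i)) => //.
  by move=> j; rewrite addrC -scaleN1r; apply: gr_lin.
by rewrite sumrB /= -ef -eg subrr.
Qed.

Lemma extend_homog (W : zmodType) (F : int -> V -> W) n v :
  (forall i, F i 0 = 0) -> h n v -> extend F v = F n v.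
Proof.
move=> F0 hv; rewrite /extend; case: cid => /= sf df.
have d1 : decomposition v ([:: n], fun i => if i == n then v else 0).
  split=> //= [i|]; last by rewrite big_seq1 eqxx.
  by case: eqP => [->|] //; move=> _; apply: gr0.
by rewrite (decomp_uniq F0 df d1) /= big_seq1 eqxx.
Qed.

Lemma extend_linear (W : lmodType k) (F : int -> V -> W) :
  (forall i c u v, h i u -> h i v -> F i (c *: u + v) = c *: F i u + F i v) ->
  linear (extend F).
Proof.
move=> Fl c v w.
have F0 i : F i 0 = 0.
  have := Fl i (-1) 0 0 (gr0 G i) (gr0 G i).
  by rewrite scaler0 addr0 scaleN1r addNr.
rewrite {2 3}/extend; case: cid => sf df /=; case: cid => tg dg /=.
pose u := undup (sf.1 ++ tg.1).
have uu : uniq u by apply: undup_uniq.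
have su : {subset sf.1 <= u} by move=> i; rewrite mem_undup mem_cat => ->.
have tu : {subset tg.1 <= u}.
  by move=> i; rewrite mem_undup mem_cat orbC => ->.
have pf := pad_decomp (gr0 G) df uu su.
have pg := pad_decomp (gr0 G) dg uu tu.
rewrite (decomp_uniq F0 df pf) (decomp_uniq F0 dg pg) /=.
have dd : decomposition (c *: v + w) (u, fun i => c *: pad sf i + pad tg i).
  case: pf => _ hf ->; case: pg => _ hg ->; split=> //= [i|].
    exact: (gr_lin G).
  by rewrite big_split -scaler_sumr.
rewrite /extend; case: cid => sd ds /=; rewrite (decomp_uniq F0 ds dd) /=.
have [_ hf _] := pf; have [_ hg _] := pg.
by rewrite scaler_sumr -big_split; apply: eq_bigr => i _; apply: Fl.
Qed.

End Extension.
End Grading.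

(* * Complexes *)

HB.mixin Record isComplex (k : fieldType) V of GRing.Lmodule k V := {
  homog : int -> V -> Prop;
  diff : V -> V;
  homog_grading : is_grading homog;
  diff_linear : linear diff;
  diff_homog : forall i v, homog i v -> homog (i + 1) (diff v);
  diff_diff : forall v, diff (diff v) = 0
}.

#[short(type="complexType")]
HB.structure Definition Complex (k : fieldType) :=
  {V of isComplex k V & GRing.Lmodule k V}.

Definition acyclic (k : fieldType) (V : complexType k) :=
  forall v : V, diff v = 0 -> exists u : V, v = diff u.

Definition chain_map (k : fieldType) (V W : complexType k) (f : V -> W) :=
  [/\ linear f, forall i v, homog i v -> homog i (f v)
    & forall v, f (diff v) = diff (f v)].

(* As f preserves degrees, it is bijective on ker(diff) / im(diff) iff it is
   so on each cohomology group. *)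
Definition quasi_iso (k : fieldType) (V W : complexType k) (f : V -> W) :=
  [/\ chain_map f,
      forall v, diff v = 0 -> (exists w, f v = diff w) -> exists u, v = diff u
    & forall w, diff w = 0 ->
        exists v u, diff v = 0 /\ w = f v + diff u].

Definition cocycle (k : fieldType) (V : complexType k) i (v : V) :=
  homog i v /\ diff v = 0.

Definition coboundary (k : fieldType) (V : complexType k) i (v : V) :=
  exists2 u : V, homog (i - 1) u & v = diff u.

(* dim (Z / W) = n, for subspaces W <= Z of V: the classes of the z i form a
   basis of Z / W. *)
Definition subquotient_dim (k : fieldType) (V : lmodType k) (Z W : V -> Prop)
    (n : nat) :=
  exists z : 'I_n -> V,
  [/\ forall i, Z (z i),
      forall v, Z v -> exists c : 'I_n -> k, W (v - \sum_i c i *: z i)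
    & forall c : 'I_n -> k, W (\sum_i c i *: z i) -> forall i, c i = 0].

Definition subspace_dim (k : fieldType) (V : lmodType k) (Z : V -> Prop) n :=
  subquotient_dim Z (eq^~ 0) n.

Definition space_dim (k : fieldType) (V : lmodType k) n :=
  subspace_dim (fun _ : V => True) n.

Definition cohomology_dim (k : fieldType) (V : complexType k) (i : int) n :=
  subquotient_dim (@cocycle k V i) (@coboundary k V i) n.

(* * Dg algebras *)

HB.mixin Record isDGAlgebra (k : fieldType) A
    of Complex k A & GRing.Algebra k A := {
  homog1 : homog 0 (1 : A);
  homogM : forall i j (a b : A), homog i a -> homog j b -> homog (i + j) (a * b);
  diffM : forall i (a b : A), homog i a ->
    diff (a * b) = diff a * b + (-1 : k) ^ i *: (a * diff b)
}.

#[short(type="dgAlgType")]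
HB.structure Definition DGAlgebra (k : fieldType) :=
  {A of isDGAlgebra k A & Complex k A & GRing.Algebra k A}.

Record dgAlgHom (k : fieldType) (A B : dgAlgType k) := DGAlgHom {
  dgah_fun :> A -> B;
  dgah_chain : chain_map dgah_fun;
  dgah1 : dgah_fun 1 = 1;
  dgahM : {morph dgah_fun : a b / a * b} }.

Definition closed_idempotent (k : fieldType) (A : dgAlgType k) (e : A) :=
  e * e = e /\ cocycle 0 e.

(* [zigzag e f]: the dg algebras of e and f are joined by a finite chain of
   quasi-isomorphisms of dg algebras, of either direction, each member of
   which carries a closed idempotent of degree 0; the maps send these
   idempotents to each other, those at the ends being e and f. *)
Inductive zigzag (k : fieldType) :
    forall A B : dgAlgType k, A -> B -> Prop :=
| ZigzagNil (A : dgAlgType k) (e : A) : closed_idempotent e -> zigzag e e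
| ZigzagForward (A B C : dgAlgType k) (f : dgAlgHom A B) (e : A) (e' : C) :
    closed_idempotent e -> quasi_iso f -> zigzag (f e) e' -> zigzag e e'
| ZigzagBackward (A B C : dgAlgType k) (f : dgAlgHom B A) (e : B) (e' : C) :
    closed_idempotent e -> quasi_iso f -> zigzag e e' -> zigzag (f e) e'.

(* The two-sided ideal generated by S. *)
Inductive ideal (R : pzRingType) (S : R -> Prop) : R -> Prop :=
| IdealGen r : S r -> ideal S r
| Ideal0 : ideal S 0
| IdealD r s : ideal S r -> ideal S s -> ideal S (r + s)
| IdealMl r s : ideal S s -> ideal S (r * s)
| IdealMr r s : ideal S r -> ideal S (r * s).

(* * Right dg modules *)

HB.mixin Record isDGModule (k : fieldType) (A : dgAlgType k) M
    of Complex k M := {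
  ract : M -> A -> M;
  ract_linearl : forall a, linear (ract^~ a);
  ract_linearr : forall m, linear (ract m);
  ract1 : forall m, ract m 1 = m;
  ractM : forall m a b, ract m (a * b) = ract (ract m a) b;
  ract_homog : forall i j m a, homog i m -> homog j a -> homog (i + j) (ract m a);
  diff_ract : forall i m a, homog i m ->
    diff (ract m a) = ract (diff m) a + (-1 : k) ^ i *: ract m (diff a)
}.

#[short(type="dgModType")]
HB.structure Definition DGModule (k : fieldType) (A : dgAlgType k) :=
  {M of isDGModule k A M & Complex k M}.

Section DGModules.
Variables (k : fieldType) (A : dgAlgType k).

Definition mod_linear (M N : dgModType A) (f : M -> N) :=
  linear f /\ forall m (a : A), f (ract m a) = ract (f m) a.

(* The degree n part of the complex Hom_A(M, N), and its differential. *)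
Definition hom_deg (M N : dgModType A) (n : int) (f : M -> N) :=
  mod_linear f /\ forall i m, homog i m -> homog (i + n) (f m).

Definition hom_diff (M N : dgModType A) (n : int) (f : M -> N) : M -> N :=
  fun m => diff (f m) - (-1 : k) ^ n *: f (diff m).

Definition hom_acyclic (M N : dgModType A) :=
  forall n (f : M -> N), hom_deg n f -> hom_diff n f =1 (fun=> 0) ->
  exists2 g : M -> N, hom_deg (n - 1) g & f =1 hom_diff (n - 1) g.

Definition K_projective (P : dgModType A) :=
  forall N : dgModType A, acyclic N -> hom_acyclic P N.

Definition K_projective_resolution (P M : dgModType A) (eps : P -> M) :=
  [/\ K_projective P, mod_linear eps & quasi_iso eps].

(* The derived Hom complex is computed by a K-projective resolution of the
   first argument, and does not depend on it up to quasi-isomorphism. *)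
Definition derived_hom_zero (M N : dgModType A) :=
  exists (P : dgModType A) (eps : P -> M),
    K_projective_resolution eps /\ hom_acyclic P N.

End DGModules.

(* A as a right dg module over itself. *)
Definition regular (k : fieldType) (A : dgAlgType k) : Type := A.

Section Regular.
Variables (k : fieldType) (A : dgAlgType k).
HB.instance Definition _ := Complex.on (regular A).

Definition regular_act (m : regular A) (a : A) : regular A := (m : A) * a.

Let regular_linearl a : linear (regular_act^~ a).
Proof. by move=> c u v; rewrite /regular_act mulrDl scalerAl. Qed.
Let regular_linearr m : linear (regular_act m).
Proof. by move=> c u v; rewrite /regular_act mulrDr scalerAr. Qed.
Let regular1 m : regular_act m 1 = m. Proof. exact: mulr1. Qed.
Let regularM m a b :
  regular_act m (a * b) = regular_act (regular_act m a) b.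
Proof. exact: mulrA. Qed.
HB.instance Definition _ := isDGModule.Build k A (regular A)
  regular_linearl regular_linearr regular1 regularM
  (@homogM k A) (@diffM k A).
End Regular.

(* A cogenerates Mod_A; an object of Mod_A is zero iff it is acyclic. *)
Definition cogenerates (k : fieldType) (A : dgAlgType k) :=
  forall M : dgModType A, derived_hom_zero M (regular A) -> acyclic M.

(* Restriction of the regular module along a morphism of dg algebras. *)
Definition restriction (k : fieldType) (A C : dgAlgType k)
  (f : dgAlgHom A C) : Type := C.

Section Restriction.
Variables (k : fieldType) (A C : dgAlgType k) (f : dgAlgHom A C).
HB.instance Definition _ := Complex.on (restriction f).

Definition restriction_act (m : restriction f) (a : A) : restriction f :=
  (m : C) * f a.

Let restriction_linearl a : linear (restriction_act^~ a).
Proof. by move=> c u v; rewrite /restriction_act mulrDl scalerAl. Qed.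
Let restriction_linearr m : linear (restriction_act m).
Proof.
have [fl _ _] := dgah_chain f.
by move=> c u v; rewrite /restriction_act fl mulrDr scalerAr.
Qed.
Let restriction1 m : restriction_act m 1 = m.
Proof. by rewrite /restriction_act dgah1 mulr1. Qed.
Let restrictionM m a b :
  restriction_act m (a * b) = restriction_act (restriction_act m a) b.
Proof. by rewrite /restriction_act dgahM mulrA. Qed.
Let restriction_homog i j (m : restriction f) (a : A) :
  homog i m -> homog j a -> homog (i + j) (restriction_act m a).
Proof.
by have [_ fh _] := dgah_chain f => hm ha; apply: homogM => //; apply: fh.
Qed.
Let restriction_diff i (m : restriction f) (a : A) : homog i m ->
  diff (restriction_act m a) =
  restriction_act (diff m) a + (-1 : k) ^ i *: restriction_act m (diff a).
Proof.
have [_ _ fd] := dgah_chain f => hm.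
by rewrite /restriction_act (diffM _ _ _ hm) fd.
Qed.
HB.instance Definition _ := isDGModule.Build k A (restriction f)
  restriction_linearl restriction_linearr restriction1 restrictionM
  restriction_homog restriction_diff.
End Restriction.

(* M = (A / aA)[-1], where (N[-1])^i = N^(i - 1); v is the projection. *)
Definition shifted_cyclic (k : fieldType) (A : dgAlgType k) (a : A)
    (M : dgModType A) (v : A -> M) : Prop :=
  [/\ linear v /\ (forall b c, v (b * c) = ract (v b) c),
      forall m : M, exists b : A, v b = m,
      forall b : A, v b = 0 <-> exists c : A, b = a * c
    & forall i (m : M), homog i m <-> exists2 b : A, homog (i - 1) b & v b = m].

(* * Direct sums *)

Section DirectSum.
Variables (k : fieldType) (V W : complexType k).

Definition prod_homog i (x : V * W) := homog i x.1 /\ homog i x.2.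
Definition prod_diff (x : V * W) : V * W := (diff x.1, diff x.2).

Let prod_grading : is_grading prod_homog.
Proof.
have GV := @homog_grading k V; have GW := @homog_grading k W.
have lin i c u v : prod_homog i u -> prod_homog i v ->
    prod_homog i (c *: u + v).
  by case=> u1 u2 [v1 v2]; split; apply: gr_lin.
have zero i : prod_homog i 0 by split; apply: gr0.
split=> // [[x y]|s f us hf s0 i si].
  have -> : (x, y) = 1 *: (x, 0) + (0, y) :> V * W.
    by rewrite scale1r; congr pair; rewrite /= ?addr0 ?add0r.
  have [[s f] [us hf ->]] := gr_span GV x.
  have [[t g] [ut hg ->]] := gr_span GW y.
  apply: (@decomp_lin k (V * W)%type prod_homog zero lin 1 _ _
            (s, fun i => (f i, 0)) (t, fun i => (0, g i))); split=> //=.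
  - by move=> i; split=> //; apply: gr0.
  - rewrite [RHS]surjective_pairing; congr pair.
      by rewrite (raddf_sum fst).
    by rewrite (raddf_sum snd) big1.
  - by move=> i; split=> //; apply: gr0.
  - rewrite [RHS]surjective_pairing; congr pair.
      by rewrite (raddf_sum fst) big1.
    by rewrite (raddf_sum snd).
have e1 : \sum_(i <- s) (f i).1 = 0 by rewrite -(raddf_sum fst) s0.
have e2 : \sum_(i <- s) (f i).2 = 0 by rewrite -(raddf_sum snd) s0.
rewrite [f i]surjective_pairing.
rewrite (gr_free GV us (fun j => (hf j).1) e1 si).
by rewrite (gr_free GW us (fun j => (hf j).2) e2 si).
Qed.

Let prod_diff_linear : linear prod_diff.
Proof. by move=> c u v; rewrite /prod_diff /= !diff_linear. Qed.
Let prod_diff_homog i v : prod_homog i v -> prod_homog (i + 1) (prod_diff v).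
Proof. by case=> v1 v2; split; apply: diff_homog. Qed.
Let prod_diff_diff v : prod_diff (prod_diff v) = 0.
Proof. by rewrite /prod_diff /= !diff_diff. Qed.

HB.instance Definition _ := isComplex.Build k (V * W)%type
  prod_grading prod_diff_linear prod_diff_homog prod_diff_diff.
End DirectSum.

Section DirectSumModule.
Variables (k : fieldType) (A : dgAlgType k) (M N : dgModType A).

Definition prod_act (x : M * N) (a : A) : M * N := (ract x.1 a, ract x.2 a).

Let prod_linearl a : linear (prod_act^~ a).
Proof. by move=> c u v; rewrite /prod_act /= !ract_linearl. Qed.
Let prod_linearr m : linear (prod_act m).
Proof. by move=> c a b; rewrite /prod_act /= !ract_linearr. Qed.
Let prod1 m : prod_act m 1 = m.
Proof. by rewrite /prod_act !ract1 -surjective_pairing. Qed.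
Let prodM m a b : prod_act m (a * b) = prod_act (prod_act m a) b.
Proof. by rewrite /prod_act !ractM. Qed.
Let prod_act_homog i j (m : M * N) (a : A) :
  homog i m -> homog j a -> homog (i + j) (prod_act m a).
Proof. by case=> m1 m2 ha; split; apply: ract_homog. Qed.
Let prod_act_diff i (m : M * N) (a : A) : homog i m ->
  diff (prod_act m a) =
  prod_act (diff m) a + (-1 : k) ^ i *: prod_act m (diff a).
Proof.
by case=> m1 m2; congr pair; rewrite /= (diff_ract _ _ _ m1, diff_ract _ _ _ m2).
Qed.
HB.instance Definition _ := isDGModule.Build k A (M * N)%type
  prod_linearl prod_linearr prod1 prodM prod_act_homog prod_act_diff.
End DirectSumModule.

(* * Endomorphism dg algebras *)

Section Endomorphisms.
Variables (k : fieldType) (A : dgAlgType k) (P : dgModType A).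

(* The total space of the complex Hom_A(P, P): finite sums of homogeneous
   A-linear maps. *)
Inductive finite_endo : (P -> P) -> Prop :=
| FiniteEndoDeg n f : hom_deg n f -> finite_endo f
| FiniteEndoD f g : finite_endo f -> finite_endo g -> finite_endo (f + g).

Definition is_endo : pred (P -> P) := fun f => `[< finite_endo f >].

Lemma linear0f (U V : lmodType k) (f : U -> V) : linear f -> f 0 = 0.
Proof. by move=> fl; have := fl (-1) 0 0; rewrite scaler0 addr0 scaleN1r addNr. Qed.
Lemma linearDf (U V : lmodType k) (f : U -> V) : linear f ->
  {morph f : u v / u + v}.
Proof. by move=> fl u v; have := fl 1 u v; rewrite !scale1r. Qed.
Lemma linearZf (U V : lmodType k) (f : U -> V) : linear f ->
  forall c, {morph f : u / c *: u}.
Proof. by move=> fl c u; have := fl c u 0; rewrite (linear0f fl) !addr0. Qed.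
Lemma linearBf (U V : lmodType k) (f : U -> V) : linear f ->
  {morph f : u v / u - v}.
Proof.
move=> fl u v; rewrite (linearDf fl) -scaleN1r (linearZf fl) scaleN1r //.
Qed.

Lemma hom_deg0 n : hom_deg n (0 : P -> P).
Proof.
split; last by move=> i m _; apply: (gr0 (@homog_grading k P)).
split=> [c u v|m a]; first by rewrite /= scaler0 addr0.
by rewrite (linear0f (ract_linearl a)).
Qed.

Lemma hom_deg_lin n c (f g : P -> P) :
  hom_deg n f -> hom_deg n g -> hom_deg n (c *: f + g).
Proof.
move=> [[fl fA] fd] [[gl gA] gd]; split; last first.
  move=> i m hm.
  exact: (gr_lin (@homog_grading k P) _ (fd _ _ hm) (gd _ _ hm)).
split=> [b u v|m a].
  rewrite !fctE fl gl !scalerDr !scalerA [c * b]mulrC.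
  by rewrite -!addrA; congr (_ + _); rewrite addrCA.
by rewrite !fctE fA gA ract_linearl.
Qed.

Lemma hom_deg1 : hom_deg 0 (@id P).
Proof. by split=> // i m; rewrite addr0. Qed.

Lemma hom_deg_comp i j (f g : P -> P) :
  hom_deg i f -> hom_deg j g -> hom_deg (i + j) (f \o g).
Proof.
move=> [[fl fA] fd] [[gl gA] gd]; split; last first.
  by move=> n m hm; rewrite [i + j]addrC addrA; apply/fd/gd.
split=> [c u v|m a] /=; first by rewrite gl fl.
by rewrite gA fA.
Qed.

Lemma hom_diff_deg n (f : P -> P) : hom_deg n f -> hom_deg (n + 1) (hom_diff n f).
Proof.
move=> hf; have [[fl fA] fd] := hf; have GP := @homog_grading k P.
split; last first.
  move=> i m hm; rewrite /hom_diff; apply: (grB GP).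
    by rewrite addrA; apply/diff_homog/fd.
  by apply: (grZ GP); rewrite [n + 1]addrC addrA; apply/fd/diff_homog.
split=> [c u v|m a].
  rewrite /hom_diff fl !diff_linear fl.
  rewrite !scalerBr scalerDr opprD !scalerA [c * _]mulrC.
  by rewrite -!addrA; congr (_ + _); rewrite addrCA.
elim/(gr_ind GP): m => [u v IHu IHv|i m hm].
  rewrite (linearDf (ract_linearl a)) /hom_diff.
  rewrite !(linearDf fl) !(linearDf diff_linear) !(linearDf fl).
  move: IHu IHv; rewrite /hom_diff => IHu IHv.
  rewrite scalerDr opprD addrACA IHu IHv -(linearDf (ract_linearl a)) /=.
  by apply: (congr1 (fun x => ract x a)); rewrite scalerDr opprD addrACA.
rewrite /hom_diff fA (diff_ract _ _ _ (fd _ _ hm)) (diff_ract _ _ _ hm).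
rewrite (linearDf fl) (linearZf fl) !fA.
rewrite (linearBf (ract_linearl a)) (linearZf (ract_linearl a)).
rewrite scalerDr opprD scalerA addrACA.
by rewrite expfzDr ?oppr_eq0 ?oner_eq0 // [X in X *: _ - _]mulrC subrr addr0.
Qed.

Lemma endo_closed : submod_closed is_endo.
Proof.
split=> [|c f g].
  by apply/asboolP; apply: FiniteEndoDeg; apply: (hom_deg0 0).
move=> /asboolP hf /asboolP hg; apply/asboolP.
apply: FiniteEndoD hg; elim: hf => {f g} [n f hf|f g _ hf _ hg].
  apply: (@FiniteEndoDeg n); rewrite -[c *: f]addr0.
  exact: hom_deg_lin hf (hom_deg0 n).
by rewrite scalerDr; apply: FiniteEndoD.
Qed.

HB.instance Definition _ := GRing.isSubmodClosed.Build k (P -> P) is_endo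
  endo_closed.

Hypothesis P_neq0 : exists x : P, x != 0.

(* The dg algebra End_A(P). MathComp's [algType] excludes the zero algebra,
   hence the assumption that P is nonzero. *)
Definition dgEnd of (exists x : P, x != 0) : Type := {f : P -> P | is_endo f}.
Local Notation E := (dgEnd P_neq0).

Definition endo_fun (f : E) : P -> P := val f.

HB.instance Definition _ := SubChoice.on E.
HB.instance Definition _ := [SubChoice_isSubLmodule of E by <:].

Lemma endo_valE c (f g : E) : val (c *: f + g) = c *: val f + val g.
Proof. by []. Qed.

Lemma endoP (f : E) : finite_endo (val f).
Proof. exact/asboolP/(valP f). Qed.

Lemma endo_mod_linear (f : E) : mod_linear (val f).
Proof.
have := endoP f; elim=> [n g [] //|g h _ [gl gA] _ [hl hA]].
split=> [c u v|m a]; rewrite !fctE ?gl ?hl ?scalerDr.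
  by rewrite addrACA.
by rewrite gA hA (linearDf (ract_linearl a)).
Qed.

Lemma endo_comp_subproof (f g : E) : is_endo (val f \o val g).
Proof.
apply/asboolP; have := endoP g; have := endoP f.
elim=> [n f' hf hg|f1 f2 _ h1 _ h2 hg]; last first.
  by rewrite (_ : _ \o _ = f1 \o val g + (f2 \o val g));
     [apply: FiniteEndoD; [apply: h1|apply: h2]|].
have [[fl _] _] := hf; elim: hg => [m g' hg|g1 g2 _ h1 _ h2].
  exact: FiniteEndoDeg (hom_deg_comp hf hg).
rewrite (_ : _ \o _ = f' \o g1 + (f' \o g2)); first exact: FiniteEndoD.
by apply: funext => x; rewrite /= !fctE (linearDf fl).
Qed.

Definition endo_comp (f g : E) : E := Sub _ (endo_comp_subproof f g).

Lemma endo_id_subproof : is_endo (@id P).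
Proof. by apply/asboolP; apply: FiniteEndoDeg hom_deg1. Qed.

Definition endo_id : E := Sub _ endo_id_subproof.

Let endo_compA : associative endo_comp.
Proof. by move=> f g h; apply: val_inj. Qed.
Let endo_comp1l : left_id endo_id endo_comp.
Proof. by move=> f; apply: val_inj. Qed.
Let endo_comp1r : right_id endo_id endo_comp.
Proof. by move=> f; apply: val_inj. Qed.
Let endo_compDl : left_distributive endo_comp +%R.
Proof. by move=> f g h; apply: val_inj. Qed.
Let endo_compDr : right_distributive endo_comp +%R.
Proof.
move=> f g h; apply: val_inj; apply: funext => x /=.
by rewrite (linearDf (endo_mod_linear f).1).
Qed.
Let endo_id_neq0 : endo_id != 0.
Proof.
apply/eqP => /(congr1 val) /= e; have [x /eqP[]] := P_neq0.
by rewrite -[x]/(id x) e.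
Qed.

HB.instance Definition _ := GRing.Zmodule_isNzRing.Build E
  endo_compA endo_comp1l endo_comp1r endo_compDl endo_compDr endo_id_neq0.

Let endo_scaleAl (c : k) (f g : E) : c *: (f * g) = (c *: f) * g.
Proof. exact: val_inj. Qed.
HB.instance Definition _ := GRing.Lmodule_isLalgebra.Build k E endo_scaleAl.
Let endo_scaleAr (c : k) (f g : E) : c *: (f * g) = f * (c *: g).
Proof.
apply: val_inj; apply: funext => x /=.
by rewrite (linearZf (endo_mod_linear f).1).
Qed.
HB.instance Definition _ := GRing.Lalgebra_isAlgebra.Build k E endo_scaleAr.

Definition endo_homog n (f : E) := hom_deg n (endo_fun f).

Lemma endo_grading : is_grading endo_homog.
Proof.
have GP := @homog_grading k P.
have zero i : endo_homog i 0 by apply: hom_deg0.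
have lin i c (u v : E) : endo_homog i u -> endo_homog i v ->
  endo_homog i (c *: u + v) by apply: hom_deg_lin.
split=> // [f|s f us hf s0 i si].
  have hf := endoP f; case: f hf => f fP /= hf.
  elim: hf fP => {f} [n f hf fP|f g hf IHf hg IHg fP].
    exact: (@decomp_homog k E endo_homog zero n).
  have ff : is_endo f by apply/asboolP.
  have fg : is_endo g by apply/asboolP.
  have [sf df] := IHf ff; have [sg dg] := IHg fg.
  have [s ds] := decomp_lin zero lin 1 df dg.
  exists s; set x := exist _ _ _.
  suff -> : x = 1 *: (Sub f ff : E) + (Sub g fg : E) by [].
  by rewrite scale1r; apply: val_inj.
apply: val_inj; apply: funext; elim/(gr_ind GP) => [u v hu hv|n x hx].
  by rewrite (linearDf (endo_mod_linear _).1) hu hv addr0.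
pose g j := val (f (j - n)) x.
have us' : uniq [seq j + n | j <- s] by rewrite map_inj_uniq //; apply: addIr.
have := gr_free GP us' (f := g).
have hg j : homog j (g j).
  by have [_ /(_ _ _ hx)] := hf (j - n); rewrite addrC subrK.
move=> /(_ hg); rewrite big_map.
have -> : \sum_(j <- s) g (j + n) = val (\sum_(j <- s) f j) x.
  rewrite raddf_sum; elim: (s) => [|j t IH]; first by rewrite !big_nil.
  by rewrite !big_cons IH /g addrK.
rewrite s0 => /(_ erefl (i + n)); rewrite /g addrK; apply.
exact: map_f.
Qed.

(* On the degree n part, diff f = d f - (-1)^n f d; see endo_diff_homog. *)
Definition endo_diff : E -> E :=
  extend endo_grading (fun n f => insubd (0 : E) (hom_diff n (endo_fun f))).

Lemma hom_diff_linear n c (f g : P -> P) :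
  hom_diff n (c *: f + g) = c *: hom_diff n f + hom_diff n g.
Proof.
apply: funext => x; rewrite /hom_diff !fctE diff_linear.
by rewrite !scalerDr opprD scalerN addrACA !scalerA [_ * c]mulrC.
Qed.

Lemma hom_diff_endo n (f : E) : endo_homog n f ->
  val (insubd (0 : E) (hom_diff n (endo_fun f))) = hom_diff n (endo_fun f).
Proof.
move=> hf; rewrite insubdK //; apply/asboolP.
exact: FiniteEndoDeg (hom_diff_deg hf).
Qed.

Let hom_diff_additive n c f g : endo_homog n f -> endo_homog n g ->
  insubd (0 : E) (hom_diff n (endo_fun (c *: f + g))) =
  c *: insubd (0 : E) (hom_diff n (endo_fun f))
     + insubd (0 : E) (hom_diff n (endo_fun g)).
Proof.
move=> hf hg; apply: val_inj.
rewrite hom_diff_endo; last exact: (gr_lin endo_grading).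
by rewrite !endo_valE !hom_diff_endo // -hom_diff_linear.
Qed.

Let endo_diff_linear : linear endo_diff.
Proof. exact: extend_linear hom_diff_additive. Qed.

Lemma endo_diff_homog n (f : E) : endo_homog n f ->
  endo_fun (endo_diff f) = hom_diff n (endo_fun f).
Proof.
move=> hf; rewrite /endo_diff (extend_homog endo_grading _ hf).
  exact: hom_diff_endo.
move=> i; have := hom_diff_additive (-1) (gr0 endo_grading i)
  (gr0 endo_grading i).
by rewrite scaler0 addr0 scaleN1r addNr.
Qed.

Let endo_diff_deg n (f : E) : endo_homog n f -> endo_homog (n + 1) (endo_diff f).
Proof.
by move=> hf; rewrite /endo_homog (endo_diff_homog hf); apply: hom_diff_deg.
Qed.

Let endo_diff_diff f : endo_diff (endo_diff f) = 0.
Proof.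
elim/(gr_ind endo_grading): f => [u v hu hv|n f hf].
  by rewrite !(linearDf endo_diff_linear) hu hv addr0.
apply: val_inj; rewrite -[LHS]/(endo_fun _).
rewrite (endo_diff_homog (endo_diff_deg hf)) (endo_diff_homog hf).
apply: funext => x; rewrite /hom_diff /endo_fun.
rewrite (linearBf diff_linear) (linearZf diff_linear) !diff_diff sub0r.
rewrite (linear0f (endo_mod_linear f).1) scaler0 subr0.
by rewrite expfzDr ?oppr_eq0 ?oner_eq0 // expr1z mulrN1 scaleNr opprK addNr.
Qed.

HB.instance Definition _ := isComplex.Build k E endo_grading endo_diff_linear
  endo_diff_deg endo_diff_diff.

Let endo_homog1 : homog 0 (1 : E). Proof. exact: hom_deg1. Qed.
Let endo_homogM i j (f g : E) : homog i f -> homog j g -> homog (i + j) (f * g).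
Proof. exact: hom_deg_comp. Qed.
Let endo_diffM i (f g : E) : homog i f ->
  diff (f * g) = diff f * g + (-1 : k) ^ i *: (f * diff g).
Proof.
move=> hf; elim/(gr_ind endo_grading): g => [g h hg hh|j g hg].
  rewrite mulrDr !(linearDf diff_linear) hg hh !mulrDr scalerDr.
  by rewrite addrACA.
apply: val_inj; rewrite -[LHS]/(endo_fun (endo_diff _)).
rewrite (endo_diff_homog (endo_homogM hf hg)); apply: funext => x.
rewrite [X in val X]addrC endo_valE !fctE [in RHS]addrC /=.
rewrite -[val (diff f)]/(endo_fun (endo_diff f)) (endo_diff_homog hf).
rewrite -[val (diff g)]/(endo_fun (endo_diff g)) (endo_diff_homog hg).
rewrite /hom_diff /endo_fun /=.
rewrite (linearBf (endo_mod_linear f).1) (linearZf (endo_mod_linear f).1).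
rewrite scalerBr scalerA -expfzDr ?oppr_eq0 ?oner_eq0 //.
by rewrite addrA subrK.
Qed.

HB.instance Definition _ := isDGAlgebra.Build k E endo_homog1 endo_homogM
  endo_diffM.

End Endomorphisms.

(* The projection of Lambda + R onto Lambda, as an element of End_Lambda. *)
Section Projection.
Variables (k : fieldType) (A : dgAlgType k) (R : dgModType A).

Lemma regular_sum_neq0 : exists x : (regular A * R)%type, x != 0.
Proof.
exists ((1 : A) : regular A, 0); apply/eqP => /(congr1 fst) /= e.
by have /eqP[] := oner_neq0 A.
Qed.

Definition first_projection (x : regular A * R) : regular A * R := (x.1, 0).

Lemma first_projection_subproof : is_endo first_projection.
Proof.
apply/asboolP; apply: (@FiniteEndoDeg _ _ _ 0); split; last first.
  by move=> i m [m1 _]; rewrite addr0; split=> //; apply: (gr0 homog_grading).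
split=> [c u v|m a]; congr pair; rewrite /= ?scaler0 ?addr0 //.
by rewrite (linear0f (ract_linearl a)).
Qed.

Definition projection : dgEnd regular_sum_neq0 :=
  Sub first_projection first_projection_subproof.
End Projection.

(* * Path algebras *)

Record quiver := Quiver {
  vertex : finType;
  arrow : finType;
  source : arrow -> vertex;
  target : arrow -> vertex }.

Section Paths.
Variable Q : quiver.

(* The arrows of a path are listed in the order in which they are written:
   the last arrow which is followed comes first. The list is paired with the
   final vertex of the path. *)
Fixpoint is_path (v : vertex Q) (s : seq (arrow Q)) : bool :=
  if s is a :: s' then (target a == v) && is_path (source a) s' else true.

Definition qpath : Type := {p : vertex Q * seq (arrow Q) | is_path p.1 p.2}.
HB.instance Definition _ := SubChoice.on qpath.

Definition path_end (p : qpath) : vertex Q := (val p).1.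
Definition path_start (p : qpath) : vertex Q :=
  last (val p).1 [seq source a | a <- (val p).2].

Definition trivial_path (v : vertex Q) : qpath := Sub (v, [::]) isT.

Lemma arrow_path_subproof a : is_path (target a) [:: a].
Proof. by rewrite /= eqxx. Qed.
Definition arrow_path (a : arrow Q) : qpath :=
  Sub (target a, [:: a]) (arrow_path_subproof a).

(* The path p r: first r, then p. *)
Definition path_comp (p r : qpath) : option qpath :=
  if path_start p == path_end r
  then insub ((val p).1, (val p).2 ++ (val r).2) else None.

Lemma is_path_cat v s t :
  is_path v (s ++ t) =
  is_path v s && is_path (last v [seq source a | a <- s]) t.
Proof. by elim: s v => //= a s IH v; rewrite IH andbA. Qed.

Lemma path_compE p r (t : qpath) : path_comp p r = Some t ->
  path_start p = path_end r /\ val t = ((val p).1, (val p).2 ++ (val r).2).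
Proof.
rewrite /path_comp; case: eqP => // e; case: insubP => // u _ <- [<-].
by split.
Qed.

Lemma path_compP p r : path_start p = path_end r ->
  exists2 t, path_comp p r = Some t
           & val t = ((val p).1, (val p).2 ++ (val r).2).
Proof.
move=> e; rewrite /path_comp e eqxx; case: insubP => [t _ et|]; first by exists t.
rewrite /= is_path_cat (valP p) -/(path_start p) e.
by rewrite (valP r).
Qed.

Lemma path_comp_neq p r : path_start p != path_end r -> path_comp p r = None.
Proof. by rewrite /path_comp => /negbTE ->. Qed.

Lemma path_comp_start p r t : path_comp p r = Some t ->
  path_start t = path_start r.
Proof.
move=> /path_compE[e et]; rewrite /path_start et /= map_cat last_cat.
by rewrite -/(path_start p) e.
Qed.

Lemma path_comp_end p r t : path_comp p r = Some t -> path_end t = path_end p.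
Proof. by move=> /path_compE[_ et]; rewrite /path_end et. Qed.

Lemma path_compA p r t :
  obind (path_comp p) (path_comp r t) = obind (path_comp^~ t) (path_comp p r).
Proof.
have [e1|n1] := eqVneq (path_start p) (path_end r); last first.
  rewrite (path_comp_neq n1) /=.
  case E: (path_comp r t) => [u|] //=; apply: path_comp_neq.
  by rewrite (path_comp_end E).
have [u eu vu] := path_compP e1; rewrite eu /=.
have [e2|n2] := eqVneq (path_start r) (path_end t); last first.
  by rewrite (path_comp_neq n2) path_comp_neq ?(path_comp_start eu).
have [w ew vw] := path_compP e2; rewrite ew /=.
have [|x -> vx] := @path_compP p w; first by rewrite (path_comp_end ew).
have [|y -> vy] := @path_compP u t; first by rewrite (path_comp_start eu).
by congr Some; apply: val_inj; rewrite vx vy vu vw /= catA.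
Qed.

Lemma path_comp_triv v r :
  path_comp (trivial_path v) r = if v == path_end r then Some r else None.
Proof.
have [->|n] := eqVneq; last exact: path_comp_neq.
have [//|t -> vt] := @path_compP (trivial_path (path_end r)) r.
by congr Some; apply: val_inj; rewrite vt /= /path_end -surjective_pairing.
Qed.

Lemma path_triv_comp v p :
  path_comp p (trivial_path v) = if v == path_start p then Some p else None.
Proof.
have [->|n] := eqVneq; last by apply: path_comp_neq; rewrite eq_sym.
have [//|t -> vt] := @path_compP p (trivial_path (path_start p)).
by congr Some; apply: val_inj; rewrite vt /= cats0 -surjective_pairing.
Qed.

End Paths.

(* kQ: the free k-module on the paths, multiplied by concatenation. *)
Definition path_algebra (k : fieldType) (Q : quiver) : Type := {malg k[qpath Q]}.

Section PathAlgebra.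
Variables (k : fieldType) (Q : quiver).
Local Notation kQ := (path_algebra k Q).
HB.instance Definition _ := GRing.Lmodule.on kQ.

(* path_elt and path_mul are locked to keep conversion from unfolding them. *)
Fact path_key : unit. Proof. by []. Qed.

Definition path_elt : qpath Q -> kQ := locked_with path_key (fun p => << p >>).

Lemma path_eltE p : path_elt p = << p >>.
Proof. by rewrite [path_elt]unlock. Qed.

Definition path_lift (V : lmodType k) (f : qpath Q -> V) (a : kQ) : V :=
  \sum_(p <- msupp a) a@_p *: f p.

Definition path_prod (p r : qpath Q) : kQ :=
  oapp path_elt 0 (path_comp p r).

Definition path_mul : kQ -> kQ -> kQ := locked_with path_key
  (fun a b => path_lift (fun p => path_lift (path_prod p) b) a).

Definition path_one : kQ := \sum_(v : vertex Q) path_elt (trivial_path v).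

Lemma path_liftw (V : lmodType k) (f : qpath Q -> V) (a : kQ) u :
  uniq u -> {subset msupp a <= u} ->
  path_lift f a = \sum_(p <- u) a@_p *: f p.
Proof.
move=> uu su; rewrite /path_lift -(pad_sum (fun p => _) (fset_uniq _) uu su).
apply: eq_bigr => p _; case: ifPn => // /mcoeff_outdom ->.
by rewrite scale0r.
Qed.

Lemma path_lift_linear (V : lmodType k) (f : qpath Q -> V) :
  linear (path_lift f).
Proof.
move=> c a b; pose u := undup (msupp a ++ msupp b ++ msupp (c *: a + b)).
have uu : uniq u by apply: undup_uniq.
rewrite !(path_liftw f uu); do ?by move=> p; rewrite mem_undup !mem_cat => ->;
  rewrite ?orbT.
rewrite scaler_sumr -big_split; apply: eq_bigr => p _.
by rewrite mcoeffD mcoeffZ scalerDl scalerA.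
Qed.

Lemma path_lift_elt (V : lmodType k) (f : qpath Q -> V) p :
  path_lift f (path_elt p) = f p.
Proof.
by rewrite /path_lift path_eltE msuppU oner_eq0 big_seq_fset1 mcoeffUU scale1r.
Qed.

Lemma path_ind (P : kQ -> Prop) : P 0 ->
  (forall c a b, P a -> P b -> P (c *: a + b)) ->
  (forall p, P (path_elt p)) -> forall a, P a.
Proof.
move=> P0 Pl Pe a; have -> : a = \sum_(p <- msupp a) a@_p *: path_elt p.
  rewrite [LHS]monalgE; apply: eq_bigr => p _.
  apply/malgP => r; rewrite path_eltE mcoeffU.
  by rewrite mcoeffZ mcoeffU mulr_natr.
elim: (enum_fset (msupp a)) => [|p s IH]; first by rewrite big_nil.
by rewrite big_cons; apply: Pl.
Qed.

Lemma path_mulE a b :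
  path_mul a b = \sum_(p <- msupp a) a@_p *: path_lift (path_prod p) b.
Proof. by rewrite [path_mul]unlock. Qed.

Lemma path_mul_linearl b : linear (path_mul^~ b).
Proof. by move=> c u v; rewrite [path_mul]unlock path_lift_linear. Qed.

Lemma path_mul_linearr a : linear (path_mul a).
Proof.
move=> c u v; rewrite !path_mulE scaler_sumr -big_split.
apply: eq_bigr => p _; rewrite (path_lift_linear (path_prod p) c u v).
by rewrite scalerDr !scalerA [c * _]mulrC.
Qed.

Lemma path_mul_elt p r : path_mul (path_elt p) (path_elt r) = path_prod p r.
Proof. by rewrite [path_mul]unlock !path_lift_elt. Qed.

Let mul0l b : path_mul 0 b = 0.
Proof. exact: linear0f (path_mul_linearl b). Qed.
Let mul0r a : path_mul a 0 = 0.
Proof. exact: linear0f (path_mul_linearr a). Qed.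

Let path_mulA : associative path_mul.
Proof.
move=> a b c; elim/path_ind: a => [|x a a' IH IH'|p]; first by rewrite !mul0l.
  by rewrite !path_mul_linearl IH IH'.
elim/path_ind: b => [|x b b' IH IH'|r].
    by rewrite mul0r mul0l mul0r.
  by rewrite path_mul_linearl !path_mul_linearr path_mul_linearl IH IH'.
elim/path_ind: c => [|x c c' IH IH'|t]; first by rewrite !mul0r.
  by rewrite !path_mul_linearr IH IH'.
rewrite !path_mul_elt /path_prod.
have := path_compA p r t.
case: (path_comp r t) => [u|]; case: (path_comp p r) => [w|] /=.
- by rewrite !path_mul_elt /path_prod => ->.
- by rewrite path_mul_elt /path_prod => ->; rewrite mul0l.
- by rewrite path_mul_elt /path_prod => <-; rewrite mul0r.
- by rewrite mul0l mul0r.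
Qed.

Let path_mul1l : left_id path_one path_mul.
Proof.
move=> a; elim/path_ind: a => [|x a a' IH IH'|p]; first exact: mul0r.
  by rewrite path_mul_linearr IH IH'.
rewrite /path_one (big_morph (path_mul^~ _) (linearDf (path_mul_linearl _))
  (mul0l _)).
rewrite (bigD1 (path_end p)) //= path_mul_elt /path_prod path_comp_triv eqxx.
rewrite big1 ?addr0 // => v /negbTE n.
by rewrite path_mul_elt /path_prod path_comp_triv n.
Qed.

Let path_mul1r : right_id path_one path_mul.
Proof.
move=> a; elim/path_ind: a => [|x a a' IH IH'|p]; first exact: mul0l.
  by rewrite path_mul_linearl IH IH'.
rewrite /path_one (big_morph (path_mul _) (linearDf (path_mul_linearr _))
  (mul0r _)).
rewrite (bigD1 (path_start p)) //= path_mul_elt /path_prod path_triv_comp eqxx.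
rewrite big1 ?addr0 // => v /negbTE n.
by rewrite path_mul_elt /path_prod path_triv_comp n.
Qed.

Let path_mulDl : left_distributive path_mul +%R.
Proof. by move=> a b c; apply: (linearDf (path_mul_linearl c)). Qed.
Let path_mulDr : right_distributive path_mul +%R.
Proof. by move=> a b c; apply: (linearDf (path_mul_linearr a)). Qed.

HB.instance Definition _ := GRing.Zmodule_isPzRing.Build kQ
  path_mulA path_mul1l path_mul1r path_mulDl path_mulDr.

Definition vertex_elt (v : vertex Q) : kQ := path_elt (trivial_path v).
Definition arrow_elt (a : arrow Q) : kQ := path_elt (arrow_path a).

Variable deg : arrow Q -> int.

Definition path_deg (p : qpath Q) : int := \sum_(a <- (val p).2) deg a.

Definition path_homog (i : int) (a : kQ) : Prop :=
  forall p, p \in msupp a -> path_deg p = i.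

(* The graded algebra underlying A is the quotient of kQ, graded by deg, by
   the two-sided ideal generated by the relations; pi is the projection. *)
Definition presents (rels : seq kQ) (A : dgAlgType k) (pi : kQ -> A) : Prop :=
  [/\ linear pi /\ (pi 1 = 1 /\ {morph pi : a b / a * b}),
      forall b : A, exists a : kQ, pi a = b,
      forall a : kQ, pi a = 0 <-> ideal (fun r => r \in rels) a
    & forall i (b : A), homog i b <-> exists2 a : kQ, path_homog i a & pi a = b].

End PathAlgebra.

Arguments vertex_elt k {Q} v.
Arguments arrow_elt k {Q} a.

(* The quiver with one vertex; its path algebra is the free algebra on I. *)
Definition rose (I : finType) : quiver :=
  @Quiver unit I (fun=> tt) (fun=> tt).

(* * The quiver of B *)

Variant B_vertex := V1 | V2.
Variant B_arrow := Gamma | Delta | Alpha | Beta | Tau.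

Definition B_vertex_code (v : B_vertex) : bool := if v is V1 then false else true.
Definition B_vertex_decode (b : bool) : B_vertex := if b then V2 else V1.
Lemma B_vertex_codeK : cancel B_vertex_code B_vertex_decode.
Proof. by case. Qed.
HB.instance Definition _ := Finite.copy B_vertex (can_type B_vertex_codeK).

Definition B_arrow_code (a : B_arrow) : 'I_5 :=
  match a with
  | Gamma => inord 0 | Delta => inord 1 | Alpha => inord 2 | Beta => inord 3
  | Tau => inord 4
  end.
Definition B_arrow_decode (i : 'I_5) : B_arrow :=
  nth Gamma [:: Gamma; Delta; Alpha; Beta; Tau] i.
Lemma B_arrow_codeK : cancel B_arrow_code B_arrow_decode.
Proof. by case; rewrite /B_arrow_decode inordK. Qed.
HB.instance Definition _ := Finite.copy B_arrow (can_type B_arrow_codeK).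

Definition B_source (a : B_arrow) : B_vertex :=
  match a with Gamma | Delta => V1 | Alpha | Beta | Tau => V2 end.
Definition B_target (a : B_arrow) : B_vertex :=
  match a with Gamma | Delta | Tau => V2 | Alpha | Beta => V1 end.

Definition B_quiver : quiver := Quiver B_source B_target.

Definition B_relations (k : fieldType) (q : k) : seq (path_algebra k B_quiver) :=
  let ar (a : arrow B_quiver) : path_algebra k B_quiver := arrow_elt k a in
  let gamma := ar Gamma in let delta := ar Delta in let alpha := ar Alpha in
  let beta := ar Beta in let tau := ar Tau in
  [:: beta * delta; delta * beta; beta * tau; tau * delta; tau * tau;
      gamma * beta - q *: (delta * alpha);
      gamma * alpha - (q - 1) *: (delta * alpha)].

(* false and true index x and y. *)
Definition Lambda_relations (k : fieldType) (q : k) :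
    seq (path_algebra k (rose bool)) :=
  let x : path_algebra k (rose bool) := arrow_elt k (false : arrow (rose bool)) in
  let y : path_algebra k (rose bool) := arrow_elt k (true : arrow (rose bool)) in
  [:: x * x; y * y; x * y - q *: (y * x)].

Definition dual_relations (k : fieldType) : seq (path_algebra k (rose unit)) :=
  let t : path_algebra k (rose unit) := arrow_elt k (tt : arrow (rose unit)) in
  [:: t * t].

(* Main.v *)
Require Import Defs.
From HB Require Import structures.
From mathcomp Require Import all_boot all_algebra.
From mathcomp Require Import boolp functions.
From mathcomp Require Import finmap.
From mathcomp.multinomials Require Import monalg.
From mathcomp Require Import zify ring.

Set Implicit Arguments.
Unset Strict Implicit.
Unset Printing Implicit Defensive.

Import GRing.Theory.
Local Open Scope ring_scope.

(** C is resolved over B by a module with generators r_0, r_1, ..., where r_0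
    spans a copy of e_2 B and the others span copies of e_1 B, and
    d r_{n+1} = r_n z_n. Here z_0 = gamma, and z_{n+1} is the image of
    (-q)^n x + y under an embedding of Lambda in e_1 B e_1. Maps from this
    resolution to B are sequences in B, and their cocycle equations are solved
    recursively; the coefficients which occur are multiples of 1 - (-q)^n, so
    Hom(C, B) = 0.

    Through the embedding, B e_1 is a B-Lambda-bimodule, and a resolution R of V
    yields a quasi-isomorphism f from P = Lambda + R to B e_1. The elements
    (-q)^n x + y also give a resolution of V, and the acyclicity above says that
    b |-> b f identifies H(B) with the cohomology of Hom(P, B e_1). The zigzag
    passes through the dg algebra of the pairs (b, F), where F is an endomorphism
    of the cone of f which preserves B e_1 and is the action of b there: it
    projects to B, and to End(P) by the induced map on P. *)

(** * Gradings and complexes *)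

(** The elements $(-q)^nx+y$ come from annihilators: $(ax+y)(a'x+y)=(qa+a')yx$, so the right
    annihilator of $ax+y$ with $a\neq0$ is generated by $-qax+y$. As $-q$ is not a root of unity,
    the sequence starting with $x+y$ never returns to a multiple of an earlier member.

    The sequence over $B$ starts with $\gamma$ because $e_1Be_1$ has the cohomology of $\Lambda$ and
    $e_2Be_1$ that of $V$, with $\gamma$ in the place of the class of 1. Thus $Be_1$ is a model of
    $\Lambda\oplus V$ on which $B$ acts. For the telescope resolution of $V$, the cone of
    $Be_2\to\mathrm{Hom}(R,Be_1)$ is, up to shift, the complex of maps from the resolution of $C$ to
    $B$; this is why one computation gives both $\mathrm{Hom}(C,B)=0$ and the comparison with
    $\mathrm{End}(P)$.

    The obstacle to a direct map is that $B$ acts on $Be_1$ but not on $P$; the cone of $f$ has room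
    for both. Also, $R$ is an arbitrary K-projective resolution, so what is computed for the
    explicit one is carried over by a homotopy equivalence. *)

Section Components.
Variables (k : fieldType) (V : lmodType k) (h : int -> V -> Prop).
Hypothesis G : is_grading h.

Definition component (n : int) : V -> V :=
  extend G (fun i v => if i == n then v else 0).

Lemma component_linear n : linear (component n).
Proof.
apply: extend_linear => i c u v _ _.
by case: ifP => // _; rewrite scaler0 addr0.
Qed.

Lemma component_homog n i v : h i v -> component n v = if i == n then v else 0.
Proof. by move=> hv; apply: extend_homog hv => j; case: ifP. Qed.

Lemma grD i u v : h i u -> h i v -> h i (u + v).
Proof. by move=> hu hv; rewrite -[u]scale1r; apply: gr_lin. Qed.

Lemma gr_sum i (I : Type) (s : seq I) (P : pred I) (f : I -> V) :
  (forall j, P j -> h i (f j)) -> h i (\sum_(j <- s | P j) f j).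
Proof. by move=> hf; apply: big_ind => //; [apply: gr0|apply: grD]. Qed.

Lemma homog_component n v : h n (component n v).
Proof.
elim/(gr_ind G): v => [u v hu hv|i v hv].
  by rewrite (linearDf (component_linear n)); apply: grD.
by rewrite (component_homog n hv); case: eqP => [<-|_] //; apply: gr0.
Qed.

Lemma component_id n v : h n v -> component n v = v.
Proof. by move=> hv; rewrite (component_homog n hv) eqxx. Qed.

Lemma component_span v : exists s : seq int,
  [/\ uniq s, v = \sum_(i <- s) component i v
    & forall i, i \notin s -> component i v = 0].
Proof.
have [[s f] [/= us hf ev]] := gr_span G v; exists s.
have cE i : component i v = if i \in s then f i else 0.
  rewrite ev (big_morph _ (linearDf (component_linear i))
    (linear0f (component_linear i))).
  under eq_bigr => j _ do rewrite (component_homog i (hf j)).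
  case: ifP => [si|/negP si].
    rewrite (bigD1_seq i) //= eqxx big1 ?addr0 // => j /negbTE.
    by rewrite eq_sym => ->.
  rewrite big1_seq // => j /andP[_ sj]; case: eqP => // ej.
  by case: si; rewrite -ej.
split=> // [|i /negbTE ni]; last by rewrite cE ni.
rewrite {1}ev !big_seq; apply: eq_bigr => i si.
by rewrite cE si.
Qed.

End Components.

Lemma component_morph (k : fieldType) (V W : lmodType k)
    (hV : int -> V -> Prop) (hW : int -> W -> Prop)
    (GV : is_grading hV) (GW : is_grading hW) (F : V -> W) r :
  linear F -> (forall i v, hV i v -> hW (i + r) (F v)) ->
  forall n v, component GW (n + r) (F v) = F (component GV n v).
Proof.
move=> Fl Fh n v; elim/(gr_ind GV): v => [u v hu hv|i v hv].
  rewrite (linearDf Fl) !(linearDf (component_linear _ _)) hu hv.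
  by rewrite (linearDf Fl).
rewrite (component_homog GV n hv) (component_homog GW _ (Fh _ _ hv)).
by rewrite (inj_eq (addIr r)); case: ifP => // _; rewrite (linear0f Fl).
Qed.

Lemma component_morph0 (k : fieldType) (V W : lmodType k)
    (hV : int -> V -> Prop) (hW : int -> W -> Prop)
    (GV : is_grading hV) (GW : is_grading hW) (F : V -> W) :
  linear F -> (forall i v, hV i v -> hW i (F v)) ->
  forall n v, component GW n (F v) = F (component GV n v).
Proof.
move=> Fl Fh n v; rewrite -{1}[n]addr0; apply: component_morph => // i u.
by rewrite addr0; apply: Fh.
Qed.

(** Meant for subspaces cut out by equations, such as [roof] and [corner_mod]: they inherit a
    grading as soon as they contain the components of their elements. *)
Lemma pullback_grading (k : fieldType) (U V : lmodType k)
    (h : int -> V -> Prop) (G : is_grading h) (F : U -> V) :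
  linear F -> injective F ->
  (forall n u, exists u', F u' = component G n (F u)) ->
  is_grading (fun i u => h i (F u)).
Proof.
move=> Fl Fi Fc; have F0 := linear0f Fl.
have Fsum (s : seq int) (f : int -> U) :
    F (\sum_(i <- s) f i) = \sum_(i <- s) F (f i).
  exact: (big_morph F (linearDf Fl) F0).
split=> [i|i c u v hu hv|u|s f us hf s0 i si].
- by rewrite F0; apply: gr0 G i.
- by rewrite Fl; apply: gr_lin.
- have [s [us eu _]] := component_span G (F u).
  have /choice[f fE] : forall n, exists u', F u' = component G n (F u) by [].
  exists (s, f); split=> //= [i|]; first by rewrite fE; apply: homog_component.
  by apply: Fi; rewrite Fsum (eq_bigr _ (fun i _ => fE i)).
- apply: Fi; rewrite F0; apply: (gr_free G us hf) => //.
  by rewrite -Fsum s0 F0.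
Qed.

(** * Graded vector spaces in coordinates *)

Definition coords (k : fieldType) (I : Type) : Type := I -> k.

Section Coordinates.
Variables (k : fieldType) (I : Type).
Local Notation V := (coords k I).
HB.instance Definition _ := GRing.Zmodule.copy V (I -> k).

Definition coords_scale (c : k) (u : V) : V := fun i => c * u i.
Let scaleA c d (u : V) :
  coords_scale c (coords_scale d u) = coords_scale (c * d) u.
Proof. by apply: funext => i; apply: mulrA. Qed.
Let scale1 : left_id 1 coords_scale.
Proof. by move=> u; apply: funext => i; apply: mul1r. Qed.
Let scaleDr : right_distributive coords_scale +%R.
Proof. by move=> c u v; apply: funext => i; apply: mulrDr. Qed.
Let scaleDl u : {morph coords_scale^~ u : c d / c + d}.
Proof. by move=> c d; apply: funext => i; apply: mulrDl. Qed.
HB.instance Definition _ := GRing.Zmodule_isLmodule.Build k V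
  scaleA scale1 scaleDr scaleDl.

Lemma coordsP (u v : V) : u =1 v -> u = v.
Proof. by move=> uv; apply: funext. Qed.

Lemma coordD (u v : V) i : (u + v) i = u i + v i. Proof. by []. Qed.
Lemma coordN (u : V) i : (- u) i = - u i. Proof. by []. Qed.
Lemma coord0 i : (0 : V) i = 0. Proof. by []. Qed.
Lemma coordZ c (u : V) i : (c *: u) i = c * u i. Proof. by []. Qed.
Lemma coord_sum (J : Type) (s : seq J) (P : pred J) (F : J -> V) i :
  (\sum_(j <- s | P j) F j) i = \sum_(j <- s | P j) F j i.
Proof.
exact: (big_morph (fun u : V => u i) (fun u v => coordD u v i) (coord0 i)).
Qed.
Definition coordE := (coordD, coordN, coordZ, coord0).

End Coordinates.

Section CoordinateGrading.
Variables (k : fieldType) (I : finType) (deg : I -> int).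
Local Notation V := (coords k I).

Definition coord_homog (n : int) (v : V) := forall i, deg i != n -> v i = 0.

Lemma coord_grading : is_grading coord_homog.
Proof.
split=> [i j _|i c u v hu hv j ji|v|s f us hf s0 n sn] //.
- by rewrite !coordE (hu _ ji) (hv _ ji) mulr0 addr0.
- pose f n : V := fun i => if deg i == n then v i else 0.
  exists (undup [seq deg i | i <- enum I], f); split=> //=.
  + exact: undup_uniq.
  + by move=> n i /negbTE ni; rewrite /f ni.
  + apply: coordsP => i; rewrite coord_sum (bigD1_seq (deg i)) ?undup_uniq //=.
      rewrite /f eqxx big1 ?addr0 // => j /negbTE.
      by rewrite eq_sym => ->.
    by rewrite mem_undup map_f ?mem_enum.
- apply: coordsP => i; have [di|] := eqVneq (deg i) n; last exact: hf.
  have := congr1 (fun g : V => g i) s0; rewrite coord_sum (bigD1_seq n) //=.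
  rewrite big1 ?addr0 // => j jn; apply: hf.
  by rewrite di eq_sym.
Qed.

(** The sign $(-1)^{|a|}$ of the Leibniz rule as an operation on all vectors. With it the rule for
    $B$ becomes a polynomial identity between coordinates, within reach of [ring]. *)
Definition coord_sgn (v : V) : V := fun i => (-1) ^ deg i * v i.

Lemma coord_sgnE n v : coord_homog n v -> coord_sgn v = (-1 : k) ^ n *: v.
Proof.
move=> hv; apply: coordsP => i; rewrite coordZ /coord_sgn.
by have [->//|/hv ->] := eqVneq (deg i) n; rewrite !mulr0.
Qed.

Lemma coord_homogM n m (u v : V) i j : coord_homog n u -> coord_homog m v ->
  deg i + deg j != n + m -> u i * v j = 0.
Proof.
move=> hu hv; have [->|/hu ->] := eqVneq (deg i) n; last by rewrite mul0r.
by rewrite (inj_eq (addrI n)) => /hv ->; rewrite mulr0.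
Qed.

Definition coord_basis (i : I) : V := fun j => if i == j then 1 else 0.

Lemma coord_span (v : V) : v = \sum_i v i *: coord_basis i.
Proof.
apply: coordsP => j; rewrite coord_sum (bigD1 j) //= coordZ /coord_basis eqxx.
rewrite mulr1 big1 ?addr0 // => i /negbTE.
by rewrite coordZ => ->; rewrite mulr0.
Qed.

Lemma coord_basis_homog i : coord_homog (deg i) (coord_basis i).
Proof. by move=> j; rewrite /coord_basis; case: (i =P j) => [->|//]; rewrite eqxx. Qed.

End CoordinateGrading.

(** * Reduction to homogeneous elements *)

Section Complexes.
Variable k : fieldType.
Implicit Types V W : complexType k.

Lemma homog0 V i : homog i (0 : V). Proof. exact: gr0 homog_grading i. Qed.

Lemma homogD V i (u v : V) : homog i u -> homog i v -> homog i (u + v).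
Proof. exact: grD homog_grading i u v. Qed.

Lemma homogZ V i c (u : V) : homog i u -> homog i (c *: u).
Proof. exact: grZ homog_grading i c u. Qed.

Lemma homogN V i (u : V) : homog i u -> homog i (- u).
Proof. by rewrite -scaleN1r; apply: homogZ. Qed.

Lemma diff0 V : diff (0 : V) = 0. Proof. exact: linear0f diff_linear. Qed.
Lemma diffD V : {morph (@diff k V) : u v / u + v}.
Proof. exact: linearDf diff_linear. Qed.
Lemma diffB V : {morph (@diff k V) : u v / u - v}.
Proof. exact: linearBf diff_linear. Qed.
Lemma diffZ V c : {morph (@diff k V) : u / c *: u}.
Proof. exact: linearZf diff_linear c. Qed.
Lemma diffN V : {morph (@diff k V) : u / - u}.
Proof. by move=> u /=; rewrite -!scaleN1r diffZ. Qed.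

Lemma component_diff V n (v : V) :
  component homog_grading (n + 1) (diff v) = diff (component homog_grading n v).
Proof. by apply: component_morph; [apply: diff_linear|apply: diff_homog]. Qed.

Lemma boundary_homog V n (v u : V) : homog n v -> v = diff u ->
  exists2 u' : V, homog (n - 1) u' & v = diff u'.
Proof.
move=> hv e; exists (component homog_grading (n - 1) u).
  exact: homog_component.
by rewrite -component_diff subrK -e component_id.
Qed.

Lemma acyclic_homog V n (v : V) : acyclic V -> homog n v -> diff v = 0 ->
  exists2 u : V, homog (n - 1) u & v = diff u.
Proof. by move=> aV hv /aV[u]; apply: boundary_homog. Qed.

(** As [f] commutes with taking components, solutions chosen in each degree can be added up over the
    finitely many degrees that occur. This serves the roof below, where primitives are supplied for
    homogeneous maps only. *)
Lemma quasi_iso_homog V W (f : V -> W) : chain_map f ->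
  (forall n v w, homog n v -> homog (n - 1) w -> diff v = 0 -> f v = diff w ->
     exists u, v = diff u) ->
  (forall n w, homog n w -> diff w = 0 ->
     exists v u, diff v = 0 /\ w = f v + diff u) -> quasi_iso f.
Proof.
move=> fc finj fsurj; have [fl fh fd] := fc.
have fcomp n v : component homog_grading n (f v) =
    f (component homog_grading n v).
  exact: component_morph0.
split=> // [v dv [w fv]|w dw].
  have /choice[u uE] :
      forall n, exists u, component homog_grading n v = diff u.
    move=> n; apply: (finj n _ (component homog_grading (n - 1) w)).
    - exact: homog_component.
    - exact: homog_component.
    - by rewrite -component_diff dv (linear0f (component_linear _ _)).
    - by rewrite -fcomp fv -component_diff subrK.
  have [s [_ e _]] := component_span homog_grading v.
  exists (\sum_(n <- s) u n); rewrite e (big_morph _ (@diffD V) (@diff0 V)).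
  exact: eq_bigr.
have /choice[vu vuE] : forall n, exists vu : V * W,
    diff vu.1 = 0 /\ component homog_grading n w = f vu.1 + diff vu.2.
  move=> n; have [||v [u vuE]] := fsurj n (component homog_grading n w).
  - exact: homog_component.
  - by rewrite -component_diff dw (linear0f (component_linear _ _)).
  - by exists (v, u).
have [s [_ e _]] := component_span homog_grading w.
exists (\sum_(n <- s) (vu n).1), (\sum_(n <- s) (vu n).2); split.
  by rewrite (big_morph _ (@diffD V) (@diff0 V)) big1 // => n _; case: (vuE n).
rewrite e (big_morph _ (@diffD W) (@diff0 W)).
rewrite (big_morph _ (linearDf fl) (linear0f fl)) -big_split /=.
by apply: eq_bigr => n _; case: (vuE n).
Qed.

End Complexes.

(** * Shifts and cones *)

Section ModuleLemmas.
Variables (k : fieldType) (A : dgAlgType k).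

Lemma ract0l (M : dgModType A) (a : A) : ract (0 : M) a = 0.
Proof. exact: linear0f (ract_linearl a). Qed.
Lemma ract0r (M : dgModType A) (m : M) : ract m (0 : A) = 0.
Proof. exact: linear0f (ract_linearr m). Qed.
Lemma ractDl (M : dgModType A) (m n : M) (a : A) :
  ract (m + n) a = ract m a + ract n a.
Proof. exact: linearDf (ract_linearl a) m n. Qed.
Lemma ractDr (M : dgModType A) (m : M) (a b : A) :
  ract m (a + b) = ract m a + ract m b.
Proof. exact: linearDf (ract_linearr m) a b. Qed.
Lemma ractZl (M : dgModType A) c (m : M) (a : A) :
  ract (c *: m) a = c *: ract m a.
Proof. exact: linearZf (ract_linearl a) c m. Qed.
Lemma ractZr (M : dgModType A) c (m : M) (a : A) :
  ract m (c *: a) = c *: ract m a.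
Proof. exact: linearZf (ract_linearr m) c a. Qed.
Lemma ractNl (M : dgModType A) (m : M) (a : A) : ract (- m) a = - ract m a.
Proof. by rewrite -!scaleN1r ractZl. Qed.
Lemma ractBl (M : dgModType A) (m n : M) (a : A) :
  ract (m - n) a = ract m a - ract n a.
Proof. by rewrite ractDl ractNl. Qed.

Definition sgz (n : int) : k := (-1) ^ n.

Lemma sgzD m n : sgz (m + n) = sgz m * sgz n.
Proof. by rewrite /sgz expfzDr ?oppr_eq0 ?oner_eq0. Qed.
Lemma sgz0 : sgz 0 = 1. Proof. exact: expr0z. Qed.
Lemma sgz1 : sgz 1 = -1. Proof. exact: expr1z. Qed.
Lemma sgzD1 n : sgz (n + 1) = - sgz n.
Proof. by rewrite sgzD sgz1 mulrN1. Qed.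
Lemma sgzB1 n : sgz (n - 1) = - sgz n.
Proof. by rewrite -[in RHS](subrK 1 n) sgzD1 opprK. Qed.
Lemma sgzz n : sgz n * sgz n = 1.
Proof.
rewrite /sgz -expfzMl mulrNN mulr1.
by case: n => n; rewrite /exprz ?expr1n ?invr1.
Qed.
End ModuleLemmas.
Arguments sgz k n : clear implicits.

Section Shift.
Variables (k : fieldType) (A : dgAlgType k) (M : dgModType A).

(* M[-1]; no signs are needed since the differential of A vanishes. *)
Definition shift of (forall a : A, diff a = 0) : Type := M.
Hypothesis A0 : forall a : A, diff a = 0.
Local Notation N := (shift A0).
HB.instance Definition _ := GRing.Lmodule.copy N M.

Definition shift_homog (i : int) (m : N) := homog (i - 1) (m : M).

Let shift_grading : is_grading shift_homog.
Proof.
have G := @homog_grading k M; split=> [i|i c u v|v|s f us hf s0 i si].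
- exact: (gr0 G (i - 1)).
- by apply: (gr_lin G).
- have [[s f] [us hf ->]] := gr_span G v.
  exists ([seq i + 1 | i <- s], fun i => f (i - 1)); split=> //=.
  + by rewrite map_inj_uniq //; apply: addIr.
  + by move=> i; apply: hf.
  + by rewrite big_map; apply: eq_bigr => i _; rewrite addrK.
have us' : uniq [seq i - 1 | i <- s] by rewrite map_inj_uniq //; apply: addIr.
have := gr_free G us' (f := fun i => f (i + 1)); rewrite big_map.
under eq_bigr => j _ do rewrite subrK.
have hf' j : homog j (f (j + 1)) by have := hf (j + 1); rewrite /shift_homog addrK.
move=> /(_ hf' s0 (i - 1)); rewrite subrK; apply.
exact: map_f.
Qed.
Let shift_diff_linear : linear (fun m : N => diff (m : M) : N).
Proof. exact: diff_linear. Qed.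
Let shift_diff_homog i (m : N) : shift_homog i m ->
  shift_homog (i + 1) (diff (m : M)).
Proof. by move=> /diff_homog; rewrite /shift_homog addrAC. Qed.
HB.instance Definition _ := isComplex.Build k N shift_grading
  shift_diff_linear shift_diff_homog (@diff_diff k M).

Definition shift_act (m : N) (a : A) : N := ract (m : M) a.
Let shift_act_homog i j (m : N) (a : A) :
  homog i m -> homog j a -> homog (i + j) (shift_act m a).
Proof. by move=> hm ha; rewrite /homog /= /shift_homog addrAC; apply: ract_homog. Qed.
Let shift_act_diff i (m : N) (a : A) : homog i m ->
  diff (shift_act m a) = shift_act (diff m) a + (-1 : k) ^ i *: shift_act m (diff a).
Proof.
move=> hm; have e0 : shift_act m 0 = 0 := ract0r (m : M).
have := diff_ract (i - 1) (m : M) a hm.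
by rewrite !A0 e0 ract0r !scaler0 !addr0.
Qed.
HB.instance Definition _ := isDGModule.Build k A N
  (@ract_linearl _ _ M) (@ract_linearr _ _ M) (@ract1 _ _ M) (@ractM _ _ M)
  shift_act_homog shift_act_diff.
End Shift.

Section Cone.
Variables (k : fieldType) (A : dgAlgType k) (X Y : dgModType A) (s : X -> Y).

(* Y is the shifted target, so that the cone of s is X + Y as a graded module. *)
Definition cone_map :=
  hom_deg 1 s /\ forall x, diff (s x) + s (diff x) = 0.

Definition cone of cone_map : Type := (X * Y)%type.
Hypothesis sc : cone_map.
Local Notation C := (cone sc).
HB.instance Definition _ := GRing.Lmodule.copy C (X * Y)%type.

Definition cone_diff (u : C) : C := (diff u.1, diff u.2 + s u.1).
Let homogC (i : int) (u : C) := homog i (u : (X * Y)%type).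

Let cone_grading : is_grading homogC.
Proof. exact: (@homog_grading k (X * Y)%type). Qed.
Let cone_diff_linear : linear cone_diff.
Proof.
have [[[sl _] _] _] := sc => c u v; congr pair; first exact: diff_linear.
by rewrite /= diff_linear sl scalerDr addrACA.
Qed.
Let cone_diff_homog i (u : C) : homogC i u -> homogC (i + 1) (cone_diff u).
Proof.
have [[_ sh] _] := sc; case=> u1 u2; split; first exact: diff_homog.
by apply: homogD; [apply: diff_homog|apply: sh].
Qed.
Let cone_diff_diff u : cone_diff (cone_diff u) = 0.
Proof.
have [_ ds] := sc.
by congr pair; rewrite /= ?diffD diff_diff // add0r ds.
Qed.
HB.instance Definition _ := isComplex.Build k C cone_grading cone_diff_linear
  cone_diff_homog cone_diff_diff.

Definition cone_act (u : C) (a : A) : C := (ract u.1 a, ract u.2 a).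
Let cone_linearl a : linear (cone_act^~ a).
Proof. by move=> c u v; rewrite /cone_act /= !ract_linearl. Qed.
Let cone_linearr m : linear (cone_act m).
Proof. by move=> c a b; rewrite /cone_act /= !ract_linearr. Qed.
Let cone1 m : cone_act m 1 = m.
Proof. by rewrite /cone_act !ract1 -surjective_pairing. Qed.
Let coneM m a b : cone_act m (a * b) = cone_act (cone_act m a) b.
Proof. by rewrite /cone_act !ractM. Qed.
Let cone_act_homog i j (m : C) (a : A) :
  homog i m -> homog j a -> homog (i + j) (cone_act m a).
Proof. by case=> m1 m2 ha; split; apply: ract_homog. Qed.
Let cone_act_diff i (m : C) (a : A) : homog i m ->
  diff (cone_act m a) =
  cone_act (diff m) a + (-1 : k) ^ i *: cone_act m (diff a).
Proof.
have [[[_ sA] _] _] := sc; case=> m1 m2; congr pair; first exact: diff_ract.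
by rewrite /= (diff_ract _ _ _ m2) sA ractDl addrAC.
Qed.
HB.instance Definition _ := isDGModule.Build k A C
  cone_linearl cone_linearr cone1 coneM cone_act_homog cone_act_diff.

Lemma cone_diffE (u : C) : diff u = (diff u.1, diff u.2 + s u.1).
Proof. by []. Qed.

End Cone.

(* A quasi-isomorphism which annihilates the differentials: its cone is
   formed without signs. *)
Section ConeAcyclic.
Variables (k : fieldType) (A : dgAlgType k) (A0 : forall a : A, diff a = 0).
Variables (X Y : dgModType A) (s : X -> Y).
Hypotheses (sl : mod_linear s) (sq : quasi_iso s) (s0 : forall x, s (diff x) = 0).

Lemma shift_cone_map : @cone_map k A X (shift Y A0) s.
Proof.
have [[_ sh sd] _ _] := sq; split; first split=> // i x hx.
  by rewrite /homog /= /shift_homog addrK; apply: sh.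
by move=> x; rewrite -[diff _]sd s0 addr0.
Qed.

Lemma cone_acyclic : acyclic (cone shift_cone_map).
Proof.
have [[_ _ sd] sinj ssurj] := sq; case=> x y.
rewrite cone_diffE => -[/= dx dy]; have dx0 : diff x = 0 by [].
have [x' ex] : exists u, x = diff u.
  apply: sinj => //; exists (- y); rewrite diffN.
  by apply/eqP; rewrite -addr_eq0 addrC; apply/eqP.
have dy0 : diff (y : Y) = 0 by rewrite -dy ex s0 addr0.
have [x2 [y' [dx2 ey]]] : exists v u, diff v = 0 /\ (y : Y) - s x' = s v + diff u.
  by apply: ssurj; rewrite diffB -sd s0 dy0 subr0.
exists ((x' + x2, y') : cone shift_cone_map); rewrite cone_diffE /=; congr pair.
  by rewrite diffD dx2 addr0.
by rewrite (linearDf sl.1) addrCA [diff _ + _]addrC -ey addrC subrK.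
Qed.

End ConeAcyclic.

(** * Semiprojective modules *)

(* The data of a semiprojective module with generators r_n of degree
   tel_deg n, each spanning a copy of e_n A, and d r_{n+1} = r_n z_n. *)
Record telescope (k : fieldType) (A : dgAlgType k) := Telescope {
  tel_e : nat -> A;
  tel_z : nat -> A;
  tel_deg : nat -> int;
  tel_ee : forall n, tel_e n * tel_e n = tel_e n;
  tel_e0 : forall n, homog 0 (tel_e n);
  tel_de : forall n, diff (tel_e n) = 0;
  tel_zh : forall n, homog (tel_deg n.+1 + 1 - tel_deg n) (tel_z n);
  tel_dz : forall n, diff (tel_z n) = 0;
  tel_ez : forall n, tel_e n * tel_z n = tel_z n;
  tel_ze : forall n, tel_z n * tel_e n.+1 = tel_z n;
  tel_zz : forall n, tel_z n * tel_z n.+1 = 0 }.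

Section Telescope.
Variables (k : fieldType) (A : dgAlgType k) (X : telescope A).
Local Notation e := (tel_e X).
Local Notation z := (tel_z X).
Local Notation D := (tel_deg X).
Local Notation comp := (component homog_grading).

(** The sequence [f] stands for the finite sum $\sum_n r_nf_n$, in which $f_n$ matters only through
    $e_nf_n$. *)
Definition is_tel : pred (nat -> A) := fun f =>
  `[< (forall n, e n * f n = f n) /\
      exists N, forall n, (N <= n)%N -> f n = 0 >].

Lemma tel_closed : submod_closed is_tel.
Proof.
split=> [|c f g].
  by apply/asboolP; split=> [n|]; [rewrite mulr0|exists 0%N].
move=> /asboolP[ef [N Nf]] /asboolP[eg [M Mg]]; apply/asboolP.
split=> [n|]; first by rewrite !fctE mulrDr -scalerAr ef eg.
exists (maxn N M) => n; rewrite geq_max => /andP[hN hM].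
by rewrite !fctE Nf // Mg // scaler0 addr0.
Qed.
HB.instance Definition _ := GRing.isSubmodClosed.Build k (nat -> A) is_tel
  tel_closed.

Definition tel : Type := {f : nat -> A | is_tel f}.
HB.instance Definition _ := SubChoice.on tel.
HB.instance Definition _ := [SubChoice_isSubLmodule of tel by <:].

Definition tel_fun (f : tel) : nat -> A := val f.

Lemma tel_inj f g : tel_fun f =1 tel_fun g -> f = g.
Proof. by move=> fg; apply: val_inj; apply: funext. Qed.

Lemma tel_ef f n : e n * tel_fun f n = tel_fun f n.
Proof. by have /asboolP[h _] := valP f; apply: h. Qed.

Lemma tel_fin f : exists N, forall n, (N <= n)%N -> tel_fun f n = 0.
Proof. by have /asboolP[] := valP f. Qed.

Definition tel_mk (f : nat -> A) (ef : forall n, e n * f n = f n)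
  (Nf : exists N, forall n, (N <= n)%N -> f n = 0) : tel :=
  Sub f (asboolT (conj ef Nf)).

Lemma tel_lin c f g n : tel_fun (c *: f + g) n = c *: tel_fun f n + tel_fun g n.
Proof. by []. Qed.

Definition tel_homog i (f : tel) := forall n, homog (i - D n) (tel_fun f n).

Lemma comp_e i n (a : A) : e n * a = a -> e n * comp i a = comp i a.
Proof.
move=> ea; rewrite -{2}ea.
symmetry; apply: (component_morph0 _ _ (F := *%R (e n))).
  by move=> c u v; rewrite mulrDr scalerAr.
by move=> j v hv; rewrite -[j]add0r; apply: homogM => //; apply: tel_e0.
Qed.

Definition tel_comp (i : int) (f : tel) : tel.
Proof.
apply: (@tel_mk (fun n => comp (i - D n) (tel_fun f n))).
  by move=> n; apply/comp_e/tel_ef.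
have [N Nf] := tel_fin f; exists N => n /Nf ->.
exact: linear0f (component_linear _ _).
Defined.

Lemma tel_compE i f n :
  tel_fun (tel_comp i f) n = comp (i - D n) (tel_fun f n).
Proof. by []. Qed.

Lemma tel_sumE (I : Type) (s : seq I) (F : I -> tel) n :
  tel_fun (\sum_(i <- s) F i) n = \sum_(i <- s) tel_fun (F i) n.
Proof.
exact: (big_morph (fun f : tel => tel_fun f n) (fun f g => erefl) erefl).
Qed.

Lemma tel_grading : is_grading tel_homog.
Proof.
split=> [i n|i c u v hu hv n|f|s F us hF s0 i si].
- exact: homog0.
- by rewrite tel_lin; apply: gr_lin homog_grading _ _ _ _ _ _.
- have [N Nf] := tel_fin f.
  have /choice[t tE] : forall n, exists s : seq int,
      forall i, i \notin s -> comp i (tel_fun f n) = 0.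
    by move=> n; have [s [_ _ ?]] := component_span homog_grading (tel_fun f n);
       exists s.
  (* Only the coordinates below [N] are nonzero, so finitely many total degrees $i+D(n)$ occur; a
     list containing all of them serves every coordinate at once. *)
  pose s := undup (flatten [seq [seq i + D n | i <- t n] | n <- iota 0 N]).
  exists (s, tel_comp^~ f); split=> //=; first exact: undup_uniq.
    by move=> i n; apply: homog_component.
  apply: tel_inj => n; rewrite tel_sumE /=.
  under eq_bigr => i _ do rewrite tel_compE.
  have [nN|/Nf f0] := ltnP n N; last first.
    rewrite f0 big1 // => i _.
    exact: linear0f (component_linear _ _).
  have [u [uu eu u0]] := component_span homog_grading (tel_fun f n).
  have -> : \sum_(i <- s) comp (i - D n) (tel_fun f n) =
      \sum_(i <- [seq i - D n | i <- s]) comp i (tel_fun f n) by rewrite big_map.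
  rewrite {1}eu (bigID (mem [seq i - D n | i <- s])) /= [X in _ + X]big1 ?addr0.
    rewrite [RHS](bigID (mem u)) /= [X in _ = _ + X]big1 ?addr0; last first.
      by move=> i; apply: u0.
    rewrite -big_filter -[RHS]big_filter; apply: perm_big; apply: uniq_perm.
    - exact: filter_uniq.
    - by rewrite filter_uniq // map_inj_uniq ?undup_uniq //; apply: addIr.
    - by move=> i; rewrite !mem_filter andbC.
  move=> i ni; apply: tE; apply: contra ni => ti.
  apply/mapP; exists (i + D n); last by rewrite addrK.
  rewrite mem_undup; apply/flattenP; exists [seq j + D n | j <- t n].
    by apply: map_f; rewrite mem_iota.
  exact: map_f.
- apply: tel_inj => n.
  have us' : uniq [seq i - D n | i <- s] by rewrite map_inj_uniq //; apply: addIr.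
  have := gr_free homog_grading us' (f := fun i => tel_fun (F (i + D n)) n).
  rewrite big_map; under eq_bigr => j _ do rewrite subrK.
  rewrite -tel_sumE s0 => /(_ _ erefl (i - D n)); rewrite subrK; apply.
    by move=> j; have := hF (j + D n) n; rewrite addrK.
  exact: map_f.
Qed.

(** The Leibniz rule for $\sum r_nf_n$ with $dr_{n+1}=r_nz_n$ and $dr_0=0$: the coordinate at $r_n$
    receives $z_nf_{n+1}$ from the next generator and $(-1)^{|r_n|}df_n$ from its own. *)
Definition tel_diff (f : tel) : tel.
Proof.
apply: (@tel_mk (fun n => z n * tel_fun f n.+1 +
                          sgz k (D n) *: diff (tel_fun f n))).
  move=> n; rewrite mulrDr mulrA tel_ez -scalerAr; congr (_ + _ *: _).
  rewrite -[in RHS]tel_ef (diffM _ _ _ (tel_e0 X n)) tel_de mul0r add0r.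
  by rewrite expr0z scale1r.
have [N Nf] := tel_fin f; exists N => n hn.
by rewrite !Nf ?(leq_trans hn) // mulr0 diff0 scaler0 addr0.
Defined.

Lemma tel_diffE f n : tel_fun (tel_diff f) n =
  z n * tel_fun f n.+1 + sgz k (D n) *: diff (tel_fun f n).
Proof. by []. Qed.

Let tel_diff_linear : linear tel_diff.
Proof.
move=> c u v; apply: tel_inj => n; rewrite tel_lin !tel_diffE !tel_lin.
rewrite diff_linear mulrDr !scalerDr -scalerAr !scalerA [c * _]mulrC.
exact: addrACA.
Qed.
Let tel_diff_homog i f : tel_homog i f -> tel_homog (i + 1) (tel_diff f).
Proof.
move=> hf n; rewrite tel_diffE; apply: homogD.
  have -> : i + 1 - D n = (D n.+1 + 1 - D n) + (i - D n.+1) by ring.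
  by apply: homogM; [apply: tel_zh|apply: hf].
by apply: homogZ; rewrite addrAC; apply: diff_homog.
Qed.
Let tel_diff_diff f : tel_diff (tel_diff f) = 0.
Proof.
(* The term $z_nz_{n+1}f_{n+2}$ vanishes. The two terms in $z_n\,df_{n+1}$ cancel, because the
   degrees of $r_nz_n$ and $r_{n+1}$ differ by 1. *)
apply: tel_inj => n; rewrite !tel_diffE mulrDr mulrA tel_zz mul0r add0r.
rewrite diffD diffZ diff_diff scaler0 addr0 (diffM _ _ _ (tel_zh X n)).
rewrite tel_dz mul0r add0r -scalerAr scalerA -scalerDl -[(-1) ^ _]/(sgz k _).
rewrite -sgzD.  rewrite [D n + _]addrC.  rewrite subrK sgzD1 subrr scale0r.
by [].
Qed.
HB.instance Definition _ := isComplex.Build k tel tel_grading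
  tel_diff_linear tel_diff_homog tel_diff_diff.

Definition tel_act (f : tel) (a : A) : tel.
Proof.
apply: (@tel_mk (fun n => tel_fun f n * a)).
  by move=> n; rewrite mulrA tel_ef.
by have [N Nf] := tel_fin f; exists N => n /Nf ->; rewrite mul0r.
Defined.

Let tel_linearl a : linear (tel_act^~ a).
Proof.
by move=> c u v; apply: tel_inj => n; rewrite tel_lin /tel_fun /= mulrDl scalerAl.
Qed.
Let tel_linearr m : linear (tel_act m).
Proof.
by move=> c u v; apply: tel_inj => n; rewrite tel_lin /tel_fun /= mulrDr scalerAr.
Qed.
Let tel1 m : tel_act m 1 = m.
Proof. by apply: tel_inj => n; rewrite /tel_fun /= mulr1. Qed.
Let telM m a b : tel_act m (a * b) = tel_act (tel_act m a) b.
Proof. by apply: tel_inj => n; rewrite /tel_fun /= mulrA. Qed.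
Let tel_act_homog i j (m : tel) (a : A) :
  homog i m -> homog j a -> homog (i + j) (tel_act m a).
Proof. by move=> hm ha n; rewrite addrAC; apply: homogM. Qed.
Let tel_act_diff i (m : tel) (a : A) : homog i m ->
  diff (tel_act m a) = tel_act (diff m) a + (-1 : k) ^ i *: tel_act m (diff a).
Proof.
move=> hm; apply: tel_inj => n.
rewrite addrC [RHS]tel_lin [LHS]tel_diffE {1 2 4}/tel_fun /= (diffM _ _ _ (hm n)).
rewrite -[(-1) ^ i]/(sgz k i) -[(-1) ^ _]/(sgz k (i - D n)).
rewrite mulrDl mulrA -scalerAl scalerDr scalerA -sgzD.
by rewrite [D n + _]addrC subrK addrA [RHS]addrC.
Qed.
HB.instance Definition _ := isDGModule.Build k A tel
  tel_linearl tel_linearr tel1 telM tel_act_homog tel_act_diff.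

Lemma tel_actE (f : tel) a n : tel_fun (ract f a) n = tel_fun f n * a.
Proof. by []. Qed.
Lemma tel_dE (f : tel) n : tel_fun (diff f) n =
  z n * tel_fun f n.+1 + sgz k (D n) *: diff (tel_fun f n).
Proof. by []. Qed.
End Telescope.

(** * Maps out of a semiprojective module *)

Section TelescopeMaps.
Variables (k : fieldType) (A : dgAlgType k) (X : telescope A) (N : dgModType A).
Local Notation e := (tel_e X).
Local Notation z := (tel_z X).
Local Notation D := (tel_deg X).
Local Notation tel := (tel X).
Implicit Types (y : nat -> N) (f : tel).

Definition tel_map y f : N :=
  \sum_(n < sval (cid (tel_fin f))) ract (y n) (tel_fun f n).

Lemma tel_mapE y f M : (forall n, (M <= n)%N -> tel_fun f n = 0) ->
  tel_map y f = \sum_(n < M) ract (y n) (tel_fun f n).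
Proof.
have E K L : (forall n, (K <= n)%N -> tel_fun f n = 0) -> (K <= L)%N ->
    \sum_(n < L) ract (y n) (tel_fun f n) =
    \sum_(n < K) ract (y n) (tel_fun f n).
  move=> fK KL; rewrite -(subnKC KL) big_split_ord /= [X in _ + X]big1 ?addr0 //.
  by move=> n _; rewrite fK ?leq_addr // ract0r.
rewrite /tel_map; case: cid => K fK /= fM.
by rewrite -(E _ (maxn K M) fK) ?leq_maxl // (E _ _ fM) ?leq_maxr.
Qed.

Lemma tel_map_linear y : mod_linear (tel_map y).
Proof.
split=> [c f g|f a].
  have [K fK] := tel_fin f; have [L gL] := tel_fin g.
  have fM n : (maxn K L <= n)%N -> tel_fun f n = 0.
    by rewrite geq_max => /andP[/fK].
  have gM n : (maxn K L <= n)%N -> tel_fun g n = 0.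
    by rewrite geq_max => /andP[_ /gL].
  have hM n : (maxn K L <= n)%N -> tel_fun (c *: f + g) n = 0.
    by move=> hn; rewrite tel_lin fM // gM // scaler0 addr0.
  rewrite (tel_mapE y hM) (tel_mapE y fM) (tel_mapE y gM) scaler_sumr -big_split.
  by apply: eq_bigr => n _; rewrite tel_lin ract_linearr.
have [K fK] := tel_fin f.
have faK n : (K <= n)%N -> tel_fun (ract f a) n = 0.
  by move=> /fK fn; rewrite tel_actE fn mul0r.
rewrite (tel_mapE y faK) (tel_mapE y fK).
rewrite (big_morph _ (linearDf (ract_linearl a)) (linear0f (ract_linearl a))).
by apply: eq_bigr => n _; rewrite tel_actE ractM.
Qed.

Lemma tel_map_hom_deg y i : (forall n, homog (D n + i) (y n)) ->
  hom_deg i (tel_map y).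
Proof.
move=> hy; split=> [|j f hf]; first exact: tel_map_linear.
apply: (gr_sum homog_grading) => n _.
have -> : j + i = (D n + i) + (j - D n) by ring.
exact: ract_homog.
Qed.

(** The value on $dr_n=r_{n-1}z_{n-1}$ of the map with values [y] on the generators; the 0
    corresponds to $dr_0=0$. *)
Definition tel_mulz y n : N := if n is n'.+1 then ract (y n') (z n') else 0.

Lemma tel_map_hom_diff y i : (forall n, homog (D n + i) (y n)) ->
  hom_diff i (tel_map y) =1
  tel_map (fun n => diff (y n) - sgz k i *: tel_mulz y n).
Proof.
move=> hy f; rewrite /hom_diff; have [K fK] := tel_fin f.
have dK n : (K <= n)%N -> tel_fun (diff f) n = 0.
  by move=> hn; rewrite tel_dE !fK ?(leq_trans hn) // mulr0 diff0 scaler0 addr0.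
have fK1 n : (K.+1 <= n)%N -> tel_fun f n = 0 by move=> /ltnW/fK.
have -> : tel_map (fun n => diff (y n) - sgz k i *: tel_mulz y n) f =
    tel_map (fun n => diff (y n)) f - sgz k i *: tel_map (tel_mulz y) f.
  rewrite !(tel_mapE _ fK) scaler_sumr -sumrB; apply: eq_bigr => n _.
  by rewrite ractBl ractZl.
rewrite (tel_mapE (tel_mulz y) fK1) big_ord_recl /= ract0l add0r.
rewrite (tel_mapE y dK) !(tel_mapE _ fK).
rewrite (big_morph _ (@diffD k N) (@diff0 k N)) !scaler_sumr -!sumrB.
apply: eq_bigr => n _; rewrite (diff_ract _ _ _ (hy n)) tel_dE ractDr ractZr.
have -> : (-1) ^ (D n + i) = sgz k i * sgz k (D n) by rewrite -sgzD addrC.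
by rewrite scalerDr scalerA ractM opprD addrACA subrr addr0.
Qed.

Lemma tel_gen_subproof m n :
  e n * (if n == m then e n else 0) = if n == m then e n else 0.
Proof. by case: eqP => _; rewrite ?tel_ee ?mulr0. Qed.

Definition tel_gen (m : nat) : tel.
Proof.
apply: (tel_mk (tel_gen_subproof m)).
by exists m.+1 => n hn; rewrite gtn_eqF.
Defined.

Lemma tel_genE m n : tel_fun (tel_gen m) n = if n == m then e n else 0.
Proof. by []. Qed.

Lemma tel_gen_homog m : homog (D m) (tel_gen m).
Proof.
move=> n; rewrite tel_genE; case: eqP => [->|_]; last exact: homog0.
by rewrite subrr; apply: tel_e0.
Qed.

Lemma tel_gen_e m : ract (tel_gen m) (e m) = tel_gen m.
Proof.
apply: tel_inj => n; rewrite tel_actE !tel_genE.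
by case: eqP => [->|_]; rewrite ?tel_ee ?mul0r.
Qed.

Lemma tel_diff_gen0 : diff (tel_gen 0) = 0 :> tel.
Proof.
apply: tel_inj => n; rewrite tel_dE !tel_genE /= mulr0 add0r.
by case: eqP => _; rewrite ?tel_de ?diff0 scaler0.
Qed.

Lemma tel_diff_genS m : diff (tel_gen m.+1) = ract (tel_gen m) (z m).
Proof.
apply: tel_inj => n; rewrite tel_dE tel_actE !tel_genE eqSS.
have -> : diff (if n == m.+1 then e n else 0) = 0.
  by case: eqP => _; rewrite ?tel_de ?diff0.
rewrite scaler0 addr0; case: eqP => [->|_]; last by rewrite mulr0 mul0r.
by rewrite tel_ze tel_ez.
Qed.

Lemma tel_map_gen y m : ract (y m) (e m) = y m -> tel_map y (tel_gen m) = y m.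
Proof.
move=> ye; rewrite (@tel_mapE y (tel_gen m) m.+1); last first.
  by move=> n hn; rewrite tel_genE gtn_eqF.
rewrite big_ord_recr /= tel_genE eqxx ye big1 ?add0r // => n _.
by rewrite tel_genE ltn_eqF ?ract0r.
Qed.

Lemma tel_span f K : (forall n, (K <= n)%N -> tel_fun f n = 0) ->
  f = \sum_(n < K) ract (tel_gen n) (tel_fun f n).
Proof.
move=> fK; apply: tel_inj => n; rewrite tel_sumE.
under eq_bigr => j _ do rewrite tel_actE tel_genE.
have [nK|Kn] := ltnP n K; last first.
  have f0 := fK n Kn; rewrite f0 big1 // => j _.
  by case: eqP => [<-|_]; rewrite ?mul0r // tel_ef.
rewrite (bigD1 (Ordinal nK)) //= eqxx tel_ef big1 ?addr0 // => j /negbTE.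
by rewrite -val_eqE /= eq_sym => ->; rewrite mul0r.
Qed.

Lemma tel_hom_gen (F : tel -> N) : mod_linear F -> F =1 tel_map (F \o tel_gen).
Proof.
move=> [Fl FA] f; have [K fK] := tel_fin f.
rewrite {1}(tel_span fK) (tel_mapE _ fK).
rewrite (big_morph F (linearDf Fl) (linear0f Fl)).
by apply: eq_bigr => n _; rewrite FA.
Qed.

Lemma eq_tel_map y y' : y =1 y' -> tel_map y =1 tel_map y'.
Proof. by move=> yy f; apply: eq_bigr => n _; rewrite yy. Qed.

(* Cocycles of degree i in Hom(tel, N), by their values on generators. *)
Definition tel_cocycle i (a : nat -> N) :=
  [/\ forall n, homog (D n + i) (a n),
      forall n, ract (a n) (e n) = a n
    & forall n, diff (a n) = sgz k i *: tel_mulz a n].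

(** The map with values [a] is the boundary of the one with values [b]. The latter has degree $i-1$,
    and its sign $(-1)^{i-1}$ turns the minus of [hom_diff] into a plus. *)
Definition tel_bounds i (a b : nat -> N) :=
  [/\ forall n, homog (D n + (i - 1)) (b n),
      forall n, ract (b n) (e n) = b n
    & forall n, a n = diff (b n) + sgz k i *: tel_mulz b n].

Lemma tel_cocycle_gen i (F : tel -> N) : hom_deg i F ->
  hom_diff i F =1 (fun=> 0) -> tel_cocycle i (F \o tel_gen).
Proof.
move=> [[Fl FA] Fh] dF; split=> [n|n|n] /=.
- exact/Fh/tel_gen_homog.
- by rewrite -FA tel_gen_e.
have /eqP := dF (tel_gen n); rewrite subr_eq0 => /eqP ->; congr (_ *: _).
case: n => [|n] /=; first by rewrite tel_diff_gen0 (linear0f Fl).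
by rewrite tel_diff_genS FA.
Qed.

Lemma tel_bounds_map i a b : tel_bounds i a b ->
  hom_deg (i - 1) (tel_map b) /\ tel_map a =1 hom_diff (i - 1) (tel_map b).
Proof.
move=> [hb eb ab]; split=> [|f]; first exact: tel_map_hom_deg.
rewrite tel_map_hom_diff //; apply: eq_tel_map => n.
by rewrite ab sgzB1 scaleNr opprK.
Qed.

Lemma tel_hom_acyclic :
  (forall i a, tel_cocycle i a -> exists b, tel_bounds i a b) ->
  hom_acyclic tel N.
Proof.
move=> H i F hF dF; have [b hb] := H i _ (tel_cocycle_gen hF dF).
have [hg eg] := tel_bounds_map hb; exists (tel_map b) => // f.
by rewrite -eg; apply: tel_hom_gen; case: hF.
Qed.

End TelescopeMaps.

(** A primitive is built one generator at a time. The element to be bounded at stage $n+1$ is closed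
    provided that $(a_n-db_n)z_n=0$, and $z_nz_{n+1}=0$ carries this condition to the next stage;
    this is the third clause of [P]. *)
Lemma tel_K_projective (k : fieldType) (A : dgAlgType k) (X : telescope A) :
  K_projective (tel X).
Proof.
move=> N aN; apply: tel_hom_acyclic => i a [ha ea da].
pose P n (b : N) := [/\ homog (tel_deg X n + (i - 1)) b,
  ract b (tel_e X n) = b
  & ract (a n - diff b) (tel_z X n) = 0].
(* A primitive given by acyclicity need not lie in $Ne_n$; multiplication by the closed idempotent
   $e_n$ puts it there without changing its boundary. *)
have lift n v : homog (tel_deg X n + i) v -> ract v (tel_e X n) = v ->
    diff v = 0 -> exists b : N, [/\ homog (tel_deg X n + (i - 1)) b,
      ract b (tel_e X n) = b & v = diff b].
  move=> hv ev dv; have [u hu vu] := acyclic_homog aN hv dv.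
  rewrite -addrA in hu; exists (ract u (tel_e X n)); split.
  - by rewrite -[_ + (i - 1)]addr0; apply: ract_homog => //; apply: tel_e0.
  - by rewrite -ractM tel_ee.
  - by rewrite (diff_ract _ _ _ hu) tel_de ract0r scaler0 addr0 -vu ev.
have [b0 [hb0 eb0 ab0]] : exists b : N, [/\ homog (tel_deg X 0 + (i - 1)) b,
      ract b (tel_e X 0) = b & a 0 = diff b].
  by apply: lift => //; rewrite da scaler0.
(* The step is phrased as an implication so that [choice] gives a total function; 0 is a dummy value
   off the invariant. *)
have step (nb : nat * N) : exists b', P nb.1 nb.2 ->
    P nb.1.+1 b' /\ a nb.1.+1 = diff b' + sgz k i *: ract nb.2 (tel_z X nb.1).
  case: nb => n b /=; have [[hb eb ab]|] := pselect (P n b); last by exists 0.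
  have hbz : homog (tel_deg X n.+1 + i) (ract b (tel_z X n)).
    have -> : tel_deg X n.+1 + i = (tel_deg X n + (i - 1)) +
      (tel_deg X n.+1 + 1 - tel_deg X n) by ring.
    by apply: ract_homog => //; apply: tel_zh.
  have [|||b' [hb' eb' ab']] := @lift n.+1 (a n.+1 - sgz k i *: ract b (tel_z X n)).
  - by apply: (grB homog_grading) => //; apply: homogZ.
  - by rewrite ractBl ea ractZl -ractM tel_ze.
  - rewrite diffB diffZ (diff_ract _ _ _ hb) tel_dz ract0r scaler0 addr0 da /=.
    by rewrite -scalerBr -ractBl ab scaler0.
  exists b' => _; split; last by rewrite -ab' subrK.
  split=> //; rewrite -ab' opprB addrC subrK ractZl -ractM tel_zz.
  by rewrite ract0r scaler0.
have [S SP] := choice step.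
pose b := fix b n := if n is n'.+1 then S (n', b n') else b0.
have bP n : P n (b n).
  elim: n => [|n IH] /=; first by split=> //; rewrite -ab0 subrr ract0l.
  by have [] := SP (n, b n) IH.
exists b; split=> n; try by case: (bP n).
case: n => [|n]; first by rewrite scaler0 addr0.
by have [] := SP (n, b n) (bP n).
Qed.

(** * The roof of dg algebras over a cone *)

Section ProductAlgebra.
Variables (k : fieldType) (A B : dgAlgType k).

Let prod_homog1 : homog 0 (1 : (A * B)%type).
Proof. by split; apply: homog1. Qed.
Let prod_homogM i j (a b : (A * B)%type) :
  homog i a -> homog j b -> homog (i + j) (a * b).
Proof. by move=> [a1 a2] [b1 b2]; split; apply: homogM. Qed.
Let prod_diffM i (a b : (A * B)%type) : homog i a ->
  diff (a * b) = diff a * b + (-1 : k) ^ i *: (a * diff b).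
Proof. by move=> [a1 a2]; congr pair; apply: diffM. Qed.
HB.instance Definition _ := isDGAlgebra.Build k (A * B)%type
  prod_homog1 prod_homogM prod_diffM.
End ProductAlgebra.

Record left_action (k : fieldType) (A B : dgAlgType k) (M : dgModType A)
    (act : B -> M -> M) : Prop := LeftAction {
  lact_linearl : forall m, linear (act^~ m);
  lact_linear : forall b, linear (act b);
  lact1 : forall m, act 1 m = m;
  lactM : forall b c m, act (b * c) m = act b (act c m);
  lact_ract : forall b m a, act b (ract m a) = ract (act b m) a;
  lact_homog : forall i j b m, homog i b -> homog j m -> homog (i + j) (act b m);
  lact_diff : forall i b m, homog i b ->
    diff (act b m) = act (diff b) m + sgz k i *: act b (diff m) }.

Section Roof.
Variables (k : fieldType) (A B : dgAlgType k) (P M : dgModType A).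
Variables (f : P -> M) (fc : cone_map f).
Variables (act : B -> M -> M) (actP : left_action act).
Variable P_neq0 : exists x : P, x != 0.
Local Notation C := (cone fc).

Lemma cone_neq0 : exists x : C, x != 0.
Proof.
have [x x0] := P_neq0; exists ((x, 0) : C).
by apply: contra x0 => /eqP/(congr1 fst) /= ->.
Qed.

Local Notation E := (dgEnd cone_neq0).
Implicit Types (x : (B * E)%type).

Lemma endo_fun_lin c (F G : E) u :
  endo_fun (c *: F + G) u = c *: endo_fun F u + endo_fun G u.
Proof. by []. Qed.

Lemma pair_lin c x y :
  (c *: x + y).1 = c *: x.1 + y.1 /\ (c *: x + y).2 = c *: x.2 + y.2.
Proof. by []. Qed.

Definition is_roof of left_action act : pred (B * E) := fun x =>
  `[< forall m : M, endo_fun x.2 ((0, m) : C) = (0, act x.1 m) >].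

Lemma roofE x : is_roof actP x ->
  forall m : M, endo_fun x.2 ((0, m) : C) = (0, act x.1 m).
Proof. by move/asboolP. Qed.

Lemma endo_linear (F : E) : linear (endo_fun F).
Proof. by case: (endo_mod_linear F). Qed.

Lemma roof_closed : subalg_closed (is_roof actP).
Proof.
split=> [|c x y /asboolP hx /asboolP hy|x y /asboolP hx /asboolP hy];
  apply/asboolP => m.
- by rewrite (lact1 actP).
- have [-> ->] := pair_lin c x y; rewrite endo_fun_lin hx hy.
  by rewrite (lact_linearl actP); congr pair; rewrite /= scaler0 addr0.
- rewrite -[endo_fun _ _]/(endo_fun x.2 (endo_fun y.2 (0, m))).
  by rewrite hy hx (lactM actP).
Qed.
HB.instance Definition _ := GRing.isSubalgClosed.Build k (B * E)%type (is_roof actP)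
  roof_closed.

Definition roof : Type := {x : (B * E)%type | is_roof actP x}.
HB.instance Definition _ := SubChoice.on roof.
HB.instance Definition _ := [SubChoice_isSubAlgebra of roof by <:].

Definition rval (t : roof) : B * E := val t.
Definition rbase (t : roof) : B := (rval t).1.
Definition rend (t : roof) : E := (rval t).2.
Definition rfun (t : roof) : C -> C := endo_fun (rend t).
Definition roof_homog i (t : roof) := homog i (rval t).

Lemma rfun0 t (m : M) : rfun t ((0, m) : C) = (0, act (rbase t) m).
Proof. exact: roofE (valP t) m. Qed.

Lemma rfun_linear t : linear (rfun t).
Proof. exact: endo_linear. Qed.

Lemma rfunE t p (m : M) :
  rfun t ((p, m) : C) = rfun t ((p, 0) : C) + (0, act (rbase t) m).
Proof.
rewrite -rfun0 -(linearDf (rfun_linear t)); congr (rfun t _).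
by congr pair; rewrite /= ?addr0 ?add0r.
Qed.

Lemma roof_eq t u : rbase t = rbase u ->
  (forall p, rfun t ((p, 0) : C) = rfun u ((p, 0) : C)) -> t = u.
Proof.
move=> eb ef; apply: val_inj; rewrite [LHS]surjective_pairing.
rewrite [RHS]surjective_pairing; congr pair; first exact: eb.
apply: val_inj; apply: funext => -[p m].
by rewrite -![LHS]/(rfun t (p, m)) -![RHS]/(rfun u (p, m)) rfunE eb ef -rfunE.
Qed.

Lemma rval_linear : linear rval. Proof. by []. Qed.
Lemma rval_inj : injective rval. Proof. exact: val_inj. Qed.

Lemma rend_diff n t : roof_homog n t -> forall u : C,
  endo_fun (diff (rend t)) u = diff (rfun t u) - sgz k n *: rfun t (diff u).
Proof.
by move=> [_ ht] u; rewrite -[diff _]/(endo_diff _) (endo_diff_homog ht).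
Qed.

(** For fixed homogeneous [m] of degree $j$, the defect $F(0,m)-(0,bm)$ is a linear map of degree
    $j$ in the pair $(b,F)$. It therefore commutes with taking components, and so does its
    vanishing. *)
Lemma roof_component n (x : (B * E)%type) : is_roof actP x ->
  is_roof actP (component homog_grading n x).
Proof.
move=> /asboolP hx; apply/asboolP => m; set y := component _ _ _.
suff: endo_fun y.2 ((0, m) : C) - (0, act y.1 m) = 0.
  by move/eqP; rewrite subr_eq0 => /eqP.
elim/(gr_ind (@homog_grading k M)): m => [u v hu hv|j m hm].
  have -> : ((0, u + v) : C) = (0, u) + (0, v).
    by congr pair; rewrite /= ?addr0.
  rewrite (linearDf (endo_linear _)) (linearDf (lact_linear actP _)).
  have -> : ((0, act y.1 u + act y.1 v) : C) = (0, act y.1 u) + (0, act y.1 v).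
    by congr pair; rewrite /= ?addr0.
  by rewrite opprD addrACA hu hv addr0.
pose F (x : (B * E)%type) : C := endo_fun x.2 ((0, m) : C) - (0, act x.1 m).
have Fl : linear F.
  move=> c u v; rewrite /F; have [-> ->] := pair_lin c u v.
  rewrite endo_fun_lin (lact_linearl actP).
  have -> : ((0, c *: act u.1 m + act v.1 m) : C) =
      c *: ((0, act u.1 m) : C) + (0, act v.1 m).
    by congr pair; rewrite /= ?scaler0 ?addr0.
  by rewrite scalerBr opprD addrACA.
have Fh i x' : homog i x' -> homog (i + j) (F x').
  move=> [x1 x2]; rewrite addrC; apply: (grB homog_grading).
    by have [_ h] := x2; apply: h; split=> //; apply: homog0.
  by split; [apply: homog0|rewrite addrC; apply: (lact_homog actP)].
rewrite -/(F y) /y -(component_morph homog_grading homog_grading Fl Fh).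
by rewrite /F hx subrr (linear0f (component_linear _ _)).
Qed.

(** The target of [f] is a subcomplex of the cone, so on it the boundary of [F] is computed from the
    action of [b] alone; the Leibniz rule of the action turns it into the action of $db$. *)
Lemma roof_diff_subproof t : is_roof actP (diff (rval t)).
Proof.
have diffE : forall x, is_roof actP x -> forall n, homog n x -> is_roof actP (diff x).
  move=> x hx n hn; have hx' := roofE hx; have [x1 x2] := hn.
  have d0 (m : M) : diff ((0, m) : C) = (0, diff m).
    by rewrite cone_diffE /= (linear0f fc.1.1.1) addr0 diff0.
  apply/asboolP => m; rewrite -[(diff x).2]/(endo_diff x.2).
  rewrite (endo_diff_homog x2) /hom_diff d0 !hx' d0 -/(sgz k n).
  rewrite (lact_diff actP _ x1) -[(diff x).1]/(diff x.1).
  congr pair; first by rewrite /= scaler0 subr0.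
  exact: addrK.
have [s [_ e _]] := component_span homog_grading (rval t).
rewrite e (big_morph _ (@diffD _ _) (@diff0 _ _)).
apply: (big_ind (is_roof actP)); [exact: rpred0|exact: rpredD|].
move=> n _; apply: (diffE _ _ n); last exact: homog_component.
exact/roof_component/(valP t).
Qed.

Definition roof_diff (t : roof) : roof := Sub _ (roof_diff_subproof t).

Let roof_grading : is_grading roof_homog.
Proof.
apply: (@pullback_grading k roof (B * E)%type (@homog k _) homog_grading rval
  rval_linear rval_inj) => n t.
by exists (Sub _ (roof_component n (valP t))).
Qed.
Let roof_diff_linear : linear roof_diff.
Proof. by move=> c u v; apply: val_inj; apply: diff_linear. Qed.
Let roof_diff_homog i t : roof_homog i t -> roof_homog (i + 1) (roof_diff t).
Proof. exact: diff_homog. Qed.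
Let roof_diff_diff t : roof_diff (roof_diff t) = 0.
Proof. by apply: val_inj; apply: diff_diff. Qed.
HB.instance Definition _ := isComplex.Build k roof roof_grading
  roof_diff_linear roof_diff_homog roof_diff_diff.

Let roof_homog1 : homog 0 (1 : roof).
Proof. exact: (@homog1 k (B * E)%type). Qed.
Let roof_homogM i j (a b : roof) : homog i a -> homog j b -> homog (i + j) (a * b).
Proof. exact: (@homogM k (B * E)%type). Qed.
Let roof_diffM i (a b : roof) : homog i a ->
  diff (a * b) = diff a * b + (-1 : k) ^ i *: (a * diff b).
Proof. by move=> ha; apply: val_inj; apply: (@diffM k (B * E)%type). Qed.
HB.instance Definition _ := isDGAlgebra.Build k roof roof_homog1 roof_homogM
  roof_diffM.

End Roof.

(** * The two projections of the roof *)

Section RoofMaps.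
Variables (k : fieldType) (A B : dgAlgType k) (P M : dgModType A).
Variables (f : P -> M) (fc : cone_map f).
Variables (act : B -> M -> M) (actP : left_action act).
Variable P_neq0 : exists x : P, x != 0.
Local Notation C := (cone fc).
Local Notation T := (roof fc actP P_neq0).
Local Notation E := (dgEnd P_neq0).
Implicit Types (t : T).

Lemma rbase_chain : chain_map (@rbase _ _ _ _ _ _ fc _ actP P_neq0 : T -> B).
Proof. by split=> // i t []. Qed.

Definition roof_base : dgAlgHom T B :=
  @DGAlgHom k T B (fun t => rbase t) rbase_chain erefl (fun t u => erefl).

(** The block of [F] from $P$ to $P$. An element of the roof preserves the submodule $0\oplus M$, so
    there this is the induced map on the quotient $P$, which makes it multiplicative. *)
Definition corner (F : C -> C) (p : P) : P := (F (p, 0)).1.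

Lemma corner_hom_deg n (F : C -> C) : hom_deg n F -> hom_deg n (corner F).
Proof.
move=> [[Fl FA] Fh]; split; [split=> [c u v|p a]|move=> i p hp].
- rewrite /corner (_ : ((c *: u + v, 0) : C) = c *: ((u, 0) : C) + (v, 0)) ?Fl //.
  by congr pair; rewrite /= scaler0 addr0.
- rewrite /corner (_ : ((ract p a, 0) : C) = ract ((p, 0) : C) a) ?FA //.
  by congr pair; rewrite /= ract0l.
- by have [] := Fh i ((p, 0) : C) (conj hp (homog0 _ _)).
Qed.

Lemma corner_endo t : is_endo (corner (rfun t)).
Proof.
apply/asboolP; have := endoP (rend t); rewrite -/(endo_fun _) -/(rfun t).
elim=> [n F hF|F G _ hF _ hG]; first exact: FiniteEndoDeg (corner_hom_deg hF).
exact: FiniteEndoD hF hG.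
Qed.

Definition roof_corner_fun t : E := Sub _ (corner_endo t).

Lemma roof_cornerE t p : endo_fun (roof_corner_fun t) p = (rfun t ((p, 0) : C)).1.
Proof. by []. Qed.

Lemma rfun1 t p m : (rfun t ((p, m) : C)).1 = (rfun t ((p, 0) : C)).1.
Proof. by rewrite rfunE /= addr0. Qed.

Lemma roof_homog_end n t : homog n t -> hom_deg n (rfun t).
Proof. by case. Qed.

Lemma rfun_diff n t u : homog n t ->
  rfun (diff t) u = diff (rfun t u) - sgz k n *: rfun t (diff u).
Proof. by move=> ht; rewrite -(rend_diff ht). Qed.

Lemma roof_corner_chain : chain_map roof_corner_fun.
Proof.
split=> [c t u|i t ht|t].
- by apply: val_inj; apply: funext => p.
- exact: corner_hom_deg (roof_homog_end ht).
have l : linear roof_corner_fun.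
  by move=> c t' u; apply: val_inj; apply: funext => p.
elim/(gr_ind (@homog_grading k T)): t => [t u ht hu|n t ht].
  by rewrite diffD !(linearDf l) diffD ht hu.
apply: val_inj; apply: funext => p.
rewrite -[LHS]/(endo_fun _ p) -[RHS]/(endo_fun (endo_diff _) p).
rewrite (endo_diff_homog (n := n)); last exact: corner_hom_deg (roof_homog_end ht).
have e : (rfun t (diff ((p, 0) : C))).1 = endo_fun (roof_corner_fun t) (diff p).
  by rewrite cone_diffE rfun1.
by rewrite roof_cornerE (rfun_diff _ ht) /hom_diff -e.
Qed.

Lemma roof_corner1 : roof_corner_fun 1 = 1.
Proof. by apply: val_inj; apply: funext. Qed.

Lemma roof_cornerM : {morph roof_corner_fun : t u / t * u}.
Proof.
move=> t u; apply: val_inj; apply: funext => p.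
rewrite -[LHS]/((rfun t (rfun u ((p, 0) : C))).1).
by rewrite [rfun u _]surjective_pairing rfun1.
Qed.

Definition roof_corner : dgAlgHom T E :=
  DGAlgHom roof_corner_chain roof_corner1 roof_cornerM.

(** Elements of the roof are triangular: the column on $M$ is dictated by the base [b], whereas the
    column [G] on $P$ is arbitrary. *)
Lemma roof_mk n (b : B) (G : P -> C) : homog n b -> hom_deg n G ->
  exists t : T, [/\ homog n t, rbase t = b
    & forall p m, rfun t ((p, m) : C) = G p + ((0, act b m) : C)].
Proof.
move=> hb [[Gl GA] Gh].
pose F (u : C) : C := G u.1 + ((0, act b u.2) : C).
have hF : hom_deg n F.
  split; [split=> [c u v|u a]|move=> i u [u1 u2]].
  - rewrite /F /= Gl (lact_linear actP) scalerDr addrACA; congr (_ + _).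
    by congr pair; rewrite /= scaler0 addr0.
  - rewrite /F /= GA (lact_ract actP) ractDl; congr (_ + _).
    by congr pair; rewrite /= ract0l.
  - apply: homogD; first exact: Gh.
    by split; [apply: homog0|rewrite addrC; apply: (lact_homog actP)].
have eF : is_endo F by apply/asboolP; apply: FiniteEndoDeg hF.
have rF : is_roof actP ((b, Sub F eF) : (B * dgEnd (cone_neq0 fc P_neq0))%type).
  apply/asboolP => m; rewrite -[endo_fun _ _]/(F (0, m)) /F /=.
  by rewrite (linear0f Gl) add0r.
by exists (Sub _ rF).
Qed.

Lemma hom_deg_comp_act n i (b : B) (g : P -> M) : homog n b -> hom_deg i g ->
  hom_deg (n + i) (act b \o g).
Proof.
move=> hb [[gl gA] gh]; split; [split=> [c u v|p a]|move=> j p hp] => /=.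
- by rewrite gl (lact_linear actP).
- by rewrite gA (lact_ract actP).
- have -> : j + (n + i) = n + (j + i) by ring.
  by apply: (lact_homog actP) => //; apply: gh.
Qed.

Lemma hom_deg_in2 n (g : P -> M) : hom_deg n g ->
  hom_deg n (fun p => (0, g p) : C).
Proof.
move=> [[gl gA] gh]; split; [split=> [c u v|p a]|move=> j p hp].
- by rewrite gl; congr pair; rewrite /= scaler0 addr0.
- by rewrite gA; congr pair; rewrite /= ract0l.
- by split; [apply: homog0|apply: gh].
Qed.

Lemma hom_deg_sub n (N : dgModType A) (g h : P -> N) :
  hom_deg n g -> hom_deg n h -> hom_deg n (fun p => g p - h p).
Proof.
move=> [[gl gA] gh] [[hl hA] hh]; split; [split=> [c u v|p a]|move=> j p hp].
- by rewrite gl hl scalerBr opprD addrACA.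
- by rewrite gA hA ractBl.
- by apply: (grB homog_grading); [apply: gh|apply: hh].
Qed.

Lemma rfun_hom_deg n t : homog n t -> hom_deg n (fun p => rfun t ((p, 0) : C)).
Proof.
move=> /roof_homog_end[[Fl FA] Fh]; split; [split=> [c u v|p a]|move=> j p hp].
- rewrite -Fl; congr (rfun t _).
  by congr pair; rewrite /= scaler0 addr0.
- by rewrite -FA; congr (rfun t _); congr pair; rewrite /= ract0l.
- by apply: Fh; split=> //; apply: homog0.
Qed.

(** In the cone $d(p,0)=(dp,f(p))$. The boundary of the column of [t], computed over $P$ only,
    leaves out the value of [t] at $(0,f(p))$, which is the action of the base on $f(p)$. *)
Lemma rfun_shift n t p : homog n t ->
  diff (rfun t ((p, 0) : C)) - sgz k n *: rfun t ((diff p, 0) : C) =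
  rfun (diff t) ((p, 0) : C) + sgz k n *: ((0, act (rbase t) (f p)) : C).
Proof.
move=> ht; have e : diff ((p, 0) : C) = (diff p, f p).
  by rewrite cone_diffE /= diff0 add0r.
rewrite (rfun_diff _ ht) e (rfunE t (diff p) (f p)) scalerDr opprD addrA subrK.
by [].
Qed.

Lemma hom_degZ n c (N : dgModType A) (g : P -> N) :
  hom_deg n g -> hom_deg n (fun p => c *: g p).
Proof.
move=> [[gl gA] gh]; split; [split=> [b u v|p a]|move=> j p hp].
- by rewrite gl scalerDr !scalerA mulrC.
- by rewrite gA ractZl.
- by apply: homogZ; apply: gh.
Qed.

Lemma hom_deg_zero n (N : dgModType A) : hom_deg n (fun _ : P => 0 : N).
Proof.
split; [split=> [c u v|p a]|move=> j p hp]; last exact: homog0.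
  by rewrite scaler0 addr0.
by rewrite ract0l.
Qed.

Lemma act0l m : act 0 m = 0.
Proof. exact: linear0f (lact_linearl actP m). Qed.
Lemma act0r b : act b 0 = 0.
Proof. exact: linear0f (lact_linear actP b). Qed.

Lemma pair00 : ((0, 0) : C) = 0.
Proof. by []. Qed.

Lemma pair_eq0 (u : C) : u.1 = 0 -> u.2 = 0 -> u = 0.
Proof. by case: u => x y /= -> ->. Qed.

Lemma pair_eq1 (u : C) : u.1 = 0 -> u = (0, u.2).
Proof. by case: u => x y /= ->. Qed.

Lemma pair_eq (u v : C) : u.1 = v.1 -> u.2 = v.2 -> u = v.
Proof. by case: u v => x y [z w] /= -> ->. Qed.

Lemma rbase_diff t : rbase (diff t) = diff (rbase t). Proof. by []. Qed.
Lemma rbaseM t u : rbase (t * u) = rbase t * rbase u. Proof. by []. Qed.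
Lemma rfunM t u x : rfun (t * u) x = rfun t (rfun u x). Proof. by []. Qed.
Lemma rfun_zero x : rfun (0 : T) x = 0. Proof. by []. Qed.
Lemma rbase_linear : linear (fun t => rbase t). Proof. by []. Qed.
Lemma rbaseB t u : rbase (t - u) = rbase t - rbase u.
Proof. exact: (linearBf rbase_linear). Qed.
Lemma rend_lin c t u : rend (c *: t + u) = c *: rend t + rend u.
Proof. by []. Qed.
Lemma rfun_lin x : linear (fun t => rfun t x).
Proof. by move=> c t u; rewrite /rfun rend_lin endo_fun_lin. Qed.
Lemma rfunB t u x : rfun (t - u) x = rfun t x - rfun u x.
Proof. exact: (linearBf (rfun_lin x)). Qed.

Section Base.
Hypothesis PC : hom_acyclic P C.

(** The kernel consists of the elements with base 0, that is, of the complex of maps from $P$ to the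
    cone, which is acyclic by [PC]. *)
Lemma roof_base_quasi_iso : quasi_iso roof_base.
Proof.
apply: quasi_iso_homog => [|n t b ht hb dt eb|n b hb db].
- exact: rbase_chain.
(* Subtracting the boundary of an element with base [b] makes the base vanish; the column is then a
   cocycle to which [PC] applies. *)
- have [t1 [ht1 bt1 ft1]] := roof_mk hb (hom_deg_zero (n - 1) C).
  pose t2 := t - diff t1.
  have ht2 : homog n t2.
    by apply: (grB homog_grading) => //; rewrite -[n](subrK 1); apply: diff_homog.
  have dt2 : diff t2 = 0 by rewrite diffB dt diff_diff subr0.
  have bt2 : rbase t2 = 0.
    by rewrite /t2 rbaseB rbase_diff bt1 -eb subrr.
  have [|g hg eg] := PC (rfun_hom_deg ht2).
    move=> p; rewrite /hom_diff (rfun_shift _ ht2) dt2 bt2 act0l pair00 scaler0.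
    by rewrite addr0.
  have [t3 [ht3 bt3 ft3]] := roof_mk (homog0 B (n - 1)) hg.
  exists (t1 + t3); rewrite diffD; apply/eqP.
  rewrite addrC -subr_eq; apply/eqP; rewrite -/t2; apply: roof_eq => [|p].
    by rewrite bt2 rbase_diff bt3 diff0.
  have := rfun_shift p ht3; rewrite bt3 act0l pair00 scaler0 addr0 => <-.
  by rewrite eg /hom_diff !ft3 act0l pair00 !addr0.
(* For closed [b] the map $p\mapsto(0,bf(p))$ is a cocycle of degree $n+1$. A primitive of it, times
   $(-1)^n$, is the column that makes a lift of [b] closed. *)
- have hG := hom_deg_in2 (hom_deg_comp_act hb fc.1).
  have [|g hg eg] := PC hG.
    move=> p; rewrite /hom_diff cone_diffE /= diff0.
    rewrite (linear0f fc.1.1.1) addr0 (lact_diff actP _ hb) db act0l add0r.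
    have /eqP := fc.2 p; rewrite addr_eq0 => /eqP ->.
    have -> : act b (- f (diff p)) = - act b (f (diff p)).
      by rewrite -!scaleN1r (linearZf (lact_linear actP b)).
    rewrite -/(sgz k (n + 1)) sgzD1; congr pair; rewrite /= ?scaler0 ?subr0 //.
    by rewrite scalerN scaleNr opprK addNr.
  rewrite addrK in hg eg.
  have [t [ht bt ft]] := roof_mk hb (hom_degZ (sgz k n) hg).
  exists t, 0; rewrite diff0 addr0; split; last by rewrite -bt.
  apply: roof_eq => [|p]; first by rewrite rbase_diff bt db.
  have /eqP := rfun_shift p ht; rewrite -subr_eq => /eqP <-.
  rewrite !ft !act0r pair00 !addr0 diffZ bt.
  have -> : ((0, act b (f p)) : C) = hom_diff n g p := eg p.
  rewrite /hom_diff -/(sgz k n) scalerBr.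
  rewrite [rfun 0 _](_ : _ = 0) //.
  by rewrite subrr.
Qed.
End Base.

Section Corner.
(* The action of B on f identifies H(B) with the cohomology of Hom(P, M). *)
Hypothesis act_inj : forall n b (g : P -> M), homog n b -> diff b = 0 ->
  hom_deg n g -> (forall p, act b (f p) = hom_diff n g p) ->
  exists b', b = diff b'.
Hypothesis act_surj : forall n (h : P -> M), hom_deg n h ->
  hom_diff n h =1 (fun=> 0) -> exists b g, [/\ homog (n - 1) b, diff b = 0,
    hom_deg (n - 1) g & forall p, h p = act b (f p) + hom_diff (n - 1) g p].

Lemma cone_hom_snd n (G : P -> C) : hom_deg n G -> hom_deg n (fun p => (G p).2).
Proof.
move=> [[gl gA] gh]; split; [split=> [c u v|p a]|move=> j p hp].
- by rewrite gl.
- by rewrite gA.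
- by have [] := gh j p hp.
Qed.

Lemma hom_deg_in1 n (g : P -> P) : hom_deg n g ->
  hom_deg n (fun p => (g p, 0) : C).
Proof.
move=> [[gl gA] gh]; split; [split=> [c u v|p a]|move=> j p hp].
- by rewrite gl; congr pair; rewrite /= scaler0 addr0.
- by rewrite gA; congr pair; rewrite /= ract0l.
- by split; [apply: gh|apply: homog0].
Qed.

(** The kernel consists of pairs of an element [b] and a map [g] from $P$ to $M$: up to shift and
    signs it is the cone of $b\mapsto bf$ from $B$ to $\mathrm{Hom}(P,M)$, acyclic by [act_inj] and
    [act_surj]. *)
Lemma roof_corner_quasi_iso : quasi_iso roof_corner.
Proof.
apply: quasi_iso_homog => [|n t F ht hF dt eF|n F hF dF].
- exact: roof_corner_chain.
(* Subtracting the boundary of an element with corner [F] and base 0 makes the corner vanish; a base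
   and a map [g] into $M$ are left. *)
- have [t1 [ht1 bt1 ft1]] := roof_mk (homog0 B (n - 1)) (hom_deg_in1 hF).
  pose t2 := t - diff t1.
  have ht2 : homog n t2.
    by apply: (grB homog_grading) => //; rewrite -[n](subrK 1); apply: diff_homog.
  have dt2 : diff t2 = 0 by rewrite diffB dt diff_diff subr0.
  have ct2 : roof_corner t2 = 0.
    have [cl _ cd] := roof_corner_chain.
    rewrite -[LHS]/(roof_corner_fun _) (linearBf cl) cd.
    have -> : roof_corner_fun t1 = F.
      apply: val_inj; apply: funext => p.
      by rewrite -[LHS]/(endo_fun _ p) roof_cornerE ft1 /= addr0.
    by rewrite -[roof_corner_fun t]/(roof_corner t) eF subrr.
  have c0 p : (rfun t2 ((p, 0) : C)).1 = 0.
    by rewrite -roof_cornerE [roof_corner_fun t2]ct2.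
  have {}c0 p : rfun t2 ((p, 0) : C) = (0, (rfun t2 ((p, 0) : C)).2).
    by rewrite -(c0 p) -surjective_pairing.
  have hg := cone_hom_snd (rfun_hom_deg ht2).
  set g := fun p => _ in hg.
  (* Closedness of [t2] says that the base acting on [f] is, up to sign, the boundary of [g]; by
     [act_inj] the base is then itself a boundary and can be removed. *)
  have dg p : diff (g p) - sgz k n *: g (diff p) = sgz k n *: act (rbase t2) (f p).
    have := congr1 snd (rfun_shift p ht2).
    rewrite dt2 c0 [rfun t2 ((diff p, 0) : C)]c0 cone_diffE /= -/(g p).
    by rewrite (linear0f fc.1.1.1) addr0 add0r.
  have [//||||b' eb'] := @act_inj n (rbase t2) (fun p => sgz k n *: g p).
  - by case: ht2.
  - by rewrite -rbase_diff dt2.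
  - exact: hom_degZ.
  - move=> p; rewrite /hom_diff diffZ -/(sgz k n) -scalerBr dg scalerA sgzz.
    by rewrite scale1r.
  have [{}b' hb' {}eb'] := boundary_homog ht2.1 eb'.
  have [t3 [ht3 bt3 ft3]] := roof_mk hb' (hom_deg_zero (n - 1) C).
  pose t4 := t2 - diff t3.
  have ht4 : homog n t4.
    by apply: (grB homog_grading) => //; rewrite -[n](subrK 1); apply: diff_homog.
  have dt4 : diff t4 = 0 by rewrite diffB dt2 diff_diff subr0.
  have bt4 : rbase t4 = 0.
    by rewrite /t4 rbaseB rbase_diff bt3 -eb' subrr.
  have r3 p : rfun (diff t3) ((p, 0) : C) =
      - sgz k (n - 1) *: ((0, act b' (f p)) : C).
    have := rfun_shift p ht3; rewrite !ft3 !act0r bt3 pair00 !addr0 diff0 scaler0.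
    by rewrite subrr scaleNr => /eqP; rewrite eq_sym addr_eq0 => /eqP.
  have c4 p : rfun t4 ((p, 0) : C) = (0, (rfun t4 ((p, 0) : C)).2).
    apply: pair_eq1; rewrite /t4 rfunB r3 c0 /=.
    by rewrite scaler0 subr0.
  have hg4 := cone_hom_snd (rfun_hom_deg ht4).
  set g4 := fun p => _ in hg4.
  (* With base 0 the remaining map is a cocycle, hence $b_5f$ plus a boundary. Since $b_5$ is
     closed, $b_5f$ is also a boundary in the roof, up to sign that of the element with base $b_5$
     and column 0. *)
  have [|b5 [g5 [hb5 db5 hg5 eg5]]] := act_surj hg4.
    move=> p; have := congr1 snd (rfun_shift p ht4).
    rewrite dt4 bt4 act0l c4 [rfun t4 ((diff p, 0) : C)]c4 cone_diffE /= -/(g4 p).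
    by rewrite (linear0f fc.1.1.1) addr0 scaler0 addr0.
  have [t5 [ht5 bt5 ft5]] :=
    roof_mk (homogZ (- sgz k (n - 1)) hb5) (hom_deg_in2 hg5).
  exists (t1 + t3 + t5); rewrite !diffD; apply/eqP.
  rewrite -subr_eq0 opprD addrA opprD addrA -/t2 -/t4 subr_eq0; apply/eqP.
  apply: roof_eq => [|p].
    by rewrite bt4 rbase_diff bt5 diffZ db5 scaler0.
  have /eqP := rfun_shift p ht5; rewrite -subr_eq => /eqP <-.
  rewrite !ft5 !act0r pair00 !addr0 bt5 c4 -/(g4 p) eg5.
  rewrite (linearZf (lact_linearl actP _)) cone_diffE /= (linear0f fc.1.1.1).
  rewrite addr0 diff0; apply: pair_eq => /=; first by rewrite !scaler0 !subr0.
  by rewrite scalerA mulrN sgzz scaleN1r opprK addrC.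
- have [[fl fA] fh] := fc.1.
  (* A closed lift of [F] needs $b$ and $g$ with $fF=bf+dg$: base $(-1)^nb$ and column $(F,-g)$ then
     form a cocycle. *)
  have hfF : hom_deg (n + 1) (f \o endo_fun F).
    have [[Fl FA] Fh] := hF; split; [split=> [c u v|p a]|move=> j p hp] => /=.
    + by rewrite Fl fl.
    + by rewrite FA fA.
    + by rewrite addrA; apply/fh/Fh.
  have dF0 p : diff (endo_fun F p) = sgz k n *: endo_fun F (diff p).
    have := congr1 (fun G : E => endo_fun G p) dF.
    rewrite -[diff F]/(endo_diff F) (endo_diff_homog hF) => /eqP.
    by rewrite subr_eq0 => /eqP.
  have df p : diff (f p) = - f (diff p).
    by apply/eqP; rewrite -addr_eq0; apply/eqP/fc.2.
  have [|b [g [hb db hg eg]]] := act_surj hfF.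
    move=> p; rewrite /hom_diff /= df dF0 (linearZf fl) -/(sgz k _) sgzD1.
    by rewrite scaleNr opprK addNr.
  rewrite addrK in hb hg eg.
  have hG : hom_deg n (fun p => (endo_fun F p, - g p) : C).
    have [[Fl FA] Fh] := hF; have [[gl gA] gh] := hg.
    split; [split=> [c u v|p a]|move=> j p hp] => /=.
    + by rewrite Fl gl; congr pair; rewrite /= opprD scalerN.
    + by rewrite FA gA; congr pair; rewrite /= ractNl.
    + by split; [apply: Fh|apply/homogN/gh].
  have [t [ht bt ft]] := roof_mk (homogZ (sgz k n) hb) hG.
  exists t, 0; rewrite diff0 addr0; split; last first.
    apply: val_inj; apply: funext => p.
    by rewrite -[RHS]/(endo_fun _ p) roof_cornerE ft /= addr0.
  apply: roof_eq => [|p]; first by rewrite rbase_diff bt diffZ db scaler0.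
  have /eqP := rfun_shift p ht; rewrite -subr_eq => /eqP <-.
  rewrite !ft !act0r pair00 !addr0 bt cone_diffE /= dF0.
  rewrite (linearZf (lact_linearl actP _)).
  have -> : f (endo_fun F p) = act b (f p) + hom_diff n g p by rewrite -eg.
  rewrite [rfun 0 _](_ : _ = 0) //; apply: pair_eq0 => /=.
    by rewrite scaler0 subr0 subrr.
  rewrite diffN scalerN opprK scalerA sgzz scale1r /hom_diff -/(sgz k n).
  by rewrite addrCA addKr subrK subrr.
Qed.
End Corner.

End RoofMaps.

(** * The algebras B, Lambda, C and the module V *)

(* The letters are those of the arrows, e.g. ADA stands for alpha delta alpha. *)
Variant B_basis :=
  E1 | E2 | Ga | De | Al | Be | Ta | AG | AD | BG | DA | TG | AT | ADA | DAG
| ATG | ADAG.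

Definition B_basis_seq :=
  [:: E1; E2; Ga; De; Al; Be; Ta; AG; AD; BG; DA; TG; AT; ADA; DAG; ATG; ADAG].
Definition B_basis_code (i : B_basis) : nat :=
  match i with
  | E1 => 0 | E2 => 1 | Ga => 2 | De => 3 | Al => 4 | Be => 5 | Ta => 6
  | AG => 7 | AD => 8 | BG => 9 | DA => 10 | TG => 11 | AT => 12 | ADA => 13
  | DAG => 14 | ATG => 15 | ADAG => 16
  end.
Lemma B_basis_codeK : cancel B_basis_code (nth E1 B_basis_seq).
Proof. by case. Qed.
HB.instance Definition _ := Countable.copy B_basis (can_type B_basis_codeK).
Lemma B_basis_enumP : Finite.axiom B_basis_seq.
Proof. by case. Qed.
HB.instance Definition _ := isFinite.Build B_basis B_basis_enumP.

Definition B_degn (i : B_basis) : nat :=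
  match i with
  | E1 | E2 => 0
  | Ga | De | Al | Be | Ta => 1
  | AG | AD | BG | DA | TG | AT => 2
  | ADA | DAG | ATG => 3
  | ADAG => 4
  end.
Definition B_deg (i : B_basis) : int := B_degn i.

Definition Balg (k : fieldType) (q : k) : Type := coords k B_basis.

Section B.
Variables (k : fieldType) (q : k).
Local Notation B := (Balg q).
HB.instance Definition _ := GRing.Lmodule.copy B (coords k B_basis).

(** Structure constants on normal words: concatenation, together with
    $\gamma\alpha=(q-1)\delta\alpha$ and $\gamma\beta=q\delta\alpha$. Words such as
    $\delta\alpha\delta$ and $\delta\alpha\tau$ are absent because
    $q\delta\alpha\delta=\gamma\beta\delta=0$ and $q\delta\alpha\tau=\gamma\beta\tau=0$. *)
Definition B_mul (u v : B) : B := fun i => match i with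
  | E1 => u E1 * v E1
  | E2 => u E2 * v E2
  | Ga => u E2 * v Ga + u Ga * v E1
  | De => u E2 * v De + u De * v E1
  | Al => u E1 * v Al + u Al * v E2
  | Be => u E1 * v Be + u Be * v E2
  | Ta => u E2 * v Ta + u Ta * v E2
  | AG => u E1 * v AG + u Al * v Ga + u AG * v E1
  | AD => u E1 * v AD + u Al * v De + u AD * v E1
  | BG => u E1 * v BG + u Be * v Ga + u BG * v E1
  | DA => u E2 * v DA + (q - 1) * (u Ga * v Al) + q * (u Ga * v Be) +
      u De * v Al + u DA * v E2
  | TG => u E2 * v TG + u Ta * v Ga + u TG * v E1
  | AT => u E1 * v AT + u Al * v Ta + u AT * v E2
  | ADA => u E1 * v ADA + u Al * v DA + (q - 1) * (u AG * v Al) +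
      q * (u AG * v Be) + u AD * v Al + u ADA * v E2
  | DAG => u E2 * v DAG + (q - 1) * (u Ga * v AG) + q * (u Ga * v BG) +
      u De * v AG + u DA * v Ga + u DAG * v E1
  | ATG => u E1 * v ATG + u Al * v TG + u AT * v Ga + u ATG * v E1
  | ADAG => u E1 * v ADAG + u Al * v DAG + (q - 1) * (u AG * v AG) +
      q * (u AG * v BG) + u AD * v AG + u ADA * v Ga + u ADAG * v E1
  end.

Definition B_one : B := fun i => match i with E1 | E2 => 1 | _ => 0 end.

(** The transposed matrix of $d$: besides $d\beta=\alpha\tau$ and $d\delta=\tau\gamma$, the Leibniz
    rule gives $d(\beta\gamma)=\alpha\tau\gamma$ and $d(\alpha\delta)=-\alpha\tau\gamma$, the sign
    being that of $\alpha$. *)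
Definition B_diff (u : B) : B := fun i => match i with
  | AT => u Be
  | TG => u De
  | ATG => u BG - u AD
  | _ => 0
  end.

Let B_mulA : associative B_mul.
Proof. by move=> u v w; apply: coordsP; case; rewrite /B_mul /=; ring. Qed.
Let B_mul1l : left_id B_one B_mul.
Proof. by move=> u; apply: coordsP; case; rewrite /B_mul /=; ring. Qed.
Let B_mul1r : right_id B_one B_mul.
Proof. by move=> u; apply: coordsP; case; rewrite /B_mul /=; ring. Qed.
Let B_mulDl : left_distributive B_mul +%R.
Proof.
by move=> u v w; apply: coordsP; case; rewrite coordE /B_mul !coordE; ring.
Qed.
Let B_mulDr : right_distributive B_mul +%R.
Proof.
by move=> u v w; apply: coordsP; case; rewrite coordE /B_mul !coordE; ring.
Qed.
Let B_one_neq0 : B_one != 0.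
Proof. by apply/eqP => /(congr1 (fun u : B => u E1))/eqP; rewrite oner_eq0. Qed.
HB.instance Definition _ := GRing.Zmodule_isNzRing.Build B
  B_mulA B_mul1l B_mul1r B_mulDl B_mulDr B_one_neq0.

Lemma B_mulE (u v : B) : u * v = B_mul u v. Proof. by []. Qed.

Let B_scaleAl (c : k) (u v : B) : c *: (u * v) = (c *: u) * v.
Proof.
by apply: coordsP; case; rewrite coordE !B_mulE /B_mul !coordE; ring.
Qed.
HB.instance Definition _ := GRing.Lmodule_isLalgebra.Build k B B_scaleAl.
Let B_scaleAr (c : k) (u v : B) : c *: (u * v) = u * (c *: v).
Proof.
by apply: coordsP; case; rewrite coordE !B_mulE /B_mul !coordE; ring.
Qed.
HB.instance Definition _ := GRing.Lalgebra_isAlgebra.Build k B B_scaleAr.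

Definition B_homog (n : int) (u : B) := coord_homog B_deg n u.
Let B_grading : is_grading B_homog.
Proof. exact: coord_grading. Qed.
Let B_diff_linear : linear B_diff.
Proof.
by move=> c u v; apply: coordsP; case; rewrite !coordE /B_diff ?coordE; ring.
Qed.
Let B_diff_homog n u : B_homog n u -> B_homog (n + 1) (B_diff u).
Proof.
move=> hu; case=> //= h; rewrite /B_diff ?hu ?subrr //;
  by apply: contra h => /eqP <-.
Qed.
Let B_diff_diff u : B_diff (B_diff u) = 0.
Proof. by apply: coordsP; case; rewrite /B_diff ?subrr. Qed.
HB.instance Definition _ := isComplex.Build k B B_grading B_diff_linear
  B_diff_homog B_diff_diff.

Let B_homog1 : homog 0 (1 : B).
Proof. by case. Qed.
Let B_homogM i j (u v : B) : homog i u -> homog j v -> homog (i + j) (u * v).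
Proof.
move=> hu hv l hl; rewrite B_mulE /B_mul.
have E (x y : B_basis) : B_deg x + B_deg y = B_deg l -> u x * v y = 0.
  by move=> e; apply: coord_homogM hu hv _; rewrite e.
by case: l hl E => _ E; rewrite !E // ?mulr0 ?addr0.
Qed.
Let B_diffM i (u v : B) : homog i u ->
  diff (u * v) = diff u * v + (-1 : k) ^ i *: (u * diff v).
Proof.
move=> hu; rewrite scalerAl -(coord_sgnE hu); apply: coordsP => l.
rewrite -[diff u]/(B_diff u) -[diff v]/(B_diff v) -[diff _]/(B_diff _) coordE !B_mulE.
by case: l; rewrite /B_mul /B_diff /= /coord_sgn /= /exprz /=; ring.
Qed.
HB.instance Definition _ := isDGAlgebra.Build k B B_homog1 B_homogM B_diffM.

End B.

(* Lw stands for y x. *)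
Variant L_basis := L1 | Lx | Ly | Lw.
Definition L_basis_code (i : L_basis) : bool * bool :=
  match i with
  | L1 => (false, false) | Lx => (true, false)
  | Ly => (false, true) | Lw => (true, true)
  end.
Definition L_basis_decode (b : bool * bool) : L_basis :=
  if b.1 then if b.2 then Lw else Lx else if b.2 then Ly else L1.
Lemma L_basis_codeK : cancel L_basis_code L_basis_decode.
Proof. by case. Qed.
HB.instance Definition _ := Finite.copy L_basis (can_type L_basis_codeK).

Definition L_deg (i : L_basis) : int :=
  match i with L1 => 0 | Lx | Ly => 2 | Lw => 4 end.

Definition Lalg (k : fieldType) (q : k) : Type := coords k L_basis.

Section L.
Variables (k : fieldType) (q : k).
Local Notation L := (Lalg q).
HB.instance Definition _ := GRing.Lmodule.copy L (coords k L_basis).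

Definition L_mul (u v : L) : L := fun i => match i with
  | L1 => u L1 * v L1
  | Lx => u L1 * v Lx + u Lx * v L1
  | Ly => u L1 * v Ly + u Ly * v L1
  | Lw => u L1 * v Lw + u Ly * v Lx + q * (u Lx * v Ly) + u Lw * v L1
  end.
Definition L_one : L := fun i => if i is L1 then 1 else 0.
Definition L_diff (u : L) : L := 0.

Let L_mulA : associative L_mul.
Proof. by move=> u v w; apply: coordsP; case; rewrite /L_mul /=; ring. Qed.
Let L_mul1l : left_id L_one L_mul.
Proof. by move=> u; apply: coordsP; case; rewrite /L_mul /=; ring. Qed.
Let L_mul1r : right_id L_one L_mul.
Proof. by move=> u; apply: coordsP; case; rewrite /L_mul /=; ring. Qed.
Let L_mulDl : left_distributive L_mul +%R.
Proof.
by move=> u v w; apply: coordsP; case; rewrite coordE /L_mul !coordE; ring.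
Qed.
Let L_mulDr : right_distributive L_mul +%R.
Proof.
by move=> u v w; apply: coordsP; case; rewrite coordE /L_mul !coordE; ring.
Qed.
Let L_one_neq0 : L_one != 0.
Proof. by apply/eqP => /(congr1 (fun u : L => u L1))/eqP; rewrite oner_eq0. Qed.
HB.instance Definition _ := GRing.Zmodule_isNzRing.Build L
  L_mulA L_mul1l L_mul1r L_mulDl L_mulDr L_one_neq0.

Lemma L_mulE (u v : L) : u * v = L_mul u v. Proof. by []. Qed.

Let L_scaleAl (c : k) (u v : L) : c *: (u * v) = (c *: u) * v.
Proof. by apply: coordsP; case; rewrite coordE !L_mulE /L_mul !coordE; ring. Qed.
HB.instance Definition _ := GRing.Lmodule_isLalgebra.Build k L L_scaleAl.
Let L_scaleAr (c : k) (u v : L) : c *: (u * v) = u * (c *: v).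
Proof. by apply: coordsP; case; rewrite coordE !L_mulE /L_mul !coordE; ring. Qed.
HB.instance Definition _ := GRing.Lalgebra_isAlgebra.Build k L L_scaleAr.

Definition L_homog (n : int) (u : L) := coord_homog L_deg n u.
Let L_grading : is_grading L_homog.
Proof. exact: coord_grading. Qed.
Let L_diff_linear : linear L_diff.
Proof. by move=> c u v; rewrite /L_diff scaler0 addr0. Qed.
Let L_diff_homog n u : L_homog n u -> L_homog (n + 1) (L_diff u).
Proof. by []. Qed.
Let L_diff_diff u : L_diff (L_diff u) = 0.
Proof. by []. Qed.
HB.instance Definition _ := isComplex.Build k L L_grading L_diff_linear
  L_diff_homog L_diff_diff.

Let L_homog1 : homog 0 (1 : L).
Proof. by case. Qed.
Let L_homogM i j (u v : L) : homog i u -> homog j v -> homog (i + j) (u * v).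
Proof.
move=> hu hv l hl; rewrite L_mulE /L_mul.
have E (x y : L_basis) : L_deg x + L_deg y = L_deg l -> u x * v y = 0.
  by move=> e; apply: coord_homogM hu hv _; rewrite e.
by case: l hl E => _ E; rewrite !E // ?mulr0 ?addr0.
Qed.
Let L_diffM i (u v : L) : homog i u ->
  diff (u * v) = diff u * v + (-1 : k) ^ i *: (u * diff v).
Proof. by rewrite mul0r mulr0 scaler0 addr0. Qed.
HB.instance Definition _ := isDGAlgebra.Build k L L_homog1 L_homogM L_diffM.

Lemma L_diff0 (u : L) : diff u = 0. Proof. by []. Qed.

End L.

Variant C_basis := C1 | Ct.
Definition C_basis_code (i : C_basis) : bool := if i is Ct then true else false.
Definition C_basis_decode (b : bool) : C_basis := if b then Ct else C1.
Lemma C_basis_codeK : cancel C_basis_code C_basis_decode.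
Proof. by case. Qed.
HB.instance Definition _ := Finite.copy C_basis (can_type C_basis_codeK).

Definition C_deg (i : C_basis) : int := if i is Ct then 1 else 0.

Definition Calg (k : fieldType) : Type := coords k C_basis.

Section C.
Variables (k : fieldType).
Local Notation C := (Calg k).
HB.instance Definition _ := GRing.Lmodule.copy C (coords k C_basis).

Definition C_mul (u v : C) : C := fun i => match i with
  | C1 => u C1 * v C1
  | Ct => u C1 * v Ct + u Ct * v C1
  end.
Definition C_one : C := fun i => if i is C1 then 1 else 0.
Definition C_diff (u : C) : C := 0.

Let C_mulA : associative C_mul.
Proof. by move=> u v w; apply: coordsP; case; rewrite /C_mul /=; ring. Qed.
Let C_mul1l : left_id C_one C_mul.
Proof. by move=> u; apply: coordsP; case; rewrite /C_mul /=; ring. Qed.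
Let C_mul1r : right_id C_one C_mul.
Proof. by move=> u; apply: coordsP; case; rewrite /C_mul /=; ring. Qed.
Let C_mulDl : left_distributive C_mul +%R.
Proof.
by move=> u v w; apply: coordsP; case; rewrite coordE /C_mul !coordE; ring.
Qed.
Let C_mulDr : right_distributive C_mul +%R.
Proof.
by move=> u v w; apply: coordsP; case; rewrite coordE /C_mul !coordE; ring.
Qed.
Let C_one_neq0 : C_one != 0.
Proof. by apply/eqP => /(congr1 (fun u : C => u C1))/eqP; rewrite oner_eq0. Qed.
HB.instance Definition _ := GRing.Zmodule_isNzRing.Build C
  C_mulA C_mul1l C_mul1r C_mulDl C_mulDr C_one_neq0.

Lemma C_mulE (u v : C) : u * v = C_mul u v. Proof. by []. Qed.

Let C_scaleAl (c : k) (u v : C) : c *: (u * v) = (c *: u) * v.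
Proof. by apply: coordsP; case; rewrite coordE !C_mulE /C_mul !coordE; ring. Qed.
HB.instance Definition _ := GRing.Lmodule_isLalgebra.Build k C C_scaleAl.
Let C_scaleAr (c : k) (u v : C) : c *: (u * v) = u * (c *: v).
Proof. by apply: coordsP; case; rewrite coordE !C_mulE /C_mul !coordE; ring. Qed.
HB.instance Definition _ := GRing.Lalgebra_isAlgebra.Build k C C_scaleAr.

Definition C_homog (n : int) (u : C) := coord_homog C_deg n u.
Let C_grading : is_grading C_homog.
Proof. exact: coord_grading. Qed.
Let C_diff_linear : linear C_diff.
Proof. by move=> c u v; rewrite /C_diff scaler0 addr0. Qed.
Let C_diff_homog n u : C_homog n u -> C_homog (n + 1) (C_diff u).
Proof. by []. Qed.
Let C_diff_diff u : C_diff (C_diff u) = 0.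
Proof. by []. Qed.
HB.instance Definition _ := isComplex.Build k C C_grading C_diff_linear
  C_diff_homog C_diff_diff.

Let C_homog1 : homog 0 (1 : C).
Proof. by case. Qed.
Let C_homogM i j (u v : C) : homog i u -> homog j v -> homog (i + j) (u * v).
Proof.
move=> hu hv l hl; rewrite C_mulE /C_mul.
have E (x y : C_basis) : C_deg x + C_deg y = C_deg l -> u x * v y = 0.
  by move=> e; apply: coord_homogM hu hv _; rewrite e.
by case: l hl E => _ E; rewrite !E // ?mulr0 ?addr0.
Qed.
Let C_diffM i (u v : C) : homog i u ->
  diff (u * v) = diff u * v + (-1 : k) ^ i *: (u * diff v).
Proof. by rewrite mul0r mulr0 scaler0 addr0. Qed.
HB.instance Definition _ := isDGAlgebra.Build k C C_homog1 C_homogM C_diffM.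

Lemma C_diff0 (u : C) : diff u = 0. Proof. by []. Qed.

End C.

(* The classes of 1 and x in Lambda / (x + y) Lambda. *)
Variant V_basis := V_1 | V_x.
Definition V_basis_code (i : V_basis) : bool := if i is V_x then true else false.
Definition V_basis_decode (b : bool) : V_basis := if b then V_x else V_1.
Lemma V_basis_codeK : cancel V_basis_code V_basis_decode.
Proof. by case. Qed.
HB.instance Definition _ := Finite.copy V_basis (can_type V_basis_codeK).

Definition V_deg (i : V_basis) : int := if i is V_x then 3 else 1.

Definition Vmod (k : fieldType) (q : k) : Type := coords k V_basis.

Section V.
Variables (k : fieldType) (q : k).
Local Notation L := (Lalg q).
Local Notation V := (Vmod q).
HB.instance Definition _ := GRing.Lmodule.copy V (coords k V_basis).

Definition V_homog (n : int) (u : V) := coord_homog V_deg n u.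
Definition V_diff (u : V) : V := 0.
Let V_grading : is_grading V_homog.
Proof. exact: coord_grading. Qed.
Let V_diff_linear : linear V_diff.
Proof. by move=> c u v; rewrite /V_diff scaler0 addr0. Qed.
Let V_diff_homog n u : V_homog n u -> V_homog (n + 1) (V_diff u).
Proof. by []. Qed.
Let V_diff_diff u : V_diff (V_diff u) = 0.
Proof. by []. Qed.
HB.instance Definition _ := isComplex.Build k V V_grading V_diff_linear
  V_diff_homog V_diff_diff.

(** Modulo $x+y$ the class of $y$ is minus that of $x$, and $yx=(x+y)x$ vanishes, as does
    $xy=qyx$. *)
Definition V_act (m : V) (a : L) : V := fun i => match i with
  | V_1 => m V_1 * a L1
  | V_x => m V_x * a L1 + m V_1 * (a Lx - a Ly)
  end.
Let V_linearl a : linear (V_act^~ a).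
Proof. by move=> c u v; apply: coordsP; case; rewrite !coordE /V_act !coordE; ring. Qed.
Let V_linearr m : linear (V_act m).
Proof. by move=> c u v; apply: coordsP; case; rewrite !coordE /V_act !coordE; ring. Qed.
Let V_act1 m : V_act m 1 = m.
Proof. by apply: coordsP; case; rewrite /V_act /= /GRing.one /= /L_one; ring. Qed.
Let V_actM m a b : V_act m (a * b) = V_act (V_act m a) b.
Proof. by apply: coordsP; case; rewrite L_mulE /V_act /L_mul; ring. Qed.
Let V_act_homog i j (m : V) (a : L) :
  homog i m -> homog j a -> homog (i + j) (V_act m a).
Proof.
move=> hm ha l hl.
have E x y : V_deg x + L_deg y = V_deg l -> m x * a y = 0.
  move=> e; have [ei|/hm ->] := eqVneq (V_deg x) i; last by rewrite mul0r.
  have [ej|/ha ->] := eqVneq (L_deg y) j; last by rewrite mulr0.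
  by rewrite -e ei ej eqxx in hl.
by case: l hl E => _ E; rewrite /V_act ?mulrBr !E // ?subrr ?addr0.
Qed.
Let V_act_diff i m (a : L) : homog i m ->
  diff (V_act m a) = V_act (diff m) a + (-1 : k) ^ i *: V_act m (diff a).
Proof.
by move=> _; rewrite L_diff0 (linear0f (V_linearl a)) (linear0f (V_linearr m))
  scaler0 addr0.
Qed.
HB.instance Definition _ := isDGModule.Build k L V
  V_linearl V_linearr V_act1 V_actM V_act_homog V_act_diff.

Lemma V_diff0 (u : V) : diff u = 0. Proof. by []. Qed.
Lemma V_ractE (m : V) (a : L) : ract m a = V_act m a. Proof. by []. Qed.

End V.

(** * Presentations by quivers with relations *)

Section Congruence.
Variables (k : fieldType) (Q : quiver) (S : path_algebra k Q -> Prop).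
Local Notation kQ := (path_algebra k Q).
Implicit Types a b c : kQ.

Lemma path_scaleAl x a b : x *: (a * b) = (x *: a) * b.
Proof. by rewrite [RHS](linearZf (path_mul_linearl b)). Qed.
Lemma path_scaleAr x a b : x *: (a * b) = a * (x *: b).
Proof. by rewrite [RHS](linearZf (path_mul_linearr a)). Qed.

Lemma ideal_scale x a : ideal S a -> ideal S (x *: a).
Proof. by move=> Sa; rewrite -[a]mul1r path_scaleAl; apply: IdealMl. Qed.

Definition cong a b := ideal S (a - b).

Lemma cong_refl a : cong a a.
Proof. by rewrite /cong subrr; apply: Ideal0. Qed.
Lemma cong_trans b a c : cong a b -> cong b c -> cong a c.
Proof. by move=> ab bc; have := IdealD ab bc; rewrite addrA subrK. Qed.
Lemma cong_sym a b : cong a b -> cong b a.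
Proof. by move=> ab; have := ideal_scale (-1) ab; rewrite scaleN1r opprB. Qed.
Lemma congD a b a' b' : cong a b -> cong a' b' -> cong (a + a') (b + b').
Proof. by move=> ab ab'; have := IdealD ab ab'; rewrite addrACA -opprD. Qed.
Lemma congZ x a b : cong a b -> cong (x *: a) (x *: b).
Proof. by rewrite /cong -scalerBr; apply: ideal_scale. Qed.
Lemma congMl a b c : cong a b -> cong (c * a) (c * b).
Proof. by rewrite /cong -mulrBr; apply: IdealMl. Qed.
Lemma congMr a b c : cong a b -> cong (a * c) (b * c).
Proof. by rewrite /cong -mulrBl; apply: IdealMr. Qed.
Lemma cong_sum (I : Type) (s : seq I) (F G : I -> kQ) :
  (forall i, cong (F i) (G i)) -> cong (\sum_(i <- s) F i) (\sum_(i <- s) G i).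
Proof.
move=> FG; elim: s => [|i s IH]; first by rewrite !big_nil; apply: cong_refl.
by rewrite !big_cons; apply: congD.
Qed.

End Congruence.

Section Presentation.
Variables (k : fieldType) (Q : quiver) (A : dgAlgType k).
Local Notation kQ := (path_algebra k Q).
Variables (E : vertex Q -> A) (X : arrow Q -> A).
Hypotheses (E_sum : \sum_v E v = 1)
  (EE : forall v w, E v * E w = if v == w then E v else 0)
  (EX : forall a, E (target a) * X a = X a)
  (XE : forall a, X a * E (source a) = X a).

Definition path_val (p : qpath Q) : A :=
  E (path_end p) * \prod_(a <- (val p).2) X a.

Definition path_eval : kQ -> A := path_lift path_val.

Lemma path_eval_linear : linear path_eval.
Proof. exact: path_lift_linear. Qed.
Lemma path_eval_elt p : path_eval (path_elt k p) = path_val p.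
Proof. exact: path_lift_elt. Qed.

Lemma path_eval_vertex v : path_eval (vertex_elt k v) = E v.
Proof. by rewrite path_eval_elt /path_val big_nil mulr1. Qed.
Lemma path_eval_arrow a : path_eval (arrow_elt k a) = X a.
Proof. by rewrite path_eval_elt /path_val big_seq1 EX. Qed.

Lemma prod_start v s : is_path v s ->
  E v * \prod_(a <- s) X a * E (last v [seq source a | a <- s]) =
  E v * \prod_(a <- s) X a.
Proof.
elim: s v => [|a s IH] v /=; first by rewrite big_nil mulr1 EE eqxx.
case/andP=> /eqP <- /IH e; rewrite big_cons mulrA EX -XE.
by rewrite -!mulrA [E (source a) * (_ * _)]mulrA e.
Qed.

Lemma path_val_start p : path_val p * E (path_start p) = path_val p.
Proof. exact: prod_start (valP p). Qed.
Lemma path_val_end p : E (path_end p) * path_val p = path_val p.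
Proof. by rewrite /path_val mulrA EE eqxx. Qed.

Lemma path_eval1 : path_eval 1 = 1.
Proof.
rewrite -E_sum [1]/(path_one k Q) /path_one.
rewrite (big_morph _ (linearDf path_eval_linear) (linear0f path_eval_linear)).
by apply: eq_bigr => v _; rewrite path_eval_vertex.
Qed.

Lemma path_evalM : {morph path_eval : a b / a * b}.
Proof.
have el := path_eval_linear; have e0 := linear0f el.
move=> a b; elim/path_ind: a => [|c a a' IH IH'|p]; first by rewrite mul0r e0 mul0r.
  by rewrite mulrDl -path_scaleAl !el IH IH' mulrDl scalerAl.
elim/path_ind: b => [|c b b' IH IH'|r]; first by rewrite mulr0 e0 mulr0.
  by rewrite mulrDr -path_scaleAr !el IH IH' mulrDr scalerAr.
rewrite [_ * _]path_mul_elt !path_eval_elt /path_prod.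
have [e|n] := eqVneq (path_start p) (path_end r); last first.
  rewrite path_comp_neq //= e0 -path_val_start -[path_val r]path_val_end.
  by rewrite mulrA -(mulrA (path_val p)) EE (negbTE n) mulr0 mul0r.
have [t -> et] := path_compP e; rewrite /= path_eval_elt.
have -> : path_val t = path_val p * \prod_(a <- (val r).2) X a.
  by rewrite /path_val /path_end et big_cat mulrA.
by rewrite [path_val r]/path_val mulrA -e path_val_start.
Qed.

Variables (deg : arrow Q -> int) (rels : seq kQ).
Variables (I : finType) (basis : I -> A) (coord : A -> I -> k).
Variable word : I -> qpath Q.
Hypotheses (coord_lin : forall c u v i,
    coord (c *: u + v) i = c * coord u i + coord v i)
  (basis_span : forall u, u = \sum_i coord u i *: basis i)
  (wordE : forall i, path_val (word i) = basis i)
  (word_deg : forall n u i, homog n u -> path_deg deg (word i) != n ->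
    coord u i = 0)
  (Eh : forall v, homog 0 (E v)) (Xh : forall a, homog (deg a) (X a))
  (rel0 : forall r, r \in rels -> path_eval r = 0).

Definition section (u : A) : kQ := \sum_i coord u i *: path_elt k (word i).

Local Notation "a == b" := (cong (fun r => r \in rels) a b).
Hypotheses (vertex_section : forall v, vertex_elt k v == section (E v))
  (arrow_section : forall a i,
    arrow_elt k a * path_elt k (word i) == section (X a * basis i)).

Lemma section_linear : linear section.
Proof.
move=> c u v; rewrite /section scaler_sumr -big_split; apply: eq_bigr => i _.
by rewrite coord_lin scalerDl scalerA.
Qed.

Lemma sectionK u : path_eval (section u) = u.
Proof.
rewrite {2}[u]basis_span.
rewrite (big_morph _ (linearDf path_eval_linear) (linear0f path_eval_linear)).
apply: eq_bigr => i _.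
by rewrite (linearZf path_eval_linear) path_eval_elt wordE.
Qed.

Lemma path_elt_cons (p r : qpath Q) a s : val p = (target a, a :: s) ->
  val r = (source a, s) -> path_elt k p = arrow_elt k a * path_elt k r.
Proof.
move=> ep er; rewrite [_ * _]path_mul_elt /path_prod.
have [|t -> et] := @path_compP Q (arrow_path a) r.
  by rewrite /path_end er.
by congr path_elt; apply: val_inj; rewrite ep et er.
Qed.

(** By induction on the path, stripping its leftmost arrow: the span of the chosen words contains
    the vertices and, modulo the relations, is stable under left multiplication by arrows. *)
Lemma cong_section p : path_elt k p == section (path_val p).
Proof.
case: p => -[v s] /= vs; elim: s v vs => [|a s IH] v vs.
  rewrite /path_val big_nil mulr1.
  have -> : exist _ (v, [::]) vs = trivial_path v by apply: val_inj.
  exact: vertex_section.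
have /andP[/eqP ev sp] : (target a == v) && is_path (source a) s := vs.
pose r : qpath Q := Sub (source a, s) sp.
rewrite (@path_elt_cons (exist _ (v, a :: s) vs) r a s) ?ev //.
have IHr : path_elt k r == section (path_val r) := IH _ sp.
apply: cong_trans (congMl _ IHr) _.
have -> : path_val (exist _ (v, a :: s) vs) = X a * path_val r.
  by rewrite /path_val /path_end /= big_cons -ev !mulrA EX XE.
have -> : section (X a * path_val r) =
    \sum_i coord (path_val r) i *: section (X a * basis i).
  rewrite {1}[path_val r]basis_span mulr_sumr.
  rewrite (big_morph _ (linearDf section_linear) (linear0f section_linear)).
  by apply: eq_bigr => i _; rewrite -scalerAr (linearZf section_linear).
rewrite {1}/section mulr_sumr; apply: cong_sum => i.
rewrite -(path_scaleAr (coord (path_val r) i)).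
exact: (congZ (coord (path_val r) i) (arrow_section a i)).
Qed.

Lemma path_homogE n (a : kQ) :
  path_homog deg n a <-> forall p, path_deg deg p != n -> a@_p = 0.
Proof.
split=> [ha p np|ha p].
  by apply/eqP; rewrite mcoeff_eq0; apply: contra np => /ha ->.
by rewrite -mcoeff_neq0 => /eqP pa; apply: contra_notP pa => /eqP/ha.
Qed.

Lemma path_val_homog p : homog (path_deg deg p) (path_val p).
Proof.
rewrite /path_val -[path_deg _ _]add0r; apply: homogM; first exact: Eh.
rewrite /path_deg; elim: (val p).2 => [|a s IH].
  by rewrite !big_nil; apply: homog1.
by rewrite !big_cons; apply: homogM.
Qed.

(** Every element of $kQ$ is congruent to the section of its value, so an element of value 0 lies in
    the ideal; this bounds the quotient by the chosen words without a confluence argument. *)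
Theorem presentsP : presents deg rels path_eval.
Proof.
have el := path_eval_linear.
split.
- by split=> //; split; [apply: path_eval1|apply: path_evalM].
- by move=> b; exists (section b); rewrite sectionK.
- move=> a; split=> [a0|].
    have : a == section (path_eval a).
      elim/path_ind: (a) => [|c b b' IH IH'|p].
      - by rewrite (linear0f el) (linear0f section_linear); apply: cong_refl.
      - by rewrite el section_linear; apply: congD => //; apply: congZ.
      - by rewrite path_eval_elt; apply: cong_section.
    by rewrite a0 (linear0f section_linear) /cong subr0.
  elim=> {a} [r /rel0||r s _ r0 _ s0|r s _ s0|r s _ r0] //.
  - exact: linear0f el.
  - by rewrite (linearDf el) r0 s0 addr0.
  - by rewrite path_evalM s0 mulr0.
  - by rewrite path_evalM r0 mul0r.
- move=> n b; split=> [hb|[a ha <-]].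
    exists (section b); last exact: sectionK.
    apply/path_homogE => p np; rewrite /section.
    rewrite (big_morph (fun a : kQ => a@_p) (mcoeffD p) (mcoeff0 p)).
    apply: big1 => i _; rewrite mcoeffZ path_eltE mcoeffU.
    case: eqP => [ep|_]; last by rewrite mulr0.
    by rewrite (word_deg hb) ?mul0r // ep.
  rewrite /path_eval /path_lift big_seq; apply: (gr_sum homog_grading) => p pa.
  by apply: homogZ; rewrite -(ha p pa); apply: path_val_homog.
Qed.

End Presentation.

Section PathWords.
Variables (k : fieldType) (Q : quiver).

Lemma arrow_path_elt (p : qpath Q) a :
  val p = (target a, [:: a]) -> path_elt k p = arrow_elt k a.
Proof. by move=> e; congr path_elt; apply: val_inj. Qed.

Lemma arrow_path_neq a (p : qpath Q) : source a != path_end p ->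
  arrow_elt k a * path_elt k p = 0.
Proof. by move=> n; rewrite [_ * _]path_mul_elt /path_prod path_comp_neq. Qed.

Lemma arrow_vertex a (p : qpath Q) : val p = (source a, [::]) ->
  arrow_elt k a * path_elt k p = arrow_elt k a.
Proof.
move=> ep; rewrite [_ * _]path_mul_elt /path_prod.
have [|t -> et] := @path_compP Q (arrow_path a) p; first by rewrite /path_end ep.
by rewrite /=; congr path_elt; apply: val_inj; rewrite et ep.
Qed.

End PathWords.

Section PresentationB.
Variables (k : fieldType) (q : k).
Hypothesis q_neq0 : q != 0.
Local Notation B := (Balg q).
Local Notation kQ := (path_algebra k B_quiver).
Local Notation bas := (@coord_basis k B_basis : B_basis -> B).

Definition B_vertex_val (v : vertex B_quiver) : B :=
  match v with V1 => bas E1 | V2 => bas E2 end.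
Definition B_arrow_val (a : arrow B_quiver) : B :=
  match a with
  | Gamma => bas Ga | Delta => bas De | Alpha => bas Al | Beta => bas Be
  | Tau => bas Ta
  end.

Definition mkpath (v : vertex B_quiver) (s : seq (arrow B_quiver))
  (p : is_path v s) : qpath B_quiver := Sub (v, s) p.

Definition B_word (i : B_basis) : qpath B_quiver :=
  match i with
  | E1 => @mkpath V1 [::] isT
  | E2 => @mkpath V2 [::] isT
  | Ga => @mkpath V2 [:: Gamma] isT
  | De => @mkpath V2 [:: Delta] isT
  | Al => @mkpath V1 [:: Alpha] isT
  | Be => @mkpath V1 [:: Beta] isT
  | Ta => @mkpath V2 [:: Tau] isT
  | AG => @mkpath V1 [:: Alpha; Gamma] isT
  | AD => @mkpath V1 [:: Alpha; Delta] isT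
  | BG => @mkpath V1 [:: Beta; Gamma] isT
  | DA => @mkpath V2 [:: Delta; Alpha] isT
  | TG => @mkpath V2 [:: Tau; Gamma] isT
  | AT => @mkpath V1 [:: Alpha; Tau] isT
  | ADA => @mkpath V1 [:: Alpha; Delta; Alpha] isT
  | DAG => @mkpath V2 [:: Delta; Alpha; Gamma] isT
  | ATG => @mkpath V1 [:: Alpha; Tau; Gamma] isT
  | ADAG => @mkpath V1 [:: Alpha; Delta; Alpha; Gamma] isT
  end.

(* [None] stands for the product 0. *)
Definition B_nf (a : B_arrow) (i : B_basis) : option (k * B_basis) :=
  match a, i with
  | Gamma, E1 => Some (1, Ga)
  | Gamma, Al => Some (q - 1, DA)
  | Gamma, Be => Some (q, DA)
  | Gamma, AG => Some (q - 1, DAG)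
  | Gamma, BG => Some (q, DAG)
  | Delta, E1 => Some (1, De)
  | Delta, Al => Some (1, DA)
  | Delta, AG => Some (1, DAG)
  | Alpha, E2 => Some (1, Al)
  | Alpha, Ga => Some (1, AG)
  | Alpha, De => Some (1, AD)
  | Alpha, Ta => Some (1, AT)
  | Alpha, DA => Some (1, ADA)
  | Alpha, TG => Some (1, ATG)
  | Alpha, DAG => Some (1, ADAG)
  | Beta, E2 => Some (1, Be)
  | Beta, Ga => Some (1, BG)
  | Tau, E2 => Some (1, Ta)
  | Tau, Ga => Some (1, TG)
  | _, _ => None
  end.

Definition B_nf_val (x : option (k * B_basis)) : B :=
  if x is Some (c, i) then c *: bas i else 0.

Definition B_lmul (a : B_arrow) (v : B) : B := fun i =>
  match a, i with
  | Gamma, Ga => v E1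
  | Gamma, DA => (q - 1) * v Al + q * v Be
  | Gamma, DAG => (q - 1) * v AG + q * v BG
  | Delta, De => v E1
  | Delta, DA => v Al
  | Delta, DAG => v AG
  | Alpha, Al => v E2
  | Alpha, AG => v Ga
  | Alpha, AD => v De
  | Alpha, AT => v Ta
  | Alpha, ADA => v DA
  | Alpha, ATG => v TG
  | Alpha, ADAG => v DAG
  | Beta, Be => v E2
  | Beta, BG => v Ga
  | Tau, Ta => v E2
  | Tau, TG => v Ga
  | _, _ => 0
  end.

Lemma B_lmulE a v : B_arrow_val a * v = B_lmul a v.
Proof.
apply: coordsP; case: a; case; rewrite B_mulE /B_mul /coord_basis /=;
  by rewrite ?(mul0r, mul1r, mulr0, add0r, addr0).
Qed.

Lemma B_nfE a i : B_arrow_val a * bas i = B_nf_val (B_nf a i).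
Proof.
rewrite B_lmulE; apply: coordsP; case: a; case: i; case=> //=;
  by rewrite ?coordE /coord_basis /= ?(mulr0, mulr1, add0r, addr0).
Qed.

Local Notation g := (arrow_elt k (Gamma : arrow B_quiver) : kQ).
Local Notation d := (arrow_elt k (Delta : arrow B_quiver) : kQ).
Local Notation a := (arrow_elt k (Alpha : arrow B_quiver) : kQ).
Local Notation b := (arrow_elt k (Beta : arrow B_quiver) : kQ).
Local Notation t := (arrow_elt k (Tau : arrow B_quiver) : kQ).
Local Notation "x == y" := (cong (fun r => r \in B_relations q) x y).

Lemma B_rel (n : nat) : (n < 7)%N -> nth 0 (B_relations q) n == 0.
Proof. by move=> hn; rewrite /cong subr0; apply: IdealGen; apply: mem_nth. Qed.

Lemma bd0 : b * d == 0. Proof. exact: (@B_rel 0). Qed.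
Lemma db0 : d * b == 0. Proof. exact: (@B_rel 1). Qed.
Lemma bt0 : b * t == 0. Proof. exact: (@B_rel 2). Qed.
Lemma td0 : t * d == 0. Proof. exact: (@B_rel 3). Qed.
Lemma tt0 : t * t == 0. Proof. exact: (@B_rel 4). Qed.
Lemma gb_rel : g * b == q *: (d * a).
Proof. by have := @B_rel 5 isT; rewrite /cong subr0. Qed.
Lemma ga_rel : g * a == (q - 1) *: (d * a).
Proof. by have := @B_rel 6 isT; rewrite /cong subr0. Qed.

Lemma cong0l (x y : kQ) : x == 0 -> x * y == 0.
Proof. by rewrite /cong !subr0 => h; apply: IdealMr. Qed.
Lemma cong0r (x y : kQ) : y == 0 -> x * y == 0.
Proof. by rewrite /cong !subr0 => h; apply: IdealMl. Qed.

(* q d a z = g b z vanishes when b z does. *)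
Lemma da0 (z : kQ) : b * z == 0 -> d * (a * z) == 0.
Proof.
move=> bz; have h : q *: (d * a) * z == 0.
  apply: cong_trans (congMr z (cong_sym gb_rel)) _.
  by rewrite -mulrA; apply: cong0r.
have := congZ q^-1 h.
by rewrite -path_scaleAl scalerA mulVf // scale1r scaler0 mulrA.
Qed.

Lemma dad0 : d * (a * d) == 0. Proof. exact: da0 bd0. Qed.
Lemma dat0 : d * (a * t) == 0. Proof. exact: da0 bt0. Qed.

Lemma cong2 (x y z : kQ) : x * y == 0 -> x * (y * z) == 0.
Proof. by rewrite mulrA; apply: cong0l. Qed.
Lemma cong3 (x y z w : kQ) : x * (y * z) == 0 -> x * (y * (z * w)) == 0.
Proof. by rewrite !mulrA; apply: cong0l. Qed.

Lemma gb_mul z : g * (b * z) == q *: (d * (a * z)).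
Proof. by rewrite !mulrA path_scaleAl; apply: congMr gb_rel. Qed.
Lemma ga_mul z : g * (a * z) == (q - 1) *: (d * (a * z)).
Proof. by rewrite !mulrA path_scaleAl; apply: congMr ga_rel. Qed.
Lemma ga_mul0 z : d * (a * z) == 0 -> g * (a * z) == 0.
Proof.
by move=> h; apply: cong_trans (ga_mul z) _; rewrite -[0](scaler0 _ (q - 1));
  apply: congZ.
Qed.

Definition B_prod (i : B_basis) : kQ :=
  match i with
  | E1 => vertex_elt k (V1 : vertex B_quiver)
  | E2 => vertex_elt k (V2 : vertex B_quiver)
  | Ga => g | De => d | Al => a | Be => b | Ta => t
  | AG => a * g | AD => a * d | BG => b * g | DA => d * a | TG => t * g
  | AT => a * t | ADA => a * (d * a) | DAG => d * (a * g) | ATG => a * (t * g)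
  | ADAG => a * (d * (a * g))
  end.

Lemma B_wordE i : path_elt k (B_word i) = B_prod i.
Proof.
have st (x : arrow B_quiver) m n s : val (B_word m) = (target x, x :: s) ->
    val (B_word n) = (source x, s) ->
    path_elt k (B_word m) = arrow_elt k x * path_elt k (B_word n).
  exact: path_elt_cons.
have wG : path_elt k (B_word Ga) = g by apply: arrow_path_elt.
have wD : path_elt k (B_word De) = d by apply: arrow_path_elt.
have wA : path_elt k (B_word Al) = a by apply: arrow_path_elt.
have wT : path_elt k (B_word Ta) = t by apply: arrow_path_elt.
have wDA : path_elt k (B_word DA) = d * a by rewrite (st Delta DA Al [:: Alpha]) ?wA.
have wAG : path_elt k (B_word AG) = a * g by rewrite (st Alpha AG Ga [:: Gamma]) ?wG.
have wTG : path_elt k (B_word TG) = t * g by rewrite (st Tau TG Ga [:: Gamma]) ?wG.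
have wDAG : path_elt k (B_word DAG) = d * (a * g).
  by rewrite (st Delta DAG AG [:: Alpha; Gamma]) ?wAG.
case: i => //.
- exact: arrow_path_elt.
- by rewrite (st Alpha AD De [:: Delta]) ?wD.
- by rewrite (st Beta BG Ga [:: Gamma]) ?wG.
- by rewrite (st Alpha AT Ta [:: Tau]) ?wT.
- by rewrite (st Alpha ADA DA [:: Delta; Alpha]) ?wDA.
- by rewrite (st Alpha ATG TG [:: Tau; Gamma]) ?wTG.
- by rewrite (st Alpha ADAG DAG [:: Delta; Alpha; Gamma]) ?wDAG.
Qed.

Local Notation sec := (section (A := B) (fun (u : B) i => u i) B_word).

Lemma B_sec_linear : linear sec.
Proof. exact: section_linear. Qed.

Lemma B_sec_basis i : sec (bas i) = B_prod i.
Proof.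
rewrite /section (bigD1 i) //= /coord_basis eqxx scale1r B_wordE big1 ?addr0 //.
by move=> j /negbTE; rewrite eq_sym => ->; rewrite scale0r.
Qed.

Lemma B_sec_nf x : sec (B_nf_val x) =
  if x is Some (c, i) then c *: B_prod i else 0.
Proof.
case: x => [[c i]|] /=; last exact: linear0f B_sec_linear.
by rewrite (linearZf B_sec_linear) B_sec_basis.
Qed.

Lemma B_arrow_section x i :
  arrow_elt k x * path_elt k (B_word i) == sec (B_arrow_val x * bas i).
Proof.
rewrite B_nfE B_sec_nf.
(* When the arrow and the word do not compose, their product is already 0 in $kQ$. *)
have [e|n] := boolP (source x == path_end (B_word i)); last first.
  rewrite arrow_path_neq //.
  have -> : B_nf x i = None by case: x i n => [] [].
  exact: cong_refl.
have one y : y == 1 *: y by rewrite scale1r; apply: cong_refl.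
have tr (y : arrow B_quiver) (v : vertex B_quiver) : source y = v ->
    arrow_elt k y * vertex_elt k v == 1 *: arrow_elt k y.
  by move=> xv; rewrite arrow_vertex ?xv.
(* One goal for each composable pair, in the order of the constructors: the product is a word of the
   basis, or is rewritten by a relation, or contains a vanishing subword. *)
rewrite B_wordE; case: x i e => [] [] e;
  try exact: (False_ind _ (notF e)); clear e; cbv iota beta delta [B_prod B_nf].
- exact: tr.
- exact: ga_rel.
- exact: gb_rel.
- exact: ga_mul.
- exact: ga_mul0 dad0.
- exact: gb_mul.
- exact: ga_mul0 dat0.
- exact: ga_mul0 (cong3 _ dad0).
- exact: ga_mul0 (cong3 _ dat0).
- exact: ga_mul0 (cong3 _ dad0).
- exact: tr.
- exact: one.
- exact: db0.
- exact: one.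
- exact: dad0.
- exact: cong2 db0.
- exact: dat0.
- exact: cong3 dad0.
- exact: cong3 dat0.
- exact: cong3 dad0.
- exact: tr.
- exact: one.
- exact: one.
- exact: one.
- exact: one.
- exact: one.
- exact: one.
- exact: tr.
- exact: one.
- exact: bd0.
- exact: bt0.
- exact: cong2 bd0.
- exact: cong2 bt0.
- exact: cong2 bd0.
- exact: tr.
- exact: one.
- exact: td0.
- exact: tt0.
- exact: cong2 td0.
- exact: cong2 tt0.
- exact: cong2 td0.
Qed.

End PresentationB.

Section PresentsB.
Variables (k : fieldType) (q : k).
Hypothesis q_neq0 : q != 0.
Local Notation B := (Balg q).
Local Notation bas := (@coord_basis k B_basis : B_basis -> B).
Local Notation E := (B_vertex_val q).
Local Notation X := (B_arrow_val q).

Lemma B_mul_e1 (u : B) : u * bas E1 = (fun i => match i with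
  | E1 | Ga | De | AG | AD | BG | TG | DAG | ATG | ADAG => u i
  | _ => 0
  end) :> B.
Proof. by apply: coordsP; case; rewrite B_mulE /B_mul /coord_basis /=; ring. Qed.

Lemma B_mul_e2 (u : B) : u * bas E2 = (fun i => match i with
  | E2 | Al | Be | Ta | DA | AT | ADA => u i
  | _ => 0
  end) :> B.
Proof. by apply: coordsP; case; rewrite B_mulE /B_mul /coord_basis /=; ring. Qed.

Lemma B_e1_mul (u : B) : bas E1 * u = (fun i => match i with
  | E1 | Al | Be | AG | AD | BG | AT | ADA | ATG | ADAG => u i
  | _ => 0
  end) :> B.
Proof. by apply: coordsP; case; rewrite B_mulE /B_mul /coord_basis /=; ring. Qed.

Lemma B_e2_mul (u : B) : bas E2 * u = (fun i => match i with
  | E2 | Ga | De | Ta | DA | TG | DAG => u i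
  | _ => 0
  end) :> B.
Proof. by apply: coordsP; case; rewrite B_mulE /B_mul /coord_basis /=; ring. Qed.

Lemma B_vertex_sum : \sum_v E v = 1.
Proof.
rewrite (bigD1 (V1 : vertex B_quiver)) //= (bigD1 (V2 : vertex B_quiver)) //=.
rewrite big_pred0 ?addr0; last by case.
by apply: coordsP; case; rewrite coordD /coord_basis /= ?addr0 ?add0r.
Qed.

Lemma B_vertexM v w : E v * E w = if v == w then E v else 0.
Proof.
case: v; case: w; rewrite /= ?B_e1_mul ?B_e2_mul; by apply: coordsP; case.
Qed.

Lemma B_EX a : E (target a) * X a = X a.
Proof. by case: a; rewrite /= ?B_e1_mul ?B_e2_mul; apply: coordsP; case. Qed.

Lemma B_XE a : X a * E (source a) = X a.
Proof.
by case: a; rewrite B_lmulE; apply: coordsP; case=> //=;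
  rewrite /coord_basis /= !mulr0 addr0.
Qed.

Local Notation pe := (path_eval E X).
Local Notation pval := (path_val E X).

Lemma B_word_val i : pval (B_word i) = bas i.
Proof.
case: i; rewrite /path_val /path_end /= ?big_cons big_nil mulr1.
all: rewrite ?B_lmulE ?B_e1_mul ?B_e2_mul; apply: coordsP; case=> //=.
all: by rewrite /coord_basis /= !mulr0 addr0.
Qed.

Lemma B_path_deg i : path_deg (fun=> 1) (B_word i) = B_deg i.
Proof. by case: i; rewrite /path_deg /= ?big_cons big_nil. Qed.

Lemma B_rel_eval r : r \in B_relations q -> pe r = 0.
Proof.
have el := path_eval_linear E X.
have em := path_evalM B_vertexM B_EX B_XE.
have ea := path_eval_arrow B_EX.
rewrite !inE => /or4P[/eqP->|/eqP->|/eqP->|/or4P[] /eqP->];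
  rewrite ?(linearBf el) ?(linearZf el) !em !ea B_lmulE ?B_lmulE;
  apply: coordsP; case; rewrite ?coordE //= /coord_basis /=.
all: by rewrite ?(mulr0, mulr1, add0r, addr0, subrr, oppr0).
Qed.

Lemma B_homog_vertex v : homog 0 (E v).
Proof.
by case: v; [exact: (@coord_basis_homog k _ B_deg E1)
            |exact: (@coord_basis_homog k _ B_deg E2)].
Qed.
Lemma B_homog_arrow a : homog 1 (X a).
Proof.
have h := @coord_basis_homog k _ B_deg.
by case: a; [exact: (h Ga)|exact: (h De)|exact: (h Al)|exact: (h Be)|exact: (h Ta)].
Qed.

Lemma B_vertex_section v : cong (fun r => r \in B_relations q)
  (vertex_elt k v) (section (A := B) (fun (u : B) i => u i) B_word (E v)).
Proof. by case: v; rewrite /= B_sec_basis; apply: cong_refl. Qed.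

Theorem B_presents : presents (fun=> 1) (B_relations q) pe.
Proof.
apply: (@presentsP _ _ B E X B_vertex_sum B_vertexM B_EX B_XE (fun=> 1)
  (B_relations q) B_basis bas (fun u i => u i) B_word).
- by [].
- exact: coord_span.
- exact: B_word_val.
- by move=> n u i hu; rewrite B_path_deg; apply: hu.
- exact: B_homog_vertex.
- exact: B_homog_arrow.
- exact: B_rel_eval.
- exact: B_vertex_section.
- exact: B_arrow_section.
Qed.

End PresentsB.

(** * The presentations of Lambda and C *)

Section RosePresentation.
Variables (k : fieldType) (I : finType) (A : dgAlgType k) (X : I -> A).
Local Notation Q := (rose I).

Definition rose_path (s : seq I) : qpath Q.
Proof. by exists (tt, s); elim: s. Defined.

Lemma rose_elt_nil : path_elt k (rose_path [::]) = 1.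
Proof.
rewrite [RHS]/(path_one k Q) /path_one (bigD1 tt) //= big_pred0 ?addr0; last by case.
by congr (path_elt k _); apply: val_inj.
Qed.

Lemma rose_elt_cons (a : I) s : path_elt k (rose_path (a :: s)) =
  arrow_elt k (a : arrow Q) * path_elt k (rose_path s).
Proof. exact: path_elt_cons. Qed.

Definition rose_vertex (v : vertex Q) : A := 1.
Definition rose_arrow (a : arrow Q) : A := X a.

Lemma rose_vertex_sum : \sum_v rose_vertex v = 1.
Proof. by rewrite (bigD1 tt) //= big_pred0 ?addr0; last by case. Qed.

Lemma rose_vertexM v w :
  rose_vertex v * rose_vertex w = if v == w then rose_vertex v else 0.
Proof. by case: v; case: w; rewrite eqxx mulr1. Qed.

Lemma rose_EX a : rose_vertex (target a) * rose_arrow a = rose_arrow a.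
Proof. exact: mul1r. Qed.
Lemma rose_XE a : rose_arrow a * rose_vertex (source a) = rose_arrow a.
Proof. exact: mulr1. Qed.

Definition rose_eval := path_eval rose_vertex rose_arrow.

Lemma rose_eval_linear : linear rose_eval.
Proof. exact: path_eval_linear. Qed.
Lemma rose_evalM : {morph rose_eval : a b / a * b}.
Proof. exact: path_evalM rose_vertexM rose_EX rose_XE. Qed.
Lemma rose_eval_arrow a : rose_eval (arrow_elt k (a : arrow Q)) = X a.
Proof. exact: path_eval_arrow rose_EX a. Qed.

Lemma rose_path_val s : path_val rose_vertex rose_arrow (rose_path s) =
  \prod_(a <- s) X a.
Proof. exact: mul1r. Qed.

End RosePresentation.

Section PresentsL.
Variables (k : fieldType) (q : k).
Local Notation L := (Lalg q).
Local Notation bas := (@coord_basis k L_basis : L_basis -> L).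
Local Notation kQ := (path_algebra k (rose bool)).

Definition L_arrow (b : bool) : L := if b then bas Ly else bas Lx.
Definition L_word (i : L_basis) : seq bool :=
  match i with
  | L1 => [::] | Lx => [:: false] | Ly => [:: true] | Lw => [:: true; false]
  end.

Local Notation x := (arrow_elt k (false : arrow (rose bool)) : kQ).
Local Notation y := (arrow_elt k (true : arrow (rose bool)) : kQ).
Local Notation "a == b" := (cong (fun r => r \in Lambda_relations q) a b).

Lemma L_rel (n : nat) : (n < 3)%N -> nth 0 (Lambda_relations q) n == 0.
Proof. by move=> hn; rewrite /cong subr0; apply: IdealGen; apply: mem_nth. Qed.
Lemma xx0 : x * x == 0. Proof. exact: (@L_rel 0). Qed.
Lemma yy0 : y * y == 0. Proof. exact: (@L_rel 1). Qed.
Lemma xy_rel : x * y == q *: (y * x).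
Proof. by have := @L_rel 2 isT; rewrite /cong subr0. Qed.
Lemma xyx0 : x * (y * x) == 0.
Proof.
rewrite mulrA; apply: cong_trans (congMr x xy_rel) _.
rewrite -path_scaleAl -mulrA -[X in _ == X](scaler0 _ q).
by apply: congZ; rewrite -[X in _ == X](mulr0 y); apply: congMl xx0.
Qed.
Lemma yyx0 : y * (y * x) == 0.
Proof. by rewrite mulrA -[X in _ == X](mul0r x); apply: congMr yy0. Qed.

Lemma L_word_val i :
  path_val (@rose_vertex k bool L) (rose_arrow L_arrow) (rose_path (L_word i)) = bas i.
Proof.
rewrite rose_path_val; case: i; rewrite /= ?big_cons big_nil ?mulr1 //.
  by apply: coordsP; case.
apply: coordsP; case; rewrite L_mulE /L_mul /coord_basis /=;
  by rewrite ?(mul0r, mul1r, mulr0, add0r, addr0).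
Qed.

Lemma L_path_deg i : path_deg (fun=> 2) (rose_path (L_word i)) = L_deg i.
Proof. by case: i; rewrite /path_deg /= ?big_cons big_nil. Qed.

Local Notation sec := (section (A := L) (fun (u : L) i => u i)
  (fun i => rose_path (L_word i))).

Lemma L_sec_linear : linear sec.
Proof. exact: section_linear. Qed.

Lemma L_sec_basis i : sec (bas i) = path_elt k (rose_path (L_word i)).
Proof.
rewrite /section (bigD1 i) //= /coord_basis eqxx scale1r big1 ?addr0 //.
by move=> j /negbTE; rewrite eq_sym => ->; rewrite scale0r.
Qed.

Definition L_nf (b : bool) (i : L_basis) : option (k * L_basis) :=
  match b, i with
  | false, L1 => Some (1, Lx) | false, Ly => Some (q, Lw)
  | true, L1 => Some (1, Ly) | true, Lx => Some (1, Lw)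
  | _, _ => None
  end.

Lemma L_nfE b i : L_arrow b * bas i =
  if L_nf b i is Some (c, j) then c *: bas j else 0.
Proof.
apply: coordsP; case: b; case: i; case; rewrite L_mulE /L_mul /coord_basis /= ?coordE;
  by rewrite ?(mul0r, mul1r, mulr0, mulr1, add0r, addr0).
Qed.

Lemma L_arrow_section b i :
  arrow_elt k (b : arrow (rose bool)) * path_elt k (rose_path (L_word i))
  == sec (L_arrow b * bas i).
Proof.
have nf o : sec (if o is Some (c, j) then c *: bas j else 0) =
    if o is Some (c, j) then c *: path_elt k (rose_path (L_word j)) else 0.
  case: o => [[c j]|]; last exact: linear0f L_sec_linear.
  by rewrite (linearZf L_sec_linear) L_sec_basis.
rewrite L_nfE nf; case: b; case: i; cbv iota beta delta [L_nf L_word];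
  rewrite !rose_elt_cons ?rose_elt_nil ?mulr1 ?scale1r.
- exact: cong_refl.
- exact: cong_refl.
- exact: yy0.
- exact: yyx0.
- exact: cong_refl.
- exact: xx0.
- exact: xy_rel.
- exact: xyx0.
Qed.

Definition L_pres := rose_eval L_arrow : kQ -> L.

Lemma L_pres_x : L_pres x = bas Lx. Proof. exact: rose_eval_arrow. Qed.
Lemma L_pres_y : L_pres y = bas Ly. Proof. exact: rose_eval_arrow. Qed.

Theorem L_presents : presents (fun=> 2) (Lambda_relations q) L_pres.
Proof.
have h := @presentsP k (rose bool) L (@rose_vertex k bool L) (rose_arrow L_arrow)
  (@rose_vertex_sum k bool L) (@rose_vertexM k bool L) (rose_EX L_arrow) (rose_XE L_arrow).
have {}h := h (fun=> 2) (Lambda_relations q) L_basis bas (fun u i => u i)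
  (fun i => rose_path (L_word i)).
apply: h.
- by [].
- exact: coord_span.
- exact: L_word_val.
- by move=> n u i hu; rewrite L_path_deg; apply: hu.
- by move=> v; apply: homog1.
- move=> b; have h := @coord_basis_homog k _ L_deg.
  by case: b; [exact: (h Ly)|exact: (h Lx)].
- have el := rose_eval_linear L_arrow.
  move=> r; rewrite !inE -/(rose_eval L_arrow r).
  case/or3P=> /eqP->; rewrite ?(linearBf el) ?(linearZf el) !rose_evalM
    !rose_eval_arrow !L_nfE /= ?scale1r ?subrr //.
- move=> v; rewrite -[rose_vertex _ _]/(1 : L).
  have -> : 1 = bas L1 by apply: coordsP; case.
  rewrite L_sec_basis /= rose_elt_nil -rose_elt_nil /vertex_elt.
  have -> : trivial_path v = rose_path [::] by apply: val_inj; case: v.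
  exact: cong_refl.
- exact: L_arrow_section.
Qed.

End PresentsL.

Section PresentsC.
Variables (k : fieldType).
Local Notation C := (Calg k).
Local Notation bas := (@coord_basis k C_basis : C_basis -> C).
Local Notation kQ := (path_algebra k (rose unit)).

Definition C_arrow (b : unit) : C := bas Ct.
Definition C_word (i : C_basis) : seq unit := if i is Ct then [:: tt] else [::].

Local Notation t := (arrow_elt k (tt : arrow (rose unit)) : kQ).
Local Notation "a == b" := (cong (fun r => r \in dual_relations k) a b).

Lemma C_rel : t * t == 0.
Proof. by rewrite /cong subr0; apply: IdealGen; rewrite inE. Qed.

Lemma C_word_val i :
  path_val (@rose_vertex k unit C) (rose_arrow C_arrow) (rose_path (C_word i)) = bas i.
Proof.
rewrite rose_path_val; case: i; rewrite /= ?big_cons big_nil ?mulr1 //.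
by apply: coordsP; case.
Qed.

Lemma C_path_deg i : path_deg (fun=> 1) (rose_path (C_word i)) = C_deg i.
Proof. by case: i; rewrite /path_deg /= ?big_cons big_nil. Qed.

Local Notation sec := (section (A := C) (fun (u : C) i => u i)
  (fun i => rose_path (C_word i))).

Lemma C_sec_basis i : sec (bas i) = path_elt k (rose_path (C_word i)).
Proof.
rewrite /section (bigD1 i) //= /coord_basis eqxx scale1r big1 ?addr0 //.
by move=> j /negbTE; rewrite eq_sym => ->; rewrite scale0r.
Qed.

Lemma C_tt : bas Ct * bas Ct = 0.
Proof.
apply: coordsP; case; rewrite C_mulE /C_mul /coord_basis /= ?coordE;
  by rewrite ?(mul0r, mul1r, mulr0, mulr1, add0r, addr0).
Qed.

Lemma C_arrow_section b i :
  arrow_elt k (b : arrow (rose unit)) * path_elt k (rose_path (C_word i))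
  == sec (C_arrow b * bas i).
Proof.
case: b; case: i.
  have -> : C_arrow tt * bas C1 = bas Ct.
    have -> : bas C1 = 1 by apply: coordsP; case.
    by rewrite mulr1.
  rewrite C_sec_basis /C_word rose_elt_cons rose_elt_nil mulr1.
  exact: cong_refl.
have sl : linear sec by apply: section_linear.
rewrite [C_arrow _ * _]C_tt (linear0f sl) /C_word rose_elt_cons rose_elt_nil mulr1.
exact: C_rel.
Qed.

Definition C_pres := rose_eval C_arrow : kQ -> C.

Lemma C_pres_t : C_pres t = bas Ct. Proof. exact: rose_eval_arrow. Qed.

Theorem C_presents : presents (fun=> 1) (dual_relations k) C_pres.
Proof.
have h := @presentsP k (rose unit) C (@rose_vertex k unit C) (rose_arrow C_arrow)
  (@rose_vertex_sum k unit C) (@rose_vertexM k unit C) (rose_EX C_arrow) (rose_XE C_arrow).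
have {}h := h (fun=> 1) (dual_relations k) C_basis bas (fun u i => u i)
  (fun i => rose_path (C_word i)).
apply: h.
- by [].
- exact: coord_span.
- exact: C_word_val.
- by move=> n u i hu; rewrite C_path_deg; apply: hu.
- by move=> v; apply: homog1.
- move=> b; exact: (@coord_basis_homog k _ C_deg Ct).
- move=> r; rewrite !inE -/(rose_eval C_arrow r) => /eqP->.
  by rewrite rose_evalM !rose_eval_arrow C_tt.
- move=> v; rewrite -[rose_vertex _ _]/(1 : C).
  have -> : 1 = bas C1 by apply: coordsP; case.
  rewrite C_sec_basis /vertex_elt.
  have -> : trivial_path v = rose_path [::] by apply: val_inj; case: v.
  exact: cong_refl.
- exact: C_arrow_section.
Qed.

End PresentsC.

(** * The resolution of C *)

Section Scalars.
Variables (k : fieldType) (q : k) (q_neq0 : q != 0)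
  (q_not_root : forall n : nat, (0 < n)%N -> q ^+ n != 1).

(* The c for which alpha gamma + c (alpha delta + beta gamma) has square 0. *)
Definition cq : k := (1 - q) / (1 + q).
(** The image of $(-q)^nx+y$ in $e_1Be_1$ is [za n] times $\alpha\gamma$ plus [zb n] times
    $\alpha\delta+\beta\gamma$; see [jB_zL]. *)
Definition za (n : nat) : k := q * (- q) ^+ n.
Definition zb (n : nat) : k := cq * (1 + za n).

Lemma q_neq1 : q != 1. Proof. exact: (q_not_root (n := 1)). Qed.
Lemma q1_neq0 : 1 + q != 0.
Proof.
apply: contra (@q_not_root 2 isT) => /eqP h.
have -> : q = -1 by apply/eqP; rewrite -addr_eq0 addrC h.
by rewrite sqrrN expr1n.
Qed.
Lemma cq_neq0 : cq != 0.
Proof. by rewrite mulf_neq0 ?invr_eq0 ?q1_neq0 // subr_eq0 eq_sym q_neq1. Qed.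
Lemma cqE : cq * (1 + q) = 1 - q.
Proof. by rewrite mulfVK ?q1_neq0. Qed.
Lemma za_neq0 n : za n != 0.
Proof. by rewrite mulf_neq0 // expf_neq0 // oppr_eq0. Qed.
Lemma zaS n : za n.+1 = - q * za n. Proof. by rewrite /za exprS mulrCA. Qed.
Lemma za0 : za 0 = q. Proof. by rewrite /za expr0 mulr1. Qed.

(** Squaring removes the sign: a power of $-q$ equal to 1 would give an even power of $q$ equal to
    1. *)
Lemma pow_neq1 n : (- q) ^+ n.+1 != 1.
Proof.
apply: contra (@q_not_root (2 * n.+1) isT) => /eqP h.
by rewrite exprM -sqrrN -exprM mulnC exprM h expr1n.
Qed.

(** The left side is the coefficient of $\delta\alpha\gamma$ in $\gamma z$, and of
    $\alpha\delta\alpha\gamma$ in $\alpha\gamma z$, for [z = zB n]. The right side is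
    $cq(1-(-q)^n)$: it vanishes for $n=0$, which gives $\gamma z=0$, and is invertible for $n>0$. *)
Lemma zA n : za n * (q - 1) + zb n * q = cq * (q - za n).
Proof.
by rewrite /zb /cq; field; rewrite q1_neq0.
Qed.

Lemma zA0 : za 0 * (q - 1) + zb 0 * q = 0.
Proof. by rewrite zA za0 subrr mulr0. Qed.

Lemma zA_neq0 n : za n.+1 * (q - 1) + zb n.+1 * q != 0.
Proof.
rewrite zA mulf_neq0 ?cq_neq0 // /za -{1}[q]mulr1 -mulrBr mulf_neq0 //.
by rewrite subr_eq0 eq_sym pow_neq1.
Qed.

(** The analogous coefficient for multiplication by [zB n] from the left, on $\alpha$ and
    $\alpha\gamma$. Its value is $c(1-(-q)^{n+2})$, which never vanishes. *)
Lemma zA' n : za n * (q - 1) + zb n = cq * (1 + za n.+1).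
Proof.
by rewrite zaS /zb /cq; field; rewrite q1_neq0.
Qed.

Lemma zA'_neq0 n : za n * (q - 1) + zb n != 0.
Proof.
rewrite zA' mulf_neq0 ?cq_neq0 // /za -[X in 1 + X]opprK -mulNr -exprS.
by rewrite subr_eq0 eq_sym pow_neq1.
Qed.

(** The coefficient of $\alpha\delta\alpha\gamma$ in [zB n * zB n.+1], the only one that could be
    nonzero. *)
Lemma zAb n : zb n * za n.+1 + za n * (za n.+1 * (q - 1) + zb n.+1 * q) = 0.
Proof.
by rewrite zA zaS /zb /cq; field; rewrite q1_neq0.
Qed.

End Scalars.

Section TelescopeB.
Variables (k : fieldType) (q : k) (q_neq0 : q != 0)
  (q_not_root : forall n : nat, (0 < n)%N -> q ^+ n != 1).
Local Notation B := (Balg q).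
Local Notation bas := (@coord_basis k B_basis : B_basis -> B).

Definition zB (n : nat) : B := fun i => match i with
  | AG => za q n
  | AD | BG => zb q n
  | _ => 0
  end.

Lemma B_mulzE (u : B) n : u * zB n = (fun i => match i with
  | AG => u E1 * za q n
  | AD | BG => u E1 * zb q n
  | DAG => u Ga * (za q n * (q - 1) + zb q n * q) + u De * za q n
  | ADAG => u AG * (za q n * (q - 1) + zb q n * q) + u AD * za q n
  | _ => 0
  end) :> B.
Proof. by apply: coordsP; case; rewrite B_mulE /B_mul /zB; ring. Qed.

Lemma B_zmulE (u : B) n : zB n * u = (fun i => match i with
  | AG => za q n * u E1
  | AD | BG => zb q n * u E1
  | ADA => (za q n * (q - 1) + zb q n) * u Al + za q n * q * u Be
  | ADAG => (za q n * (q - 1) + zb q n) * u AG + za q n * q * u BG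
  | _ => 0
  end) :> B.
Proof. by apply: coordsP; case; rewrite B_mulE /B_mul /zB; ring. Qed.

Lemma B_mul_gamma (u : B) : u * bas Ga = (fun i => match i with
  | Ga => u E2 | AG => u Al | BG => u Be | TG => u Ta | DAG => u DA
  | ATG => u AT | ADAG => u ADA | _ => 0
  end) :> B.
Proof. by apply: coordsP; case; rewrite B_mulE /B_mul /coord_basis /=; ring. Qed.

Lemma B_gamma_mul (u : B) : bas Ga * u = (fun i => match i with
  | Ga => u E1
  | DA => (q - 1) * u Al + q * u Be
  | DAG => (q - 1) * u AG + q * u BG
  | _ => 0
  end) :> B.
Proof. by apply: coordsP; case; rewrite B_mulE /B_mul /coord_basis /=; ring. Qed.

Lemma zB_homog n : homog 2 (zB n).
Proof. by move=> l hl; case: l hl. Qed.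
Lemma zB_diff n : diff (zB n) = 0.
Proof. by apply: coordsP; case=> //; apply: subrr. Qed.
Lemma zBzB n : zB n * zB n.+1 = 0.
Proof.
apply: coordsP; case; rewrite B_mulzE /zB ?coordE ?mul0r ?addr0 //.
by rewrite addrC zAb.
Qed.
Lemma ga_zB : bas Ga * zB 0 = 0.
Proof.
apply: coordsP; case; rewrite B_gamma_mul /zB ?coordE ?mulr0 ?addr0 //.
by rewrite mulrC [q * _]mulrC zA0.
Qed.

Let e n : B := if n is 0 then bas E2 else bas E1.
Let z n : B := if n is n'.+1 then zB n' else bas Ga.
(** Forced by $|z_n|=D(n+1)+1-D(n)$: since $|\gamma|=1$, the generators $r_0$ and $r_1$ both have
    degree 0, and every later $z$, of degree 2, raises the degree by one. *)
Let D n : int := if n is n'.+1 then n'%:Z else 0.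
Let ee n : e n * e n = e n.
Proof. by case: n => [|n]; rewrite /= ?B_mul_e1 ?B_mul_e2; apply: coordsP; case. Qed.
Let eh n : homog 0 (e n).
Proof.
by case: n => [|n]; [exact: (@coord_basis_homog k _ B_deg E2)
                    |exact: (@coord_basis_homog k _ B_deg E1)].
Qed.
Let de n : diff (e n) = 0.
Proof. by case: n => [|n]; apply: coordsP; case=> //; apply: subrr. Qed.
Let zh n : homog (D n.+1 + 1 - D n) (z n).
Proof.
case: n => [|n] /=; first exact: (@coord_basis_homog k _ B_deg Ga).
have -> : n.+1%:Z + 1 - n%:Z = 2 by lia.
exact: zB_homog.
Qed.
Let dz n : diff (z n) = 0.
Proof.
by case: n => [|n]; rewrite /= ?zB_diff //; apply: coordsP; case=> //; apply: subrr.
Qed.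
Let ez n : e n * z n = z n.
Proof. by case: n => [|n]; rewrite /= ?B_e1_mul ?B_e2_mul; apply: coordsP; case. Qed.
Let ze n : z n * e n.+1 = z n.
Proof. by case: n => [|n]; rewrite /= B_mul_e1; apply: coordsP; case. Qed.
Let zz n : z n * z n.+1 = 0.
Proof. by case: n => [|n]; [apply: ga_zB|apply: zBzB]. Qed.

(* Resolves C = B / B e_1 B. *)
Definition tel_B : telescope B := Telescope ee eh de zh dz ez ze zz.

(* The coefficients which have to be inverted are multiples of 1 - (-q)^n with
   n > 0: this is where q must not be a root of unity. *)
Lemma tel_B_sequence i (a : nat -> regular B) :
  tel_cocycle tel_B i a -> exists b, tel_bounds tel_B i a b.
Proof.
pose s := sgz k i; have ss : s * s = 1 by apply: sgzz.
move=> [ha ea da]; pose A n : B := a n.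
have hz n l : B_deg l != D n + i -> A n l = 0 := ha n l.
have e0 l : (A 0%N * bas E2 : B) l = A 0%N l by rewrite [in RHS]/A -[in RHS]ea.
have e1 n l : (A n.+1 * bas E1 : B) l = A n.+1 l by rewrite [in RHS]/A -[in RHS]ea.
have d0 l : @B_diff k q (A 0%N) l = 0.
  by have /(congr1 (fun u : B => u l)) := da 0%N; rewrite scaler0.
have d1 l : @B_diff k q (A 1%N) l = s * (A 0%N * bas Ga : B) l.
  by have /(congr1 (fun u : B => u l)) := da 1%N.
have d2 n l : @B_diff k q (A n.+2) l = s * (A n.+1 * zB n : B) l.
  by have /(congr1 (fun u : B => u l)) := da n.+2.
have s0 x : 0 = s * x -> x = 0.
  by move=> e0'; rewrite -[x]mul1r -ss -mulrA -e0' mulr0.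
(* The cocycle equations are read at words which $d$ does not reach, here $\alpha\gamma$, so that
   the product with $z$ must vanish there. *)
have E0 n : A n.+1 E1 = 0.
  have := d2 n AG; rewrite B_mulzE /B_diff => /s0/eqP.
  by rewrite mulf_eq0 (negbTE (za_neq0 q_neq0 n)) orbF => /eqP.
have AGE n : A n.+1 AG * (za q n * (q - 1) + zb q n * q) + A n.+1 AD * za q n = 0.
  by have := d2 n ADAG; rewrite B_mulzE => /s0.
have DAGE n : A n.+1 Ga * (za q n * (q - 1) + zb q n * q) + A n.+1 De * za q n = 0.
  by have := d2 n DAG; rewrite B_mulzE => /s0.
(* For $n=0$ the coefficient of the first term of [AGE] is zero by [zA0], so the second term
   vanishes by itself. *)
have AD1 : A 1%N AD = 0.
  have /eqP := AGE 0%N; rewrite zA0 // mulr0 add0r mulf_eq0.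
  by rewrite (negbTE (za_neq0 q_neq0 0)) orbF => /eqP.
have De1 : A 1%N De = 0.
  have /eqP := DAGE 0%N; rewrite zA0 // mulr0 add0r mulf_eq0.
  by rewrite (negbTE (za_neq0 q_neq0 0)) orbF => /eqP.
have De2 n : A n.+2 De = 0.
  by have := d2 n TG; rewrite B_mulzE mulr0.
(* From here on the coefficient is $cq(1-(-q)^{n+1})$, hence invertible. *)
have Ga2 n : A n.+2 Ga = 0.
  have /eqP := DAGE n.+1; rewrite De2 mul0r addr0 mulf_eq0.
  by rewrite (negbTE (zA_neq0 q_neq0 q_not_root n)) orbF => /eqP.
have BG2 n : A n.+2 BG = A n.+2 AD.
  have := d2 n ATG; rewrite B_mulzE mulr0 => /eqP.
  by rewrite /B_diff subr_eq0 => /eqP.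
have AD2 n : A n.+2 AD * za q n = zb q n * A n.+2 AG.
  have /eqP := AGE n.+1; have /eqP := zAb q_not_root n.
  rewrite !addr_eq0 => /eqP e2 /eqP e3.
  apply: (mulIf (za_neq0 q_neq0 n.+1)).
  have e4 : A n.+2 AD * za q n.+1 =
      - (A n.+2 AG * (za q n.+1 * (q - 1) + zb q n.+1 * q)).
    by rewrite e3 opprK.
  by rewrite mulrAC e4 [RHS]mulrAC e2; ring.
have AD2E n : A n.+2 AD = zb q n * A n.+2 AG / za q n.
  by rewrite -AD2 mulfK ?za_neq0.
have [Ta0 AT0] : A 0%N Ta = 0 /\ A 1%N BG = s * A 0%N AT.
  split; first by have := d1 TG; rewrite B_mul_gamma /B_diff De1 => /s0.
  by have := d1 ATG; rewrite B_mul_gamma /B_diff AD1 subr0.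
have [E20 Al0 Be0] : [/\ A 0%N E2 = 0, A 0%N Al = 0 & A 0%N Be = 0].
  by split; [have := d1 Ga|have := d1 AG|have := d1 BG]; rewrite B_mul_gamma => /s0.
have [DA0 ADA0] : A 0%N DA = 0 /\ A 0%N ADA = 0.
  by split; [have := d1 DAG|have := d1 ADAG]; rewrite B_mul_gamma => /s0.
(* Solved coordinatewise from $a_{n+1}=db_{n+1}+s\,b_nz_n$. For $n>0$, [AG] and [ADAG] of $a_{n+1}$
   determine [E1] and [AD] of $b_n$, whereas [TG] and [ATG] of $a_n$ are reached by $d$ from [De]
   and [BG] of $b_n$, and [DAG] of $a_{n+1}$ is adjusted by [Ga]. In [b 1] the coefficient of [Ga]
   is zero, so [De] must supply [DAG], and the resulting error in [TG] is absorbed by [Ta] of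
   [b 0]. *)
pose b n : B :=
  match n with
  | 0 => (fun i => match i with
    | Be => A 0%N AT
    | Al => s * A 1%N AG
    | ADA => s * A 1%N ADAG
    | E2 => s * A 1%N Ga
    | DA => s * A 1%N DAG
    | Ta => s * (A 1%N TG - s * A 2%N DAG / za q 0)
    | _ => 0 end)
  | 1 => (fun i => match i with
    | E1 => s * A 2%N AG / za q 0
    | AD => s * A 2%N ADAG / za q 0
    | BG => A 1%N ATG + s * A 2%N ADAG / za q 0
    | De => s * A 2%N DAG / za q 0
    | _ => 0 end)
  | n.+2 => (fun i => match i with
    | E1 => s * A n.+3 AG / za q n.+1
    | AD => s * A n.+3 ADAG / za q n.+1
    | BG => A n.+2 ATG + s * A n.+3 ADAG / za q n.+1
    | De => A n.+2 TG
    | Ga => (s * A n.+3 DAG - za q n.+1 * A n.+2 TG) /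
            (za q n.+1 * (q - 1) + zb q n.+1 * q)
    | _ => 0 end)
  end.
have bh n l : B_deg l != D n + (i - 1) -> b n l = 0.
{ case: n => [|[|n]] hl; rewrite /b; case: l hl => // hl;
    rewrite ?(hz 0%N AT) ?(hz 1%N) ?(hz 2%N) ?(hz n.+2) ?(hz n.+3)
      ?(mulr0, mul0r, subr0, addr0) //.
  all: by move: hl; rewrite /B_deg /B_degn /D; lia. }
exists b; split; first exact: bh.
- case=> [|[|n]]; rewrite -[ract _ _]/((_ : B) * (_ : B)) /= ?B_mul_e1 ?B_mul_e2;
    by apply: coordsP; case.
have z0 l := e0 l; rewrite B_mul_e2 in z0.
have z1 n l :=
  etrans (congr1 (fun u : B => u l) (esym (B_mul_e1 (A n.+1)))) (e1 n l).
have bE1 n : b n.+1 E1 = s * A n.+2 AG / za q n by case: n.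
have bAD n : b n.+1 AD = s * A n.+2 ADAG / za q n by case: n.
have bAG n : b n.+1 AG = 0 by case: n.
have bDAG n : b n.+1 Ga * (za q n * (q - 1) + zb q n * q) + b n.+1 De * za q n =
    s * A n.+2 DAG.
  case: n => [|n] /=; first by rewrite zA0 // mulr0 add0r divfK ?za_neq0.
  rewrite divfK ?zA_neq0 // [A _ _ * _]mulrC subrK //.
have ssK x : s * (s * x) = x by rewrite mulrA ss mul1r.
case=> [|[|n]]; apply: coordsP => l; rewrite -[a _ l]/(A _ l) coordD coordZ -/s.
- rewrite -[diff _]/(@B_diff k q _) mulr0 addr0 /B_diff /b.
  by case: l => //; rewrite ?subrr //; exact: (esym (z0 _)).
- rewrite -[diff _]/(@B_diff k q _) -[tel_mulz _ _ _]/((b 0%N : B) * bas Ga).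
  rewrite B_mul_gamma /B_diff; case: l; rewrite /b ?(mulr0, add0r, addr0).
  all: rewrite ?ssK ?subrr ?addr0 ?addrK // ?E0 ?De1 ?AD1 //.
  all: try exact: (esym (z1 0%N _)).
  by rewrite addrC subrK.
- rewrite -[diff _]/(@B_diff k q _) -[tel_mulz _ _ _]/((b n.+1 : B) * zB n) B_mulzE.
  rewrite bE1 bAD bAG bDAG mul0r add0r /B_diff; case: l.
  all: rewrite ?mulr0 ?add0r ?addr0 ?E0 ?De2 ?Ga2 //.
  all: try exact: (esym (z1 n.+1 _)).
  all: rewrite ?BG2 ?AD2E ?divfK ?za_neq0 ?ssK ?addrK //.
  all: by move: (zb q n) (za q n)^-1 => w v; rewrite -!mulrA ssK; ring.
Qed.

End TelescopeB.

(** * The quotient C and its resolution *)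

Section QuotientC.
Variables (k : fieldType) (q : k).
Local Notation B := (Balg q).
Local Notation C := (Calg k).
Local Notation bas := (@coord_basis k B_basis : B_basis -> B).

Definition BC (u : B) : C := fun i => if i is Ct then u Ta else u E2.

Lemma BC_linear : linear BC.
Proof. by move=> c u v; apply: coordsP; case. Qed.
Lemma BC1 : BC 1 = 1.
Proof. by apply: coordsP; case. Qed.
Lemma BCM : {morph BC : u v / u * v}.
Proof.
by move=> u v; apply: coordsP; case; rewrite C_mulE /C_mul /BC B_mulE /B_mul.
Qed.
Lemma BC_diff u : BC (diff u) = 0.
Proof. by apply: coordsP; case. Qed.
Lemma BC_chain : chain_map BC.
Proof.
split=> [|n u hu|u]; first exact: BC_linear; last exact: BC_diff.
have h : C_homog n (BC u) by case=> hl; apply: hu.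
exact: h.
Qed.

Definition B_to_C : dgAlgHom B C := DGAlgHom BC_chain BC1 BCM.

Lemma B_to_C_surj (c : C) : exists b : B, B_to_C b = c.
Proof.
exists (fun i => match i with E2 => c C1 | Ta => c Ct | _ => 0 end).
by apply: coordsP; case.
Qed.

Lemma B_to_C_kernel (u : B) : B_to_C u = 0 <-> ideal (fun r => r = bas E1) u.
Proof.
split=> [u0|]; last first.
  elim=> [r ->||r s _ h _ h'|r s _ h|r s _ h].
  - by apply: coordsP; case.
  - by apply: coordsP; case.
  - by rewrite [LHS](linearDf BC_linear) [BC r]h [BC s]h' addr0.
  - by rewrite [LHS]BCM [BC s]h mulr0.
  - by rewrite [LHS]BCM [BC r]h mul0r.
have uE2 : u E2 = 0 by have /(congr1 (fun c : C => c C1)) := u0.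
have uTa : u Ta = 0 by have /(congr1 (fun c : C => c Ct)) := u0.
have I1 : ideal (fun r => r = bas E1) (bas E1) by apply: IdealGen.
pose w : B := fun i => match i with
  Al | Be | AT | ADA => u i | _ => 0 end.
(* Every word other than $e_2$ and $\tau$ passes through the vertex 1: at its start, at its end, or,
   for $\delta\alpha$ only, in between. *)
have -> : u = u * bas E1 + (bas E1 * w + u DA *: (bas De * (bas E1 * bas Al))).
  apply: coordsP; case; rewrite !coordE B_mul_e1 B_e1_mul B_mulE /B_mul B_e1_mul
    /coord_basis /w /= ?uE2 ?uTa; ring.
apply: IdealD; first exact: IdealMl.
apply: IdealD; first exact: IdealMr.
rewrite -[bas De * _]mul1r scalerAl; apply/IdealMl/IdealMl.
exact: IdealMr.
Qed.

End QuotientC.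

Section ResolutionC.
Variables (k : fieldType) (q : k) (q_neq0 : q != 0)
  (q_not_root : forall n : nat, (0 < n)%N -> q ^+ n != 1).
Local Notation B := (Balg q).
Local Notation C := (restriction (B_to_C q)).
Local Notation bas := (@coord_basis k B_basis : B_basis -> B).
Local Notation P := (tel (tel_B q_neq0 q_not_root)).

Definition epsC (f : P) : C := BC (tel_fun f 0).

Lemma epsC_linear : mod_linear epsC.
Proof.
split=> [c u v|f b]; first by rewrite /epsC tel_lin BC_linear.
by rewrite /epsC tel_actE BCM.
Qed.

Lemma epsC_diff f : epsC (diff f) = 0.
Proof.
rewrite /epsC tel_dE /=; apply: coordsP.
by case; rewrite /BC B_gamma_mul coordE ?coordZ add0r mulr0.
Qed.

(** Injectivity on cohomology is the exactness of the telescope: a cocycle with coordinates $F_n$ in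
    the kernel is solved as $F_n=z_nG_{n+1}\pm dG_n$. Besides [za n], the coefficients to be
    inverted are $q-1$ and $c(1-(-q)^{n+2})$. *)
Lemma epsC_quasi_iso : quasi_iso epsC.
Proof.
have [el eA] := epsC_linear.
split.
- split=> // [i f hf|f]; last exact: epsC_diff.
  have := hf 0%N; rewrite subr0 => h0.
  by have [_ h _] := @BC_chain k q; apply: h h0.
- move=> v dv [w ew].
  pose F n : B := tel_fun v n; pose t n := sgz k n%:Z.
  have tt n : t n * t n = 1 by apply: sgzz.
  have ef n : (if n is 0 then bas E2 else bas E1) * F n = F n.
    by case: n => [|n]; [exact: (tel_ef v 0)|exact: (tel_ef v n.+1)].
  have ew0 : BC (F 0%N) = 0 := ew.
  have FE2 : F 0%N E2 = 0 by have /(congr1 (fun c : C => (c : Calg k) C1)) := ew0.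
  have FTa : F 0%N Ta = 0 by have /(congr1 (fun c : C => (c : Calg k) Ct)) := ew0.
  have d0 l : (bas Ga * F 1%N : B) l + @B_diff k q (F 0%N) l = 0.
    have /(congr1 (fun f : P => (tel_fun f 0%N : B) l)) := dv.
    by rewrite tel_dE coordD coordZ sgz0 mul1r.
  have d1 n l : (zB q n * F n.+2 : B) l + t n * @B_diff k q (F n.+1) l = 0.
    by have /(congr1 (fun f : P => (tel_fun f n.+1 : B) l)) := dv.
  have z0 l := etrans (congr1 (fun u : B => u l) (esym (B_e2_mul (F 0%N))))
    (congr1 (fun u : B => u l) (ef 0%N)).
  have z1 n l := etrans (congr1 (fun u : B => u l) (esym (B_e1_mul (F n.+1))))
    (congr1 (fun u : B => u l) (ef n.+1)).
  have t0 n x : t n * x = 0 -> x = 0.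
    by move=> e; rewrite -[x]mul1r -(tt n) -mulrA e mulr0.
  have FDe : F 0%N De = 0 by have := d0 TG; rewrite B_gamma_mul add0r.
  have FBe n : F n.+1 Be = 0.
    by have := d1 n AT; rewrite B_zmulE add0r => /t0.
  have FBG n : F n.+1 BG = F n.+1 AD.
    have := d1 n ATG; rewrite B_zmulE add0r => /t0/eqP.
    by rewrite /B_diff subr_eq0 => /eqP.
  have q1 : q - 1 != 0 by rewrite subr_eq0 q_neq1.
  have FE1 n : F n.+1 E1 = 0.
    case: n => [|n]; first by have := d0 Ga; rewrite B_gamma_mul addr0.
    have /eqP := d1 n AG; rewrite B_zmulE mulr0 addr0 mulf_eq0.
    by rewrite (negbTE (za_neq0 q_neq0 n)) => /eqP.
  have FAl n : F n.+1 Al = 0.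
    case: n => [|n].
      have /eqP := d0 DA; rewrite B_gamma_mul FBe mulr0 !addr0 mulf_eq0.
      by rewrite (negbTE q1) => /eqP.
    have /eqP := d1 n ADA; rewrite B_zmulE FBe !mulr0 !addr0 mulf_eq0.
    by rewrite (negbTE (zA'_neq0 q_not_root n)) => /eqP.
  have FAD n : F n.+1 AD = zb q n * F n.+1 AG / za q n.
    apply: (mulIf (za_neq0 q_neq0 n)); rewrite divfK ?za_neq0 //.
    case: n => [|n].
      have /eqP := d0 DAG; rewrite B_gamma_mul addr0 FBG addr_eq0 => /eqP e.
      rewrite /zb za0 cqE // mulrC -[RHS]opprK -mulNr opprB e.
      by rewrite opprK.
    have /eqP := d1 n ADAG; rewrite B_zmulE mulr0 addr0 FBG zA' // -/(zb q n.+1).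
    by rewrite addr_eq0 => /eqP ->; rewrite zaS; ring.
  (* [Be] and [AD] produce [AT] and [ATG] through $d$; [BG] is normalized to 0, as $d$ sees only its
     difference with [AD]. The coordinates [E1], [AG] and [Al] then match what multiplication by $z$
     must give, where [Al] makes up for the contribution of [Be] to the same word. *)
  pose G n : B := match n with
    | 0 => (fun i => if i is De then F 0%N TG else 0)
    | 1 => (fun i => match i with
      | E1 => F 0%N Ga
      | AD => - F 1%N ATG
      | AG => F 0%N DAG / (q - 1)
      | Be => F 1%N AT
      | Al => (F 0%N DA - q * F 1%N AT) / (q - 1)
      | _ => 0 end)
    | n.+2 => (fun i => match i with
      | E1 => F n.+1 AG / za q n
      | AD => - (t n.+1 * F n.+2 ATG)
      | AG => F n.+1 ADAG / (za q n * (q - 1) + zb q n)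
      | Be => t n.+1 * F n.+2 AT
      | Al => (F n.+1 ADA - za q n * q * (t n.+1 * F n.+2 AT)) /
              (za q n * (q - 1) + zb q n)
      | _ => 0 end)
    end.
  have eG n : tel_e (tel_B q_neq0 q_not_root) n * G n = G n.
    by case: n => [|[|n]]; rewrite /= ?B_e1_mul ?B_e2_mul; apply: coordsP; case.
  have nG : exists N, forall n, (N <= n)%N -> G n = 0.
    have [N Nf] := tel_fin v; exists N.+2 => -[|[|n]] // hn.
    rewrite /G; have -> : F n.+1 = 0 by apply: Nf; lia.
    have -> : F n.+2 = 0 by apply: Nf; lia.
    by apply: coordsP; case; rewrite ?coord0 ?(mulr0, mul0r, oppr0, subr0).
  have GAD n : G n.+1 AD = - (t n * F n.+1 ATG).
    by case: n => [|n] //; rewrite /t sgz0 mul1r.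
  have GBe n : G n.+1 Be = t n * F n.+1 AT.
    by case: n => [|n] //; rewrite /t sgz0 mul1r.
  have GDe n : G n.+1 De = 0 by case: n.
  have GBG n : G n.+1 BG = 0 by case: n.
  exists (tel_mk eG nG); apply: tel_inj => n; rewrite tel_dE.
  rewrite -[tel_fun (tel_mk _ _)]/G -[tel_fun v n]/(F n).
  apply: coordsP => l; case: n => [|n]; rewrite coordD coordZ.
  { rewrite -[diff _]/(@B_diff k q _) sgz0 mul1r -[tel_z _ _]/(bas Ga) B_gamma_mul.
    rewrite /B_diff; case: l; rewrite ?GBG ?add0r ?addr0 ?oppr0 //.
    all: try exact: (esym (z0 _)).
    all: rewrite ?FE2 ?FTa ?FDe ?mulr0 ?addr0 /= 1?[(q - 1) * _]mulrC ?divfK ?subrK //.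
  }
  { rewrite -[diff _]/(@B_diff k q _) -[sgz _ _]/(t n) -[tel_z _ _]/(zB q n) B_zmulE.
    rewrite /B_diff !GAD !GBe !GBG !GDe; case: l;
      rewrite ?mulr0 ?add0r ?addr0 ?oppr0 //.
    all: try exact: (esym (z1 n _)).
    all: rewrite ?FE1 ?FAl ?FBe ?FBG ?FAD //=.
    all: rewrite ?opprK 1?[t n * (t n * _)]mulrA ?tt ?mul1r //.
    all: try by rewrite mulrC divfK ?za_neq0 ?zA'_neq0.
    all: try by rewrite mulrA.
    all: try by rewrite mulrC divfK ?subrK ?zA'_neq0.
 }
- move=> w _.
  pose w' : B := fun i => match i with
    E2 => (w : Calg k) C1 | Ta => (w : Calg k) Ct | _ => 0 end.
  exists (ract (tel_gen (tel_B q_neq0 q_not_root) 0) w'), 0.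
  rewrite diff0 addr0; split.
    rewrite (diff_ract _ _ _ (tel_gen_homog _ _)) tel_diff_gen0 ract0l add0r.
    have -> : diff w' = 0 by apply: coordsP; case=> //; apply: subrr.
    by rewrite ract0r scaler0.
  rewrite eA; have -> : epsC (tel_gen (tel_B q_neq0 q_not_root) 0) = 1 :> Calg k.
    by apply: coordsP; case.
  rewrite -[ract _ _]/((1 : Calg k) * BC w') mul1r.
  by apply: coordsP; case.
Qed.

Lemma derived_hom_C_zero : derived_hom_zero C (regular B).
Proof.
exists P, epsC; split.
  by split; [apply: tel_K_projective|apply: epsC_linear|apply: epsC_quasi_iso].
exact/tel_hom_acyclic/tel_B_sequence.
Qed.

Lemma C_not_acyclic : ~ acyclic C.
Proof.
move=> /(_ (1 : Calg k) erefl) [u] /eqP.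
by rewrite -[diff u]/(0 : Calg k) oner_eq0.
Qed.

End ResolutionC.

(** * Dimensions *)

Section CoordDim.
Variables (k : fieldType) (I : finType).
Local Notation V := (coords k I).

(** The coordinates in [s] are functionals dual to the representatives [z] and vanish on [W], so
    independence modulo [W] is read off from them. *)
Lemma coord_subquotient_dim (Z W : V -> Prop) (s : seq I) (z : I -> V) :
  uniq s ->
  (forall i, i \in s -> Z (z i)) ->
  (forall v, Z v -> W (v - \sum_(i <- s) v i *: z i)) ->
  (forall i j, i \in s -> j \in s -> z i j = if i == j then 1 else 0) ->
  (forall v j, W v -> j \in s -> v j = 0) ->
  subquotient_dim Z W (size s).
Proof.
move=> us Zz ZW zE W0; pose t := tnth (in_tuple s).
have ti : injective t by apply/tuple_uniqP.
have ts i : t i \in s by apply: mem_tnth.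
exists (fun i => z (t i)); split=> [i|v Zv|c Wc i]; first exact: Zz.
  by exists (fun i => v (t i)); have := ZW v Zv; rewrite big_tnth.
have := W0 _ (t i) Wc (ts i); rewrite coord_sum (bigD1 i) //=.
rewrite coordZ zE // eqxx mulr1 big1 ?addr0 // => j /negbTE ji.
by rewrite coordZ zE // (inj_eq ti) ji mulr0.
Qed.

Lemma coord_subspace_dim (Z : V -> Prop) (s : seq I) :
  uniq s -> (forall i, i \in s -> Z (coord_basis k i)) ->
  (forall v l, Z v -> l \notin s -> v l = 0) -> subspace_dim Z (size s).
Proof.
move=> us Zs Z0.
rewrite /subspace_dim.
apply: (@coord_subquotient_dim Z (fun v : V => v = 0) s (@coord_basis k I)) =>
  // [v Zv|v j ->] //.
apply: coordsP => l; rewrite coordD coordN coord_sum coord0.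
apply/eqP; rewrite subr_eq0; apply/eqP.
have [ls|/(Z0 _ _ Zv) v0] := boolP (l \in s); last first.
  rewrite v0 big1 // => i _; rewrite coordZ /coord_basis.
  by case: eqP => [->|_]; rewrite ?v0 ?mulr0 ?mul0r.
rewrite (bigD1_seq l) //= coordZ /coord_basis eqxx mulr1 big1 ?addr0 //.
by move=> i /negbTE il; rewrite coordZ il mulr0.
Qed.

End CoordDim.

Section DimB.
Variables (k : fieldType) (q : k).
Local Notation B := (Balg q).
Local Notation bas := (@coord_basis k B_basis : B_basis -> B).

Lemma B_space_dim : space_dim B 17.
Proof.
apply: (@coord_subspace_dim k B_basis _ B_basis_seq) => // v l _.
by case: l.
Qed.

Lemma C_space_dim : space_dim (restriction (B_to_C q)) 2.
Proof.
apply: (@coord_subspace_dim k C_basis _ [:: C1; Ct]) => // v l _.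
by case: l.
Qed.

Lemma B_homog_dim (i : nat) :
  subspace_dim (@homog k B i%:Z) (nth 0 [:: 2; 5; 6; 3; 1] i)%N.
Proof.
pose s := [seq l <- B_basis_seq | B_degn l == i].
have -> : nth 0%N [:: 2; 5; 6; 3; 1] i = size s.
  by rewrite /s; case: i s => [|[|[|[|[|i]]]]] _ //; exact: nth_nil.
apply: coord_subspace_dim => [|l|v l hv].
- exact: filter_uniq.
- rewrite mem_filter => /andP[/eqP <- _].
  exact: (@coord_basis_homog k _ B_deg l).
- move=> nl; have h : B_deg l != i%:Z.
    apply: contra nl => /eqP[el]; rewrite mem_filter el eqxx.
    by case: l {el}.
  exact: hv h.
Qed.

(** Modulo exactness the pairs $\beta,\alpha\tau$ and $\delta,\tau\gamma$ drop out. Of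
    $\alpha\delta$ and $\beta\gamma$ only the sum is closed, and $\alpha\tau\gamma$ is a boundary;
    this leaves 11 classes. *)
Definition H_seq := [:: E1; E2; Ga; Al; Ta; AG; AD; DA; ADA; DAG; ADAG].
Definition H_rep (l : B_basis) : B := if l is AD then bas AD + bas BG else bas l.

Lemma B_cohomology_dim (i : nat) :
  cohomology_dim B i%:Z (nth 0 [:: 2; 3; 3; 2; 1] i)%N.
Proof.
pose s := [seq l <- H_seq | B_degn l == i].
have -> : nth 0%N [:: 2; 3; 3; 2; 1] i = size s.
  by rewrite /s; case: i s => [|[|[|[|[|i]]]]] _ //; exact: nth_nil.
rewrite /cohomology_dim.
apply: (@coord_subquotient_dim k B_basis (@cocycle k B i%:Z)
  (@coboundary k B i%:Z) s H_rep) => [|l|v [hv dv]|l m|v l].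
- exact: filter_uniq.
- rewrite mem_filter => /andP[/eqP <- lH]; split.
    have h : B_homog (B_deg l) (H_rep l).
      by case: l {lH}; case=> // _; rewrite /H_rep coordD /coord_basis /= addr0.
    exact: h.
  apply: coordsP => m; rewrite -[diff _]/(@B_diff k q _) /B_diff.
  case: l lH => // _; case: m; rewrite /H_rep ?coordE /coord_basis //=;
    by rewrite ?(addr0, add0r, subrr, oppr0).
- have v0 l : B_degn l != i -> v l = 0.
    by move=> h; apply: (hv l); apply: contra h => /eqP[->].
  have dl l : @B_diff k q v l = 0 by rewrite -[B_diff v]/(diff (v : B)) dv.
  exists (fun l => match l with
      De => v TG | Be => v AT | BG => v ATG | _ => 0 end).
    move=> l hl.
    have h j : B_deg j = B_deg l + 1 -> v j = 0.
      by move=> e; apply: (hv j); rewrite e -(inj_eq (addIr (-1))) addrK.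
    by case: l hl h => // _ h; apply: h.
  have -> : \sum_(j <- s) v j *: H_rep j = \sum_(j <- H_seq) v j *: H_rep j.
    rewrite /s big_filter big_mkcond; apply: eq_bigr => j _.
    by case: eqP => // /eqP/v0 ->; rewrite scale0r.
  apply: coordsP => l; rewrite /H_seq !big_cons big_nil !coordE.
  rewrite -[diff _]/(@B_diff k q _) /B_diff /H_rep.
  { case: l; rewrite ?coordE /coord_basis /= ?(mulr0, mulr1, add0r, addr0, oppr0)
      ?subrr ?subr0 //.
  all: first [exact: (dl TG)|exact: (dl AT)|exact: (dl ATG)]. }
- rewrite !mem_filter => /andP[_ hl] /andP[_ hm].
  by case: l m hl hm => [] [] // _ _; rewrite /H_rep ?coordD /coord_basis /= ?addr0.
- case=> u _ -> ; rewrite mem_filter => /andP[_].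
  by case: l.
Qed.

End DimB.

(** * The bimodule B e_1 *)

Lemma diff1 (k : fieldType) (A : dgAlgType k) : diff (1 : A) = 0.
Proof.
have := diffM 0 (1 : A) 1 (@homog1 k A); rewrite !mul1r mulr1 expr0z scale1r.
by move=> /eqP; rewrite -[X in X == _]addr0 (inj_eq (addrI _)) eq_sym => /eqP.
Qed.

(* j 1 is only an idempotent of B. *)
Record nonunital_map (k : fieldType) (A B : dgAlgType k) (j : A -> B) : Prop :=
  NonunitalMap {
  nu_linear : linear j;
  nuM : {morph j : a b / a * b};
  nu_homog : forall i a, homog i a -> homog i (j a);
  nu_diff : forall a, j (diff a) = diff (j a) }.

Section Corner.
Variables (k : fieldType) (A B : dgAlgType k) (j : A -> B).

Definition is_corner of nonunital_map j : pred B := fun b => b * j 1 == b.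

Hypothesis jP : nonunital_map j.

Lemma corner_closed : submod_closed (is_corner jP).
Proof.
split=> [|c u v /eqP eu /eqP ev]; apply/eqP; first exact: mul0r.
by rewrite mulrDl -scalerAl eu ev.
Qed.
HB.instance Definition _ := GRing.isSubmodClosed.Build k B (is_corner jP)
  corner_closed.

(* The right A-module B j(1). *)
Definition corner_mod : Type := {b : B | is_corner jP b}.
HB.instance Definition _ := SubChoice.on corner_mod.
HB.instance Definition _ := [SubChoice_isSubLmodule of corner_mod by <:].
Local Notation M := corner_mod.

Definition cval (m : M) : B := val m.
Lemma cval_inj : injective cval. Proof. exact: val_inj. Qed.
Lemma cval_linear : linear cval. Proof. by []. Qed.
Lemma cvalD (u v : M) : cval (u + v) = cval u + cval v.
Proof. exact: (linearDf cval_linear). Qed.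
Lemma cvalZ c (u : M) : cval (c *: u) = c *: cval u.
Proof. exact: (linearZf cval_linear). Qed.
Lemma cval_e (m : M) : cval m * j 1 = cval m.
Proof. exact/eqP/(valP m). Qed.
Lemma is_cornerP (b : B) : b * j 1 = b -> is_corner jP b.
Proof. by move/eqP. Qed.
Definition cmk (b : B) (e : b * j 1 = b) : M := Sub b (is_cornerP e).
Lemma cmkE b e : cval (@cmk b e) = b. Proof. by []. Qed.

Lemma nu_homog1 : homog 0 (j 1).
Proof. by apply: (nu_homog jP); apply: homog1. Qed.
Lemma nu_diff1 : diff (j 1) = 0.
Proof. by rewrite -(nu_diff jP) diff1 (linear0f (nu_linear jP)). Qed.
Lemma nu_mul1 a : j a * j 1 = j a.
Proof. by rewrite -(nuM jP) mulr1. Qed.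

Lemma diff_mul_unit (b : B) : diff (b * j 1) = diff b * j 1.
Proof.
elim/(gr_ind (@homog_grading k B)): b => [u v hu hv|i b hb].
  by rewrite mulrDl !diffD mulrDl hu hv.
by rewrite (diffM _ _ _ hb) nu_diff1 mulr0 scaler0 addr0.
Qed.

Lemma corner_component n (m : M) :
  exists m', cval m' = component homog_grading n (cval m).
Proof.
have e : component homog_grading n (cval m) * j 1 =
    component homog_grading n (cval m).
  rewrite -[in RHS]cval_e; symmetry.
  apply: (component_morph0 _ _ (F := fun b : B => b * j 1)) => [c u v|i b hb].
    by rewrite mulrDl scalerAl.
  by rewrite -[i]addr0; apply: homogM => //; apply: nu_homog1.
by exists (cmk e).
Qed.

Definition corner_homog i (m : M) := homog i (cval m).
Let corner_grading : is_grading corner_homog.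
Proof.
exact: (@pullback_grading k M B (@homog k _) homog_grading cval
  cval_linear cval_inj corner_component).
Qed.

Lemma corner_diff_subproof (m : M) : diff (cval m) * j 1 = diff (cval m).
Proof. by rewrite -diff_mul_unit cval_e. Qed.
Definition corner_diff (m : M) : M := cmk (corner_diff_subproof m).
Let corner_diff_linear : linear corner_diff.
Proof. by move=> c u v; apply: cval_inj; apply: diff_linear. Qed.
Let corner_diff_homog i m : corner_homog i m -> corner_homog (i + 1) (corner_diff m).
Proof. exact: diff_homog. Qed.
Let corner_diff_diff m : corner_diff (corner_diff m) = 0.
Proof. by apply: cval_inj; apply: diff_diff. Qed.
HB.instance Definition _ := isComplex.Build k M corner_grading
  corner_diff_linear corner_diff_homog corner_diff_diff.

Lemma corner_act_subproof (m : M) a : cval m * j a * j 1 = cval m * j a.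
Proof. by rewrite -mulrA nu_mul1. Qed.
Definition corner_act (m : M) (a : A) : M := cmk (corner_act_subproof m a).
Lemma corner_actE m a : cval (corner_act m a) = cval m * j a. Proof. by []. Qed.
Let corner_linearl a : linear (corner_act^~ a).
Proof.
move=> c u v; apply: cval_inj.
by rewrite cval_linear !corner_actE cval_linear mulrDl scalerAl.
Qed.
Let corner_linearr m : linear (corner_act m).
Proof.
move=> c u v; apply: cval_inj.
by rewrite cval_linear !corner_actE (nu_linear jP) mulrDr scalerAr.
Qed.
Let corner_act1 m : corner_act m 1 = m.
Proof. by apply: cval_inj; apply: cval_e. Qed.
Let corner_actM m a b : corner_act m (a * b) = corner_act (corner_act m a) b.
Proof. by apply: cval_inj; rewrite !corner_actE (nuM jP) mulrA. Qed.
Let corner_act_homog i n (m : M) (a : A) :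
  homog i m -> homog n a -> homog (i + n) (corner_act m a).
Proof. by move=> hm /(nu_homog jP); apply: homogM. Qed.
Let corner_act_diff i (m : M) (a : A) : homog i m ->
  diff (corner_act m a) =
  corner_act (diff m) a + (-1 : k) ^ i *: corner_act m (diff a).
Proof.
move=> hm; apply: cval_inj; rewrite cvalD cvalZ !corner_actE (nu_diff jP).
exact: (diffM _ _ _ hm).
Qed.
HB.instance Definition _ := isDGModule.Build k A M
  corner_linearl corner_linearr corner_act1 corner_actM corner_act_homog
  corner_act_diff.

Lemma cval_diff (m : M) : cval (diff m) = diff (cval m). Proof. by []. Qed.
Lemma cval_ract (m : M) a : cval (ract m a) = cval m * j a. Proof. by []. Qed.
Lemma corner_lact_subproof b (m : M) : b * cval m * j 1 = b * cval m.
Proof. by rewrite -mulrA cval_e. Qed.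
Definition corner_lact (b : B) (m : M) : M := cmk (corner_lact_subproof b m).

Lemma corner_lactE b m : cval (corner_lact b m) = b * cval m. Proof. by []. Qed.

Hypothesis A0 : forall a : A, diff a = 0.

Lemma corner_left_action : @left_action k A B (shift M A0) corner_lact.
Proof.
split.
- move=> m c u v; apply: cval_inj.
  by rewrite cval_linear !corner_lactE mulrDl scalerAl.
- move=> b c u v; apply: cval_inj.
  by rewrite cval_linear !corner_lactE cval_linear mulrDr scalerAr.
- by move=> m; apply: cval_inj; apply: mul1r.
- by move=> b c m; apply: cval_inj; rewrite !corner_lactE mulrA.
- by move=> b m a; apply: cval_inj; apply: mulrA.
- move=> i n b m hb hm.
  have h : homog (i + (n - 1)) (b * cval m) := homogM _ _ _ _ hb hm.
  by rewrite addrA in h; exact: h.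
- move=> i b m hb; apply: cval_inj.
  rewrite [RHS]cvalD cvalZ !corner_lactE.
  exact: (diffM _ _ _ hb).
Qed.

End Corner.

(** * K-projectivity and lifting up to homotopy *)

Section KProjective.
Variables (k : fieldType) (A : dgAlgType k).

Lemma hom_deg_compose (X Y Z : dgModType A) i n (f : Y -> Z) (g : X -> Y) :
  hom_deg i f -> hom_deg n g -> hom_deg (i + n) (f \o g).
Proof.
move=> [[fl fA] fh] [[gl gA] gh]; split; last first.
  by move=> m x hx; rewrite [i + n]addrC addrA; apply/fh/gh.
by split=> [c u v|m a] /=; rewrite ?gl ?fl ?gA ?fA.
Qed.

Lemma hom_deg_add (X Y : dgModType A) n (g h : X -> Y) :
  hom_deg n g -> hom_deg n h -> hom_deg n (fun p => g p + h p).
Proof.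
move=> [[gl gA] gh] [[hl hA] hh]; split; [split=> [c u v|p a]|move=> j p hp].
- by rewrite gl hl scalerDr addrACA.
- by rewrite gA hA ractDl.
- by apply: homogD; [apply: gh|apply: hh].
Qed.

(** A map out of $A$ is determined by its value at 1, so that $\mathrm{Hom}_A(A,N)$ is $N$. *)
Lemma regular_hom_acyclic (N : dgModType A) : acyclic N ->
  hom_acyclic (regular A) N.
Proof.
move=> aN n f [[fl fA] fh] df.
have d0 : diff (f 1) = 0.
  have /eqP := df (1 : A); rewrite /hom_diff.
  have -> : diff (1 : regular A) = 0 by apply: (@diff1 k A).
  by rewrite (linear0f fl) scaler0 subr0 => /eqP.
have h1 : homog n (f 1) by rewrite -[n]add0r; apply: fh; apply: (@homog1 k A).
have [u hu eu] := acyclic_homog aN h1 d0.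
exists (fun a => ract u (a : A)).
  split; [split=> [c a b|a b]|move=> i a ha]; first exact: ract_linearr.
    exact: ractM.
  by rewrite addrC; apply: ract_homog.
move=> a; rewrite /hom_diff (diff_ract _ _ _ hu) addrK -eu -fA.
by congr f; apply: esym; apply: (@mul1r A).
Qed.

Lemma prod_hom_acyclic (X Y N : dgModType A) :
  hom_acyclic X N -> hom_acyclic Y N -> hom_acyclic (X * Y)%type N.
Proof.
move=> aX aY n f [[fl fA] fh] df.
have in1 c u v : ((c *: u + v, 0) : X * Y) = c *: (u, 0) + (v, 0).
  by congr pair; rewrite /= scaler0 addr0.
have in2 c u v : ((0, c *: u + v) : X * Y) = c *: (0, u) + (0, v).
  by congr pair; rewrite /= scaler0 addr0.
have hX : hom_deg n (fun x => f (x, 0)).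
  split; [split=> [c u v|x a]|move=> i x hx]; first by rewrite in1 fl.
    by rewrite -fA; congr f; congr pair; rewrite /= ract0l.
  by apply: fh; split=> //; apply: homog0.
have hY : hom_deg n (fun y => f (0, y)).
  split; [split=> [c u v|x a]|move=> i x hx]; first by rewrite in2 fl.
    by rewrite -fA; congr f; congr pair; rewrite /= ract0l.
  by apply: fh; split=> //; apply: homog0.
have [|g hg eg] := aX _ _ hX.
  move=> x; rewrite -(df (x, 0)) /hom_diff; congr (_ - _ *: f _).
  by congr pair; rewrite diff0.
have [|h hh eh] := aY _ _ hY.
  move=> y; rewrite -(df (0, y)) /hom_diff; congr (_ - _ *: f _).
  by congr pair; rewrite diff0.
have [[gl gA] gd] := hg; have [[hl hA] hd] := hh.
exists (fun p => g p.1 + h p.2).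
  split; [split=> [c u v|p a]|move=> i p [h1 h2]].
  - by rewrite gl hl scalerDr addrACA.
  - by rewrite gA hA ractDl.
  - by apply: homogD; [apply: gd|apply: hd].
move=> [x y]; have -> : ((x, y) : X * Y) = (x, 0) + (0, y).
  by congr pair; rewrite /= ?addr0 ?add0r.
rewrite (linearDf fl) eg eh /hom_diff /= !addr0 !add0r diffD scalerDr opprD.
by rewrite addrACA.
Qed.

Section Lift.
Variables (A0 : forall a : A, diff a = 0).
Variables (P X Y : dgModType A) (s : X -> Y).
Hypotheses (KP : K_projective P) (sl : mod_linear s) (sq : quasi_iso s)
  (Y0 : forall y : Y, diff y = 0).

Let s0 x : s (diff x) = 0.
Proof. by have [[_ _ ->] _ _] := sq; apply: Y0. Qed.
Let PC : hom_acyclic P (cone (shift_cone_map A0 sl sq s0)).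
Proof. exact/KP/cone_acyclic. Qed.

(** The map $(0,t)$ is a cocycle of degree 1 with values in the acyclic cone of [s]; the two
    coordinates of a primitive are the lift [u] and the homotopy [h]. *)
Lemma lift_exists (t : P -> Y) : hom_deg 0 t -> (forall p, t (diff p) = 0) ->
  exists (u : P -> X) (h : P -> Y), [/\ hom_deg 0 u,
    forall p, diff (u p) = u (diff p), hom_deg (-1) h
    & forall p, t p = s (u p) - h (diff p)].
Proof.
move=> [[tl tA] th] td.
pose F p : cone (shift_cone_map A0 sl sq s0) := (0, t p).
have hF : hom_deg 1 F.
  split; [split=> [c u v|p a]|move=> i p hp].
  - by congr pair; rewrite /= ?scaler0 ?addr0 ?tl.
  - by congr pair; rewrite /= ?ract0l ?tA.
  - split; first exact: homog0.
    by rewrite /homog /= /shift_homog addrK; have := th i p hp; rewrite addr0.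
have [|G [[Gl GA] Gh] eG] := PC hF.
  move=> p; rewrite /hom_diff cone_diffE /F /= td diff0 (linear0f sl.1) addr0.
  by rewrite [diff _]Y0 scaler0 subr0.
rewrite subrr in Gh eG.
have e p : F p = diff (G p) - G (diff p) by rewrite eG /hom_diff expr0z scale1r.
exists (fun p => (G p).1), (fun p => (G p).2 : Y); split.
- split; [split=> [c u v|p a]|move=> i p hp]; first by rewrite Gl.
    by rewrite GA.
  by have [] := Gh i p hp.
- by move=> p; have /(congr1 fst)/eqP := e p; rewrite eq_sym subr_eq0 => /eqP.
- split; [split=> [c u v|p a]|move=> i p hp]; first by rewrite Gl.
    by rewrite GA.
  by have [_] := Gh i p hp; rewrite addr0.
- move=> p; have -> : t p = (diff (G p) - G (diff p)).2 := congr1 snd (e p).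
  by rewrite cone_diffE /= [diff _]Y0 add0r.
Qed.

(** The hypothesis on [y] makes $(K,y)$ a cocycle of degree 0 with values in the cone of [s]; the
    first coordinate of a primitive is the homotopy. *)
Lemma lift_unique (K : P -> X) (y : P -> Y) : hom_deg 0 K ->
  (forall p, diff (K p) = K (diff p)) -> hom_deg (-1) y ->
  (forall p, s (K p) = y (diff p)) ->
  exists2 h : P -> X, hom_deg (-1) h & forall p, K p = diff (h p) + h (diff p).
Proof.
move=> [[Kl KA] Kh] Kd [[yl yA] yh] sK.
pose F p : cone (shift_cone_map A0 sl sq s0) := (K p, y p).
have hF : hom_deg 0 F.
  split; [split=> [c u v|p a]|move=> i p hp].
  - by congr pair; rewrite /= ?Kl ?yl.
  - by congr pair; rewrite /= ?KA ?yA.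
  - split; first exact: Kh.
    by rewrite /homog /= /shift_homog addr0; apply: yh.
have [|G [[Gl GA] Gh] eG] := PC hF.
  have yd p : diff (y p : shift Y A0) = 0 := Y0 (y p).
  move=> p; rewrite /hom_diff cone_diffE /F /= Kd sK expr0z scale1r.
  by rewrite yd add0r subrr.
rewrite sub0r in Gh eG.
exists (fun p => (G p).1).
  split; [split=> [c u v|p a]|move=> i p hp]; first by rewrite Gl.
    by rewrite GA.
  by have [] := Gh i p hp.
move=> p; have -> : K p = (hom_diff (-1) G p).1 := congr1 fst (eG p).
rewrite /hom_diff /=.
by rewrite -/(sgz k (-1)) -[-1]sub0r sgzB1 sgz0 scaleN1r opprK.
Qed.

End Lift.
End KProjective.

(** * The resolution of V *)

Section LambdaSide.
Variables (k : fieldType) (q : k).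
Local Notation L := (Lalg q).
Local Notation V := (Vmod q).
Local Notation bas := (@coord_basis k L_basis : L_basis -> L).

Definition zL (n : nat) : L := fun i => match i with
  | Lx => (- q) ^+ n | Ly => 1 | _ => 0 end.

Lemma L_zmulE (u : L) n : zL n * u = (fun i => match i with
  | L1 => 0 | Lx => (- q) ^+ n * u L1 | Ly => u L1
  | Lw => u Lx + q * (- q) ^+ n * u Ly end) :> L.
Proof. by apply: coordsP; case; rewrite L_mulE /L_mul /zL; ring. Qed.

Let zLh (n : nat) : homog (n.+2%:Z + 1 - n.+1%:Z) (zL n).
Proof.
have -> : n.+2%:Z + 1 - n.+1%:Z = 2 by lia.
have h : L_homog 2 (zL n) by case.
exact: h.
Qed.
Let zLz n : zL n * zL n.+1 = 0.
Proof.
apply: coordsP; case; rewrite L_zmulE /zL ?mulr0 //.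
by rewrite mulr1 exprS coord0; ring.
Qed.

(* Resolves V = Lambda / (x + y) [-1]. *)
Definition tel_L : telescope L := @Telescope k L (fun=> 1) zL (fun n => n.+1%:Z)
  (fun n => mulr1 1) (fun n => homog1) (fun n => L_diff0 1) zLh
  (fun n => L_diff0 _) (fun n => mul1r _) (fun n => mulr1 _) zLz.

Definition Vgen (b : L) : V := fun i => if i is V_x then b Lx - b Ly else b L1.

Lemma Vgen_linear : linear Vgen.
Proof.
move=> c u v; apply: coordsP; case; rewrite !coordE /Vgen !coordE //.
by ring.
Qed.
Lemma Vgen_ract b c : Vgen (b * c) = ract (Vgen b) c.
Proof.
apply: coordsP; case; rewrite V_ractE /Vgen /V_act L_mulE /L_mul //.
by ring.
Qed.
Lemma Vgen_surj (m : V) : exists b, Vgen b = m.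
Proof.
exists (fun i => match i with L1 => m V_1 | Lx => m V_x | _ => 0 end).
by apply: coordsP; case=> //; rewrite /Vgen subr0.
Qed.
Lemma Vgen_eq0 b : Vgen b = 0 <-> b L1 = 0 /\ b Lx = b Ly.
Proof.
split=> [e|[e1 ex]]; last first.
  by apply: coordsP; case; rewrite /Vgen // ex subrr.
split; first by have /(congr1 (fun v : V => v V_1)) := e.
have /(congr1 (fun v : V => v V_x))/eqP := e.
by rewrite subr_eq0 => /eqP.
Qed.

Lemma V_shifted_cyclic : shifted_cyclic (bas Lx + bas Ly) Vgen.
Proof.
have xyE : bas Lx + bas Ly = zL 0.
  by apply: coordsP; case; rewrite coordD /coord_basis /zL /= ?addr0 ?add0r.
split.
- by split; [apply: Vgen_linear|apply: Vgen_ract].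
- exact: Vgen_surj.
- move=> b; rewrite xyE Vgen_eq0; split=> [[e1 exy]|[c ->]]; last first.
    by rewrite L_zmulE expr0 mul1r.
  exists (fun i => match i with L1 => b Lx | Lx => b Lw | _ => 0 end).
  apply: coordsP; case; rewrite L_zmulE ?expr0 ?mul1r //.
  by rewrite mulr0 addr0.
- move=> i m; split=> [hm|[b hb <-]].
    pose b : L := fun i => match i with L1 => m V_1 | Lx => m V_x | _ => 0 end.
    exists b.
      have h : L_homog (i - 1) b.
        have h j : V_deg j != i -> m j = 0 := hm j.
        by case=> // n; apply: h; apply: contra n => /eqP <-.
      exact: h.
    by apply: coordsP; case=> //; rewrite /Vgen subr0.
  have h : V_homog i (Vgen b).
    have h j : L_deg j + 1 != i -> b j = 0.
      by move=> n; apply: hb; apply: contra n => /eqP ->; rewrite subrK.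
    by case=> n; rewrite /Vgen ?h ?subrr //; apply: contra n => /eqP <-.
  exact: h.
Qed.

Local Notation R0 := (tel tel_L).
Definition epsV (f : R0) : V := Vgen (tel_fun f 0).

Lemma epsV_linear : mod_linear epsV.
Proof.
split=> [c u v|f b]; first by rewrite /epsV tel_lin Vgen_linear.
by rewrite /epsV tel_actE Vgen_ract.
Qed.

Lemma epsV_diff f : epsV (diff f) = 0.
Proof.
rewrite /epsV tel_dE L_diff0 scaler0 addr0; apply/Vgen_eq0.
by rewrite [tel_z _ _ * _]L_zmulE expr0 mul1r.
Qed.

Lemma epsV_quasi_iso : quasi_iso epsV.
Proof.
have [el eA] := epsV_linear.
split.
- split=> // [i f hf|f]; last exact: epsV_diff.
  by have [_ _ _ h] := V_shifted_cyclic; apply/h; exists (tel_fun f 0); [apply: hf|].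
- move=> v dv [w ew].
  pose F n : L := tel_fun v n.
  have d1 n l : (zL n * F n.+1 : L) l = 0.
    have /(congr1 (fun f : R0 => (tel_fun f n : L) l)) := dv.
    by rewrite tel_dE coordD coordZ mulr0 addr0.
  have [F01 F0xy] : F 0%N L1 = 0 /\ F 0%N Lx = F 0%N Ly by apply/Vgen_eq0.
  have F1 n : F n.+1 L1 = 0 by have := d1 n Ly; rewrite L_zmulE.
  have Fx n : F n Lx = (- q) ^+ n * F n Ly.
    case: n => [|n]; first by rewrite expr0 mul1r.
    have /eqP := d1 n Lw; rewrite L_zmulE addr_eq0 => /eqP ->.
    by rewrite exprS; ring.
  (* In $((-q)^nx+y)u$ the coordinates at $y$ and $yx$ are those of $u$ at 1 and $x$ when $u$ has no
     $y$, so they can be prescribed; the coordinate at $x$ then agrees by [Fx]. *)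
  pose G n : L := if n is n'.+1 then
    (fun i => match i with L1 => F n' Ly | Lx => F n' Lw | _ => 0 end) else 0.
  have eG n : tel_e tel_L n * G n = G n by apply: mul1r.
  have nG : exists N, forall n, (N <= n)%N -> G n = 0.
    have [N Nf] := tel_fin v; exists N.+1 => -[|n] // hn.
    rewrite /G; have -> : F n = 0 by apply: Nf; lia.
    by apply: coordsP; case.
  exists (tel_mk eG nG); apply: tel_inj => n; rewrite tel_dE L_diff0 scaler0 addr0.
  rewrite -[tel_fun (tel_mk _ _)]/G -[tel_fun v n]/(F n) [tel_z _ _ * _]L_zmulE.
  apply: coordsP; case=> //; last by rewrite /G mulr0 addr0.
  by case: n => [|n].
- move=> w _; have [b eb] := Vgen_surj w.
  exists (ract (tel_gen tel_L 0) b), 0.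
  rewrite diff0 addr0; split.
    rewrite (diff_ract _ _ _ (tel_gen_homog _ _)) tel_diff_gen0 ract0l add0r.
    by rewrite L_diff0 ract0r scaler0.
  have e1 : epsV (tel_gen tel_L 0) = Vgen 1 by [].
  by rewrite eA e1 -Vgen_ract mul1r.
Qed.

Lemma epsV_resolution : K_projective_resolution epsV.
Proof. by split; [apply: tel_K_projective|apply: epsV_linear|apply: epsV_quasi_iso]. Qed.

End LambdaSide.

(** * The embeddings of Lambda and V in B e_1 *)

Section Embedding.
Variables (k : fieldType) (q : k) (q_neq0 : q != 0)
  (q_not_root : forall n : nat, (0 < n)%N -> q ^+ n != 1).
Local Notation L := (Lalg q).
Local Notation V := (Vmod q).
Local Notation B := (Balg q).
Local Notation bas := (@coord_basis k B_basis : B_basis -> B).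
Local Notation c := (cq q).

(** The closed elements of degree 2 in $e_1Be_1$ which are combinations of $\alpha\gamma$ and
    $\alpha\delta+\beta\gamma$ represent its $H^2$. Here $y$ goes to $c(\alpha\delta+\beta\gamma)$
    and $x$ to $q(\alpha\gamma+c(\alpha\delta+\beta\gamma))$, both of square 0; they are scaled so
    that $\gamma$ is annihilated by the image of $x+y$. *)
Definition jB (u : L) : B := fun i => match i with
  | E1 => u L1
  | AG => q * u Lx
  | AD | BG => q * c * u Lx + c * u Ly
  | ADAG => c * q * u Lw
  | _ => 0
  end.

Lemma jB1 : jB 1 = bas E1.
Proof.
rewrite -[RHS]/(bas E1) -[1]/(L_one q).
by apply: coordsP; case; rewrite /jB /L_one /coord_basis /= ?mulr0 ?addr0.
Qed.

Lemma jBP : nonunital_map jB.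
Proof.
split.
- by move=> x u v; apply: coordsP; case; rewrite !coordE /jB ?coordE; ring.
- move=> u v; rewrite L_mulE B_mulE.
  apply: coordsP; case; rewrite /B_mul /jB /L_mul; try by ring.
  by rewrite /cq; field; rewrite (q1_neq0 q_not_root).
- move=> i u hu.
  have h : B_homog i (jB u).
    have h j : L_deg j != i -> u j = 0 := hu j.
    by case=> // n; rewrite /jB ?h ?mulr0 ?addr0.
  exact: h.
- move=> u; apply: coordsP; case; rewrite -[RHS]/(@B_diff k q (jB u) _) /B_diff /jB;
    rewrite ?mulr0 ?addr0 ?subrr //.
Qed.

Lemma jB_zL n : jB (zL q n) = zB q n.
Proof. by apply: coordsP; case; rewrite /jB /zL /zB /zb /za; ring. Qed.

Local Notation M := (corner_mod jBP).

(** The class of 1 goes to $\gamma$, so that of $x$ has to go to $\gamma$ times the image of $x$,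
    which works out as $-qc\,\delta\alpha\gamma$. *)
Definition jV_val (v : V) : B := fun i => match i with
  | Ga => v V_1 | DAG => - (q * c * v V_x) | _ => 0 end.
Lemma jV_subproof (v : V) : jV_val v * jB 1 = jV_val v.
Proof. by rewrite jB1 B_mul_e1; apply: coordsP; case. Qed.
Definition jV (v : V) : M := cmk jBP (jV_subproof v).

Lemma jVE v : cval (jV v) = jV_val v.
Proof. by []. Qed.

Lemma jV_linear : mod_linear jV.
Proof.
split=> [x u v|v a]; apply: cval_inj.
  rewrite cvalD cvalZ !jVE; apply: coordsP; case;
    rewrite !coordE /jV_val ?coordE; ring.
rewrite cval_ract !jVE; apply: coordsP.
case; rewrite V_ractE B_mulE /jV_val /V_act /B_mul /jB; try by ring.
by rewrite /cq; field; rewrite (q1_neq0 q_not_root).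
Qed.

Lemma jV_homog i v : homog i v -> homog i (jV v).
Proof.
move=> hv; have h : B_homog i (cval (jV v)).
  have h j : V_deg j != i -> v j = 0 := hv j.
  by case=> // n; rewrite jVE /jV_val ?h ?mulr0 ?oppr0.
exact: h.
Qed.

Lemma jV_diff v : diff (jV v) = 0.
Proof.
apply: cval_inj; rewrite cval_diff jVE; apply: coordsP.
by case=> //; apply: subrr.
Qed.

Lemma jV_e2 v : bas E2 * cval (jV v) = cval (jV v).
Proof. by rewrite B_e2_mul jVE; apply: coordsP; case. Qed.

End Embedding.

(** * The zigzag *)

Lemma tel_ext (k : fieldType) (A : dgAlgType k) (X : telescope A)
    (N : dgModType A) (F G : tel X -> N) : mod_linear F -> mod_linear G ->
  (forall n, F (tel_gen X n) = G (tel_gen X n)) -> F =1 G.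
Proof.
move=> Fl Gl FG f; rewrite (tel_hom_gen Fl) (tel_hom_gen Gl).
by apply: eq_tel_map.
Qed.

Lemma mod_linear_hom_diff (k : fieldType) (A : dgAlgType k) (P N : dgModType A)
    n (f : P -> N) : hom_deg n f -> mod_linear (hom_diff n f).
Proof.
move=> [[fl fA] fh]; split=> [c u v|p a].
  rewrite /hom_diff fl !diff_linear fl.
  by rewrite scalerBr scalerDr opprD addrACA !scalerA [c * _]mulrC.
have l1 (x y : P) : hom_diff n f (x + y) = hom_diff n f x + hom_diff n f y.
  rewrite /hom_diff (linearDf fl) !diffD (linearDf fl) scalerDr opprD.
  exact: addrACA.
elim/(gr_ind (@homog_grading k P)): p => [x y hx hy|i p hp].
  by rewrite ractDl !l1 ractDl hx hy.
rewrite /hom_diff fA (diff_ract _ _ _ (fh _ _ hp)) (diff_ract _ _ _ hp).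
rewrite (linearDf fl) (linearZf fl) !fA ractBl ractZl scalerDr opprD scalerA.
have -> : (-1 : k) ^ (i + n) = (-1) ^ n * (-1) ^ i.
  by rewrite expfzDr ?oppr_eq0 ?oner_eq0 // mulrC.
by rewrite addrACA subrr addr0.
Qed.

Section Comparison.
Variables (k : fieldType) (q : k) (q_neq0 : q != 0)
  (q_not_root : forall n : nat, (0 < n)%N -> q ^+ n != 1).
Local Notation L := (Lalg q).
Local Notation V := (Vmod q).
Local Notation B := (Balg q).
Local Notation bas := (@coord_basis k B_basis : B_basis -> B).
Local Notation M := (corner_mod (jBP q_not_root)).
Local Notation N := (shift M (@L_diff0 k q)).
Local Notation act := (@corner_lact k L B (@jB k q) (jBP q_not_root)).
Local Notation jV := (jV q_not_root).
Local Notation R0 := (tel (tel_L q)).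

Lemma actP : @left_action k L B N act.
Proof. exact: corner_left_action. Qed.

Lemma jV_hom_deg : @hom_deg k L V N 1 jV.
Proof.
split; first exact: (jV_linear q_not_root).
move=> i v hv; have h := jV_homog q_not_root hv.
by rewrite -[i](addrK 1) in h; exact: h.
Qed.

Lemma act_jV_diff n (b : B) v : homog n b -> diff b = 0 ->
  diff (act b (jV v) : N) = 0.
Proof.
move=> hb db; rewrite (lact_diff actP (jV v : N) hb) db.
have -> : diff (jV v : N) = 0 := jV_diff q_not_root v.
rewrite (linear0f (lact_linear actP b)) scaler0 addr0.
exact: (linear0f (lact_linearl actP _)).
Qed.

Lemma act_jV_e2 (b : B) v : act (b * bas E2) (jV v) = act b (jV v).
Proof. by apply: cval_inj; rewrite !corner_lactE -mulrA jV_e2. Qed.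

Lemma act_jV_gen (b : B) n :
  act b (jV (epsV (tel_gen (tel_L q) n))) = (if n is 0 then act b (jV (Vgen 1)) else 0).
Proof.
case: n => [|n] //.
have -> : epsV (tel_gen (tel_L q) n.+1) = 0 by apply/Vgen_eq0.
have [jl _] := jV_linear q_not_root.
by rewrite (linear0f jl) (linear0f (lact_linear actP b)).
Qed.

Lemma jV_gen : cval (jV (Vgen 1)) = bas Ga.
Proof.
rewrite jVE -[1]/(L_one q); apply: coordsP.
by case; rewrite /jV_val /Vgen /L_one /coord_basis //= subr0 mulr0 oppr0.
Qed.

Lemma N_homogE i (m : N) : homog i m = homog (i - 1) (cval (m : M)).
Proof. by []. Qed.

(* Together with b, the values of g form a cochain on the resolution of C, to
   which tel_B_sequence applies; the same holds for the values of h below. *)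
Lemma R0_inj n (b : B) (g : R0 -> N) : homog n b -> b * bas E2 = b -> diff b = 0 ->
  hom_deg n g -> (forall r, act b (jV (epsV r)) = hom_diff n g r) ->
  exists b', b = diff b'.
Proof.
move=> hb eb db hg eg; have [[gl gA] gh] := hg.
pose s := sgz k n.
(* The generator $r_{m+1}$ over $B$ has degree $m$ and the generator number $m$ over $\Lambda$ has
   degree $m+1$; the shift in [N] makes up for the difference. *)
pose a m : regular B := if m is m'.+1 then s *: cval (g (tel_gen (tel_L q) m') : M)
  else b.
have [|b' [_ _ h]] := @tel_B_sequence k q q_neq0 q_not_root n a.
  split.
  - case=> [|m]; first by rewrite -[homog _ _]/(homog (0 + n) b) add0r.
    apply: homogZ; have := gh _ _ (tel_gen_homog (tel_L q) m).
    rewrite N_homogE -[tel_deg _ _]/(m.+1%:Z).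
    have -> : m.+1%:Z + n - 1 = m%:Z + n by lia.
    by [].
  - case=> [|m]; first exact: eb.
    rewrite -[ract _ _]/((s *: cval (g (tel_gen (tel_L q) m) : M)) * bas E1).
    by rewrite -scalerAl -(jB1 q) cval_e.
  - case=> [|[|m]]; rewrite -/s.
    + by rewrite scaler0.
    + rewrite -[tel_mulz _ _ _]/(b * bas Ga).
      rewrite -[diff _]/(diff (s *: cval (g (tel_gen (tel_L q) 0) : M))) diffZ.
      congr (_ *: _); rewrite -jV_gen -corner_lactE.
      have := eg (tel_gen (tel_L q) 0); rewrite act_jV_gen => ->.
      by rewrite /hom_diff tel_diff_gen0 (linear0f gl) scaler0 subr0.
    + rewrite -[tel_mulz _ _ _]/((s *: cval (g (tel_gen (tel_L q) m) : M)) * zB q m).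
      rewrite -[diff _]/(diff (s *: cval (g (tel_gen (tel_L q) m.+1) : M))) diffZ.
      congr (_ *: _).
      have := eg (tel_gen (tel_L q) m.+1); rewrite act_jV_gen.
      rewrite /hom_diff tel_diff_genS gA -/(sgz k n) -/s => /esym/eqP.
      rewrite subr_eq0 => /eqP /(congr1 (fun m : M => cval m)) e.
      rewrite -[LHS]/(cval (diff (g (tel_gen (tel_L q) m.+1)) : M)) e cvalZ.
      by rewrite -scalerAl -jB_zL.
exists (b' 0%N); have := h 0%N.
by rewrite scaler0 addr0.
Qed.

Lemma R0_surj n (h : R0 -> N) : hom_deg n h -> hom_diff n h =1 (fun=> 0) ->
  exists b (g : R0 -> N), [/\ homog (n - 1) b, b * bas E2 = b, diff b = 0,
    hom_deg (n - 1) g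
    & forall r, h r = (act b (jV (epsV r)) : N) + hom_diff (n - 1) g r].
Proof.
move=> hh dh; have [[hl hA] hd] := hh.
pose s := sgz k n.
have hg m := tel_gen_homog (tel_L q) m.
have [_ _ yd] := tel_cocycle_gen hh dh.
pose a m : regular B := if m is m'.+1 then cval (h (tel_gen (tel_L q) m') : M) else 0.
have [|x [xh xe xE]] := @tel_B_sequence k q q_neq0 q_not_root n a.
  split.
  - case=> [|m]; first exact: homog0.
    have := hd _ _ (hg m); rewrite N_homogE -[tel_deg _ _]/(m.+1%:Z).
    have -> : m.+1%:Z + n - 1 = m%:Z + n by lia.
    by [].
  - case=> [|m]; first exact: mul0r.
    rewrite -[ract _ _]/((cval (h (tel_gen (tel_L q) m) : M)) * bas E1).
    by rewrite -(jB1 q) cval_e.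
  - case=> [|[|m]]; rewrite -/s.
    + by rewrite scaler0 diff0.
    + rewrite -[tel_mulz _ _ _]/((0 : B) * bas Ga) mul0r scaler0.
      by have /(congr1 (fun m : M => cval m)) := yd 0%N; rewrite scaler0.
    + rewrite -[tel_mulz _ _ _]/((cval (h (tel_gen (tel_L q) m) : M)) * zB q m).
      have /(congr1 (fun m : M => cval m)) := yd m.+1.
      by rewrite cvalZ cval_ract jB_zL.
(* The term of the primitive at $r_0$ lies in $Be_2$ and becomes [b] up to sign; the later terms lie
   in $Be_1$ and become the values of [g]. *)
have xcorner m : (x m.+1 : B) * jB 1 = x m.+1 by rewrite jB1; apply: (xe m.+1).
pose y m : N := cmk (jBP q_not_root) (xcorner m).
have yh m : homog (tel_deg (tel_L q) m + (n - 1)) (y m).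
  have := xh m.+1; rewrite N_homogE -[tel_deg _ _]/(m%:Z) -[tel_deg _ _]/(m.+1%:Z).
  have -> : m.+1%:Z + (n - 1) - 1 = m%:Z + (n - 1) by lia.
  by [].
pose gy : R0 -> N := tel_map (X := tel_L q) y.
have yhom : hom_deg (n - 1) gy := tel_map_hom_deg yh.
have bh : homog (n - 1) (s *: x 0%N : B).
  by apply: homogZ; have := xh 0%N; rewrite add0r.
exists (s *: x 0%N : B), gy; split=> //.
- by rewrite -scalerAl; congr (_ *: _); apply: (xe 0%N).
- by rewrite diffZ; have := xE 0%N; rewrite scaler0 addr0 => <-; rewrite scaler0.
apply: (@tel_ext k L (tel_L q) N h (fun r => (act (s *: x 0%N : B) (jV (epsV r)) : N)
  + hom_diff (n - 1) gy r)); first by [].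
  have [dl dA] := mod_linear_hom_diff yhom.
  have [jl jA] := jV_linear q_not_root; have [el eA] := epsV_linear q.
  split=> [c u v|p b].
    rewrite (el c u v) (jl c (epsV u)) (lact_linear actP) (dl c u v).
    by rewrite [in RHS]scalerDr addrACA.
  by rewrite (eA p b) (jA (epsV p) b) (lact_ract actP) (dA p b) [RHS]ractDl.
move=> m; rewrite act_jV_gen /gy tel_map_hom_diff // tel_map_gen; last exact: ract1.
rewrite sgzB1 scaleNr opprK; apply: cval_inj.
have := xE m.+1; rewrite -/s -[a _]/(cval (h (tel_gen (tel_L q) m) : M)) => ->.
case: m => [|m].
  rewrite scaler0 addr0 [RHS]cvalD corner_lactE jV_gen addrC.
  by rewrite -scalerAl.
rewrite add0r [RHS]cvalD cvalZ; congr (_ + _ *: _).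
by rewrite cval_ract jB_zL.
Qed.

Section Resolution.
Variables (R : dgModType L) (eps : R -> V).
Hypothesis HR : K_projective_resolution eps.

Let KR : K_projective R. Proof. by case: HR. Qed.
Let el : mod_linear eps. Proof. by case: HR. Qed.
Let eq : quasi_iso eps. Proof. by case: HR. Qed.

Lemma eps_diff r : eps (diff r) = 0.
Proof. by have [[_ _ ->] _ _] := eq. Qed.

Lemma quasi_iso_hom_deg (X Y : dgModType L) (s : X -> Y) :
  mod_linear s -> quasi_iso s -> hom_deg 0 s.
Proof. by move=> sl [[_ sh _] _ _]; split=> // i m hm; rewrite addr0; apply: sh. Qed.

(** Two applications of [lift_exists] give maps between the resolutions, which respect the
    augmentations only up to the homotopies [eta] and [eta']; [lift_unique] then gives [kappa]. *)
Lemma comparison : exists (psi : R0 -> R) (phi : R -> R0)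
    (eta : R0 -> V) (eta' : R -> V) (kappa : R -> R),
  [/\ hom_deg 0 psi /\ hom_deg 0 phi,
      hom_deg (-1) eta /\ hom_deg (-1) eta',
      (forall r, diff (psi r) = psi (diff r)) /\
      (forall r, diff (phi r) = phi (diff r)),
      (forall r, epsV r = eps (psi r) - eta (diff r)) /\
      (forall r, eps r = epsV (phi r) - eta' (diff r))
    & hom_deg (-1) kappa /\
      forall r, psi (phi r) - r = diff (kappa r) + kappa (diff r)].
Proof.
have L0 := @L_diff0 k q; have V0 := @V_diff0 k q.
have [psi [eta [hpsi dpsi heta epsi]]] := lift_exists L0
  (@tel_K_projective k L (tel_L q)) el eq V0
  (quasi_iso_hom_deg (epsV_linear q) (epsV_quasi_iso q)) (@epsV_diff k q).
have [phi [eta' [hphi dphi heta' ephi]]] := lift_exists L0 KR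
  (epsV_linear q) (epsV_quasi_iso q) V0 (quasi_iso_hom_deg el eq) eps_diff.
have hK : hom_deg 0 (fun r => psi (phi r) - r).
  have h : hom_deg (0 + 0) (psi \o phi) := hom_deg_compose hpsi hphi.
  by have := hom_deg_sub h (hom_deg1 R).
have hy : hom_deg (-1) (fun r => eta' r + eta (phi r)).
  apply: hom_deg_add => //.
  have h : hom_deg (-1 + 0) (eta \o phi) := hom_deg_compose heta hphi.
  by rewrite addr0 in h.
have [kappa hkappa ekappa] : exists2 h : R -> R, hom_deg (-1) h &
    forall p, psi (phi p) - p = diff (h p) + h (diff p).
  apply: (lift_unique L0 KR el eq V0 hK _ hy) => r.
    by rewrite diffB dpsi dphi.
  have e1 : eps (psi (phi r)) = epsV (phi r) + eta (phi (diff r)).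
    by rewrite epsi dphi subrK.
  by rewrite (linearBf el.1) e1 (ephi r) opprB addrC addrA subrK.
by exists psi, phi, eta, eta', kappa.
Qed.

Lemma hom_diff_comp n (X Y : dgModType L) (g : Y -> N) (u : X -> Y) x :
  (forall x, diff (u x) = u (diff x)) ->
  hom_diff n g (u x) = hom_diff n (g \o u) x.
Proof. by move=> du; rewrite /hom_diff /= du. Qed.

(** Pulling the equation back along [psi] reduces it to the explicit resolution. There
    $b\,j(\mathrm{eps}\,\psi)$ differs from $b\,j(\mathrm{epsV})$, with $j$ = [jV], by the term in
    [eta], which is the boundary of a multiple of [w] since [w] has closed values. *)
Lemma res_inj n (b : B) (g : R -> N) : homog n b -> b * bas E2 = b -> diff b = 0 ->
  hom_deg n g -> (forall r, act b (jV (eps r)) = hom_diff n g r) ->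
  exists b', b = diff b'.
Proof.
have [psi [phi [eta [eta' [kappa [[hpsi _] [heta _] [dpsi _] [epsi _] _]]]]]] :=
  comparison.
move=> hb eb db hg eg.
have [jl _] := jV_linear q_not_root.
pose w r : N := act b (jV (eta r)).
have hw : hom_deg n w.
  have h : hom_deg (1 + -1) ((jV : V -> N) \o eta) :=
    hom_deg_compose jV_hom_deg heta.
  by rewrite subrr in h; have := hom_deg_comp_act actP hb h; rewrite addr0.
have hgp : hom_deg n (g \o psi) by have := hom_deg_compose hg hpsi; rewrite addr0.
apply: (R0_inj hb eb db
  (g := fun r => g (psi r) + sgz k n *: w r)).
  exact: (hom_deg_add hgp (hom_degZ (sgz k n) hw)).
move=> r; rewrite epsi (linearBf jl).
have -> : act b (jV (eps (psi r)) - jV (eta (diff r))) =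
    act b (jV (eps (psi r))) - act b (jV (eta (diff r))).
  exact: (linearBf (lact_linear actP b)).
rewrite eg (hom_diff_comp _ _ _ dpsi) /hom_diff.
have dw : diff (w r) = 0 by exact: (@act_jV_diff n b (eta r) hb db).
rewrite diffD diffZ dw scaler0 addr0 scalerDr scalerA -/(sgz k n) sgzz scale1r.
by rewrite opprD addrA.
Qed.

(** The explicit resolution handles $h\psi$, and composition with [phi] returns to [R]. Two
    corrections remain: the composite $\psi\phi$ differs from the identity by [kappa], and [epsV]
    composed with [phi] differs from [eps] by [eta']. *)
Lemma res_surj n (h : R -> N) : hom_deg n h -> hom_diff n h =1 (fun=> 0) ->
  exists b (g : R -> N), [/\ homog (n - 1) b, b * bas E2 = b, diff b = 0,
    hom_deg (n - 1) g
    & forall r, h r = (act b (jV (eps r)) : N) + hom_diff (n - 1) g r].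
Proof.
have [psi [phi [eta [eta' [kappa [[hpsi hphi] [_ heta] [dpsi dphi] [_ ephi]
  [hkappa ekappa]]]]]]] := comparison.
move=> hh dh; have [[hl _] _] := hh; pose s := sgz k n.
have [jl _] := jV_linear q_not_root.
have dh0 r : diff (h r) = s *: h (diff r).
  by have /eqP := dh r; rewrite subr_eq0 => /eqP.
have hhp : hom_deg n (h \o psi) by have := hom_deg_compose hh hpsi; rewrite addr0.
have [|b [g [hb eb db hg eg]]] := R0_surj hhp.
  by move=> r; rewrite -(hom_diff_comp _ _ _ dpsi) dh.
pose u r : N := act b (jV (eta' r)).
have hu : hom_deg (n - 1) u.
  have hj : hom_deg (1 + -1) ((jV : V -> N) \o eta') :=
    hom_deg_compose jV_hom_deg heta.
  by rewrite subrr in hj; have := hom_deg_comp_act actP hb hj; rewrite addr0.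
have hgp : hom_deg (n - 1) (g \o phi) by have := hom_deg_compose hg hphi; rewrite addr0.
have hk : hom_deg (n - 1) (h \o kappa) by apply: hom_deg_compose.
have du r : diff (u r) = 0 by exact: (@act_jV_diff _ b (eta' r) hb db).
exists b, (fun r => (g (phi r) + s *: u r) - s *: h (kappa r)); split=> //.
  apply: hom_deg_sub; last exact: (hom_degZ s hk).
  exact: (hom_deg_add hgp (hom_degZ s hu)).
move=> r.
have e1 : h r = h (psi (phi r)) - (h (diff (kappa r)) + h (kappa (diff r))).
  by rewrite -(linearDf hl) -ekappa (linearBf hl) opprB addrC subrK.
have e2 := eg (phi r); rewrite /= in e2.
have e3 : act b (jV (epsV (phi r))) = act b (jV (eps r)) + act b (jV (eta' (diff r))).
  have -> : epsV (phi r) = eps r + eta' (diff r) by rewrite ephi subrK.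
  rewrite (linearDf jl); exact: (linearDf (lact_linear actP b)).
rewrite e1 e2 e3 (hom_diff_comp _ _ _ dphi) /hom_diff -/(sgz k _) sgzB1 -/s.
rewrite !scaleNr !opprK !diffB !diffD !diffZ du scaler0 addr0 dh0.
rewrite !scalerBr !scalerDr !scalerA !sgzz !scale1r.
have -> : act b (jV (eta' (diff r))) = u (diff r) by [].
rewrite opprD -!addrA; congr (_ + _); rewrite addrCA; congr (_ + _).
by rewrite addrCA [RHS]addrCA; congr (_ + _); apply: addrCA.
Qed.

Local Notation P := (regular L * R)%type.

Definition jLam (u : L) : M := cmk (jBP q_not_root) (nu_mul1 (jBP q_not_root) u).

Lemma jLamE u : cval (jLam u) = jB u. Proof. by []. Qed.

(* The sum of the quasi-isomorphisms Lambda -> e_1 B e_1 and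
   R -> V -> e_2 B e_1. *)
Definition fP (p : P) : M := jLam (p.1 : L) + jV (eps p.2).

Lemma fP_linear : mod_linear fP.
Proof.
have [jl jA] := jV_linear q_not_root; have [e1 eA] := el.
split=> [c u v|p a]; rewrite /fP /=.
  have -> : jLam (c *: (u.1 : L) + v.1) = c *: jLam u.1 + jLam v.1.
    by apply: cval_inj; rewrite cvalD cvalZ !jLamE (nu_linear (jBP q_not_root)).
  by rewrite e1 jl scalerDr addrACA.
have -> : jLam (ract p.1 a : regular L) = ract (jLam p.1) a.
  by apply: cval_inj; rewrite cval_ract !jLamE -(nuM (jBP q_not_root)).
by rewrite eA jA ractDl.
Qed.

Lemma fP_diff p : fP (diff p) = 0.
Proof.
rewrite /fP /= (eps_diff) (linear0f (jV_linear q_not_root).1) addr0.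
have -> : diff p.1 = (0 : L) := L_diff0 _.
by apply: cval_inj; rewrite jLamE (linear0f (nu_linear (jBP q_not_root))).
Qed.

Lemma fP_coord p : cval (fP p) = (fun i => match i with
  | E1 => (p.1 : L) L1
  | AG => q * (p.1 : L) Lx
  | AD | BG => q * cq q * (p.1 : L) Lx + cq q * (p.1 : L) Ly
  | ADAG => cq q * q * (p.1 : L) Lw
  | Ga => eps p.2 V_1
  | DAG => - (q * cq q * eps p.2 V_x)
  | _ => 0 end) :> B.
Proof.
rewrite /fP cvalD jLamE jVE; apply: coordsP.
by case; rewrite coordD /jB /jV_val ?addr0 ?add0r.
Qed.

(** The bases of $\Lambda$ and $V$ go to representatives of a basis of $H(Be_1)$; in the rest of
    $Be_1$, $d$ sends $\delta$ to $\tau\gamma$ and $\beta\gamma$ to $\alpha\tau\gamma$. *)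
Lemma fP_quasi_iso : quasi_iso fP.
Proof.
have [[e1 eh ed] einj esurj] := eq.
have c0 := cq_neq0 q_not_root.
have qc0 : q * cq q != 0 by rewrite mulf_neq0.
split.
- split; first by case: fP_linear.
    move=> i [u r] [hu hr]; apply: homogD; last exact/jV_homog/eh.
    exact: (nu_homog (jBP q_not_root) hu).
  move=> p; rewrite fP_diff; apply: cval_inj; rewrite cval_diff fP_coord.
  by apply: coordsP; case=> //; rewrite -[diff _]/(@B_diff k q _) /B_diff subrr.
- move=> p dp [m em].
  have cm l : (cval (fP p) : B) l = @B_diff k q (cval m) l.
    by rewrite em.
  rewrite fP_coord in cm.
  have e_1 : eps p.2 V_1 = 0 := cm Ga.
  have e_x : eps p.2 V_x = 0.
    have /eqP := cm DAG; rewrite /B_diff oppr_eq0 mulf_eq0.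
    by rewrite (negbTE qc0) => /eqP.
  have p1 : (p.1 : L) = 0.
    have p_x : (p.1 : L) Lx = 0.
      by have /eqP := cm AG; rewrite mulf_eq0 (negbTE q_neq0) => /eqP.
    apply: coordsP; case=> //.
    + exact: (cm E1).
    + have /eqP := cm AD; rewrite p_x mulr0 add0r mulf_eq0.
      by rewrite (negbTE c0) => /eqP.
    + have /eqP := cm ADAG; rewrite mulf_eq0 mulrC (negbTE qc0).
      by move/eqP.
  have [|r er] := einj p.2 (congr1 snd dp).
    by exists 0; rewrite diff0; apply: coordsP; case.
  exists (0, r); rewrite [LHS]surjective_pairing er.
  by congr pair; rewrite /= diff0; exact: p1.
- move=> m dm.
  have dl l : @B_diff k q (cval m) l = 0.
    by rewrite -[@B_diff k q (cval m)]/(cval (diff m)) dm.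
  have mBG : cval m BG = cval m AD.
    by apply/eqP; rewrite -subr_eq0; apply/eqP/(dl ATG).
  have mDe : cval m De = 0 := dl TG.
  have me l : (cval m * bas E1 : B) l = cval m l by rewrite -(jB1 q) cval_e.
  rewrite B_mul_e1 in me.
  pose v : V := fun i => if i is V_x then - (cval m DAG / (q * cq q)) else cval m Ga.
  have [r [x [dr ex]]] := esurj v (V_diff0 v).
  have {x}ex : v = eps r by rewrite ex [diff x]V_diff0 addr0.
  pose u : L := fun i => match i with
    | L1 => cval m E1 | Lx => cval m AG / q
    | Ly => (cval m AD - cq q * cval m AG) / cq q
    | Lw => cval m ADAG / (cq q * q) end.
  (* A primitive for the part of [m] along $\tau\gamma$ and $\alpha\tau\gamma$; the other
     coordinates of [m] are matched by [u] and [r]. *)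
  pose b : B := fun i => match i with De => cval m TG | BG => cval m ATG | _ => 0 end.
  have eb : b * jB 1 = b by rewrite jB1 B_mul_e1; apply: coordsP; case.
  exists ((u : regular L), r), (cmk (jBP q_not_root) eb); split.
    by congr pair; exact: dr.
  apply: cval_inj; rewrite cvalD cval_diff cmkE fP_coord.
  rewrite -[diff b]/(@B_diff k q b) /= -ex; apply: coordsP => l.
  rewrite coordD /B_diff /b /u /v; case: l; rewrite ?addr0 ?add0r ?mDe ?mBG //.
  all: try exact: (esym (me _)).
  all: move: (cq q) c0 {qc0} => c c0; field; rewrite ?q_neq0 ?c0 //.
Qed.

Definition fP_cone : @cone_map k L P N fP := shift_cone_map (@L_diff0 k q)
  fP_linear fP_quasi_iso fP_diff.

Lemma B_e1e2 : bas E1 * bas E2 = 0.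
Proof. by rewrite B_mul_e2; apply: coordsP; case. Qed.
Lemma B_e2e1 : bas E2 * bas E1 = 0.
Proof. by rewrite B_mul_e1; apply: coordsP; case. Qed.
Lemma B_e2e2 : bas E2 * bas E2 = bas E2.
Proof. by rewrite B_mul_e2; apply: coordsP; case. Qed.
Lemma B_e1e1 : bas E1 * bas E1 = bas E1.
Proof. by rewrite B_mul_e1; apply: coordsP; case. Qed.
Lemma B_e12 : bas E1 + bas E2 = 1.
Proof.
by apply: coordsP; case; rewrite coordD /coord_basis /= ?addr0 ?add0r.
Qed.
Lemma B_diff_e1 : diff (bas E1) = 0.
Proof. by apply: coordsP; case=> //; apply: subrr. Qed.
Lemma B_diff_e2 : diff (bas E2) = 0.
Proof. by apply: coordsP; case=> //; apply: subrr. Qed.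
Lemma B_homog_e1 : homog 0 (bas E1).
Proof. exact: (@coord_basis_homog k _ B_deg E1). Qed.
Lemma B_homog_e2 : homog 0 (bas E2).
Proof. exact: (@coord_basis_homog k _ B_deg E2). Qed.

Lemma cval0 : cval (0 : M) = 0. Proof. by []. Qed.

Lemma fP_in1 : cval (fP ((1 : L) : regular L, 0)) = bas E1.
Proof.
rewrite /fP cvalD jLamE jB1 (linear0f el.1) (linear0f (jV_linear q_not_root).1).
by rewrite cval0 addr0.
Qed.

Lemma fP_in2 r : fP (0, r) = jV (eps r).
Proof.
apply: cval_inj; rewrite /fP cvalD jLamE.
by rewrite (linear0f (nu_linear (jBP q_not_root))) add0r.
Qed.

(** The decomposition $b=be_1+be_2$ follows the two summands of [P]: at the generator of $\Lambda$
    the equation exhibits $be_1$ as a boundary, and [res_inj] treats $be_2$ on [R]. *)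
Lemma fP_act_inj n (b : B) (g : P -> N) : homog n b -> diff b = 0 ->
  hom_deg n g -> (forall p, act b (fP p) = hom_diff n g p) ->
  exists b', b = diff b'.
Proof.
move=> hb db hg eg; have [[gl gA] gh] := hg.
have e1 : b * bas E1 = diff (cval (g ((1 : L) : regular L, 0) : M)).
  rewrite -fP_in1 -corner_lactE eg /hom_diff.
  have -> : diff (((1 : L) : regular L, 0) : P) = 0.
    by rewrite [LHS]/(prod_diff _) /prod_diff /= diff0; congr pair; apply: L_diff0.
  by rewrite (linear0f gl) scaler0 subr0.
have hb2 : homog n (b * bas E2) by rewrite -[n]addr0; apply: homogM B_homog_e2.
have [||||b2 e2] := res_inj hb2
    (g := fun r => g (0, r)).
- by rewrite -mulrA B_e2e2.
- by rewrite (diffM _ _ _ hb) db B_diff_e2 mul0r mulr0 scaler0 addr0.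
- split; [split=> [c u v|r a]|move=> j r hr].
  + rewrite -gl; congr g.
    by congr pair; rewrite /= scaler0 addr0.
  + rewrite -gA; congr g.
    by congr pair; rewrite /= ract0l.
  + by apply: gh; split=> //; apply: homog0.
- by move=> r; rewrite act_jV_e2 -fP_in2 eg /hom_diff.
exists (cval (g ((1 : L) : regular L, 0) : M) + b2).
by rewrite diffD -e1 -e2 -mulrDr B_e12 mulr1.
Qed.

(** The value of [h] at the generator of $\Lambda$ lies in $Be_1$ and [res_surj] supplies an element
    of $Be_2$. Their sum works because each annihilates the part of $Be_1$ that belongs to the
    other. *)
Lemma fP_act_surj n (h : P -> N) : hom_deg n h -> hom_diff n h =1 (fun=> 0) ->
  exists b (g : P -> N), [/\ homog (n - 1) b, diff b = 0, hom_deg (n - 1) g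
    & forall p, h p = (act b (fP p) : N) + hom_diff (n - 1) g p].
Proof.
move=> hh dh; have [[hl hA] hd] := hh.
have hR : hom_deg n (fun r => h (0, r)).
  split; [split=> [c u v|r a]|move=> j r hr].
  + rewrite -hl; congr h.
    by congr pair; rewrite /= scaler0 addr0.
  + rewrite -hA; congr h.
    by congr pair; rewrite /= ract0l.
  + by apply: hd; split=> //; apply: homog0.
have [|bR [g [hb eb db hg eg]]] := res_surj hR.
  by move=> r; rewrite -(dh (0, r)).
pose u : P := ((1 : L) : regular L, 0).
pose b1 : B := cval (h u : M).
have du : diff u = 0.
  by rewrite [LHS]/(prod_diff _) /prod_diff /= diff0; congr pair; apply: L_diff0.
have hu : homog 0 u by split; [apply: (@homog1 k L)|apply: homog0].
have [[gl gA] gh] := hg.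
exists (b1 + bR), (fun p => g p.2); split.
- apply: homogD => //; have := hd _ _ hu.
  by rewrite add0r.
- rewrite diffD db addr0 -[diff b1]/(cval (diff (h u) : M)).
  by have := dh u; rewrite /hom_diff du (linear0f hl) scaler0 subr0 => ->.
- split; [split=> [c x y|p a]|move=> j p [h1 h2]] => /=.
  + exact: gl.
  + exact: gA.
  + exact: gh.
move=> [a r].
have -> : h (a, r) = ract (h u) (a : L) + h (0, r).
  rewrite -hA -(linearDf hl); congr h.
  rewrite [RHS]surjective_pairing /= ract0l add0r addr0; congr pair.
  by rewrite [RHS](@mul1r L).
rewrite eg addrA; congr (_ + _); apply: cval_inj.
rewrite [RHS]corner_lactE [cval (fP _)]cvalD jLamE mulrDr !mulrDl.
rewrite [LHS]cvalD corner_lactE -[cval (ract _ _)]/(b1 * jB a).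
have b1e : b1 * bas E1 = b1 by rewrite -(jB1 q); apply: cval_e.
have -> : b1 * cval (jV (eps r)) = 0.
  by rewrite -jV_e2 -b1e mulrA -[_ * _ * bas E2]mulrA B_e1e2 mulr0 mul0r.
have -> : bR * jB a = 0.
  rewrite -eb -[a in jB a](mul1r (a : L)) (nuM (jBP q_not_root)) jB1 mulrA.
  by rewrite -[_ * _ * bas E1]mulrA B_e2e1 mulr0 mul0r.
by rewrite addr0 add0r.
Qed.

Lemma fP_hom_acyclic : hom_acyclic P (cone fP_cone).
Proof.
have ac : acyclic (cone fP_cone) by apply: cone_acyclic.
exact: (prod_hom_acyclic (regular_hom_acyclic ac) (KR ac)).
Qed.

Local Notation C := (cone fP_cone).

Lemma first_projection_hom_deg : hom_deg 0 (@first_projection k L R).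
Proof.
split; last by move=> i p [h1 _]; rewrite addr0; split=> //; apply: homog0.
by split=> [c u v|p a]; congr pair; rewrite /= ?scaler0 ?addr0 ?ract0l.
Qed.

Lemma act_e1_fP p : act (bas E1) (fP p) = fP (first_projection p).
Proof.
apply: cval_inj; rewrite corner_lactE B_e1_mul !fP_coord.
apply: coordsP; case=> //=.
- by rewrite (linear0f el.1).
- by rewrite (linear0f el.1) mulr0 oppr0.
Qed.

(** The idempotents at both ends come from one element of the roof, with base $e_1$ and with the
    projection of $P$ onto $\Lambda$ as its column. It is closed because $e_1f$ equals $f$ composed
    with that projection strictly, without a homotopy. *)
Lemma B_zigzag : zigzag (bas E1) (projection R).
Proof.
have [t [ht bt ft]] := roof_mk (fc := fP_cone) actP (regular_sum_neq0 R)
  B_homog_e1 (hom_deg_in1 fP_cone first_projection_hom_deg).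
have f0 p : rfun t ((p, 0) : C) = (first_projection p, 0).
  rewrite ft (act0r actP).
  by rewrite [_ + _](_ : _ = (first_projection p, 0) + (0 : C)) ?addr0.
have tt : t * t = t.
  apply: roof_eq => [|p].
    by rewrite rbaseM bt B_e1e1.
  by rewrite rfunM !f0.
have dt : diff t = 0.
  apply: roof_eq => [|p]; first by rewrite rbase_diff bt B_diff_e1.
  have := rfun_shift p ht.
  rewrite !f0 bt act_e1_fP sgz0 !scale1r => /eqP; rewrite -subr_eq => /eqP <-.
  rewrite rfun_zero cone_diffE; apply: pair_eq0 => /=.
    rewrite subr0; apply/eqP; rewrite subr_eq0; apply/eqP.
    by congr pair; rewrite /= diff0.
  by rewrite diff0 add0r subr0 subrr.
have ct : closed_idempotent t by split.
have b1 : bas E1 = roof_base fP_cone actP (regular_sum_neq0 R) t by rewrite -bt.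
have cP : projection R = roof_corner fP_cone actP (regular_sum_neq0 R) t.
  apply: val_inj; apply: funext => p.
  by rewrite -[RHS]/(endo_fun _ p) roof_cornerE f0.
rewrite b1 cP.
apply: (@ZigzagBackward k B _ _ (roof_base fP_cone actP (regular_sum_neq0 R)) t).
- exact: ct.
- exact/roof_base_quasi_iso/fP_hom_acyclic.
apply: (@ZigzagForward k _ _ _ (roof_corner fP_cone actP (regular_sum_neq0 R)) t).
- exact: ct.
- apply: roof_corner_quasi_iso.
  + exact: fP_act_inj.
  + exact: fP_act_surj.
apply: ZigzagNil; split.
  by rewrite -dgahM tt.
have [cl ch cd] := dgah_chain (roof_corner fP_cone actP (regular_sum_neq0 R)).
by split; [apply: ch|rewrite -cd dt (linear0f cl)].
Qed.

End Resolution.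
End Comparison.

Theorem theoremA2 (k : fieldType) (q : k) (q_neq0 : q != 0)
    (q_not_root : forall n : nat, (0 < n)%N -> q ^+ n != 1) :
  exists (B : dgAlgType k) (p : path_algebra k B_quiver -> B),
  let e1 : B := p (vertex_elt k (V1 : vertex B_quiver)) in
  let e2 : B := p (vertex_elt k (V2 : vertex B_quiver)) in
  let gamma : B := p (arrow_elt k (Gamma : arrow B_quiver)) in
  let delta : B := p (arrow_elt k (Delta : arrow B_quiver)) in
  let alpha : B := p (arrow_elt k (Alpha : arrow B_quiver)) in
  let beta : B := p (arrow_elt k (Beta : arrow B_quiver)) in
  let tau : B := p (arrow_elt k (Tau : arrow B_quiver)) in
  (presents (fun=> 1) (B_relations q) p /\
   [/\ diff beta = alpha * tau, diff delta = tau * gamma,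
       [/\ diff alpha = 0, diff gamma = 0 & diff tau = 0]
     & diff e1 = 0 /\ diff e2 = 0]) /\
  [/\ space_dim B 17,
      forall i : nat,
        subspace_dim (@homog k B i%:Z) (nth 0%N [:: 2; 5; 6; 3; 1]%N i)
    & forall i : nat, cohomology_dim B i%:Z (nth 0%N [:: 2; 3; 3; 2; 1]%N i)] /\
  (exists (Lambda : dgAlgType k) (l : path_algebra k (rose bool) -> Lambda)
          (V : dgModType Lambda) (v : Lambda -> V),
   let x : Lambda := l (arrow_elt k (false : arrow (rose bool))) in
   let y : Lambda := l (arrow_elt k (true : arrow (rose bool))) in
   [/\ presents (fun=> 2) (Lambda_relations q) l,
       forall a : Lambda, diff a = 0,
       shifted_cyclic (x + y) v
     & forall m : V, diff m = 0] /\
   (* Lambda is K-projective over itself, so Lambda + R resolves Lambda + V *)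
   (exists (R : dgModType Lambda) (eps : R -> V),
      K_projective_resolution eps) /\
   (forall (R : dgModType Lambda) (eps : R -> V),
      K_projective_resolution eps -> zigzag e1 (projection R))) /\
  (exists (C : dgAlgType k) (pi : dgAlgHom B C),
   [/\ forall c : C, exists b : B, pi b = c,
       forall b : B, pi b = 0 <-> ideal (fun r => r = e1) b,
       exists2 c : path_algebra k (rose unit) -> C,
         presents (fun=> 1) (dual_relations k) c
         & c (arrow_elt k (tt : arrow (rose unit))) = pi tau
     & forall c : C, diff c = 0] /\
   [/\ ~ acyclic (restriction pi),
       derived_hom_zero (restriction pi) (regular B)
     & exists n, space_dim (restriction pi) n]) /\
  ~ cogenerates B.
Proof.
pose bas := @coord_basis k B_basis : B_basis -> Balg q.
pose p := path_eval (B_vertex_val q) (B_arrow_val q).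
have pv v : p (vertex_elt k v) = B_vertex_val q v by apply: path_eval_vertex.
have pa a : p (arrow_elt k a) = B_arrow_val q a by apply/path_eval_arrow/B_EX.
exists (Balg q), p; rewrite !pv !pa /=; split.
  split; first exact: B_presents.
  by split; [..|split|split]; apply: coordsP; case; rewrite -[diff _]/(@B_diff k q _)
    ?B_mulE ?coord0 /B_diff /B_mul /coord_basis /=; ring.
split; first by split; [apply: B_space_dim|apply: B_homog_dim|apply: B_cohomology_dim].
split.
  exists (Lalg q), (@L_pres k q), (Vmod q), (@Vgen k q).
  rewrite L_pres_x L_pres_y; split; last split.
  - split; [exact: L_presents|exact: L_diff0|exact: V_shifted_cyclic|exact: V_diff0].
  - by exists (tel (tel_L q)), (@epsV k q); apply: epsV_resolution.
  - by move=> R eps; apply: B_zigzag.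
have dC := derived_hom_C_zero q_neq0 q_not_root; have aC := @C_not_acyclic k q.
split; last by move=> /(_ _ dC).
exists (Calg k), (B_to_C q); split.
  split; [exact: B_to_C_surj|exact: B_to_C_kernel| |exact: C_diff0].
  exists (@C_pres k); first exact: C_presents.
  by rewrite C_pres_t; apply: coordsP; case.
by split=> //; exists 2%N; apply: C_space_dim.
Qed.
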